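(* Let $n\ge2$, $0<r<\frac{1}{\sqrt n}$, and $\mathbb{D}^n_r=\{z\in\mathbb{C}^n:\ |z_i|<r,\ 1\le i\le n\}$. Then for every $z\in B^n\setminus\overline{\mathbb{D}^n_r}$, $$s_{B^n\setminus\overline{\mathbb{D}^n_r}}(z)=\tilde e_{B^n\setminus\overline{\mathbb{D}^n_r}}(z)=\min_{w\in\partial\mathbb{D}^n_r}\left[1-\frac{(1-\|w\|^2)(1-\|z\|^2)}{\left(1-\sum_{i=1}^n|z_iw_i|\right)^2}\right]^{1/2}.$$
   Context: $\|\cdot\|$ is the Euclidean norm, $B^n$ the open Euclidean unit ball in $\mathbb{C}^n$, $\mathbb{D}$ the unit disk in $\mathbb{C}$; $O(X,Y)$ is the set of holomorphic maps from $X$ into $Y$. Carathéodory pseudodistance on a domain $D$: $c_D(z,w)=\sup\{\tanh^{-1}|\lambda| : f\in O(D,\mathbb{D}),\ f(z)=0,\ f(w)=\lambda\}$, with balls $B^c_D(z,r)=\{w\in D: c_D(z,w)<r\}$. For a bounded domain $D\subset\mathbb{C}^n$ and $z\in D$: squeezing function $s_D(z)=\sup\{r>0:\ rB^n\subset f(D)$ for some injective $f\in O(D,B^n)$ with $f(z)=0\}$; Fridman invariant $\tilde e_D(z)=\sup\{\tanh(r):\ B^c_D(z,r)\subset f(B^n)$ for some injective $f\in O(B^n,D)\}$. *)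

(* Defs.v *)
From mathcomp Require Import all_boot all_order all_algebra complex.
From mathcomp Require Import all_classical all_reals all_analysis.
From mathcomp Require Import ring lra.

Set Implicit Arguments.
Unset Strict Implicit.
Unset Printing Implicit Defensive.

Import Order.TTheory GRing.Theory Num.Theory numFieldNormedType.Exports.
Local Open Scope classical_set_scope.
Local Open Scope ring_scope.

(* R[i] bundled as a numeric field: the library's topology and norm on scalars
   and matrices are attached to (sorts of) numFieldType's, not to [complex]. *)
Definition Cplx (R : realType) : numClosedFieldType := R[i].

(* Real-valued modulus; the library's [`|x|] lives in R[i] itself. *)
Definition modulus (R : realType) (x : Cplx R) : R := ComplexField.Normc.normc x.

Lemma modulusE (R : realType) (x : Cplx R) : `|x| = (modulus x)%:C%C.
Proof. by []. Qed.

Section Hyperbolic.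
Variable R : realType.
Implicit Types x : R.

Definition tanh x : R := (expR x - expR (- x)) / (expR x + expR (- x)).

Definition atanh x : R := ln ((1 + x) / (1 - x)) / 2.

Lemma atanhK x : -1 < x < 1 -> tanh (atanh x) = x.
Proof.
move=> /andP[x1 x2].
have p1 : 0 < 1 + x by rewrite -ltrBlDl sub0r.
have p2 : 0 < 1 - x by rewrite subr_gt0.
have y0 : 0 < (1 + x) / (1 - x) by rewrite divr_gt0.
rewrite /tanh expRN; set e := expR (atanh x).
have e0 : 0 < e := expR_gt0 _.
have e2 : e * e = (1 + x) / (1 - x).
  have -> : e * e = expR (ln ((1 + x) / (1 - x))).
    by rewrite /e -expRD; congr expR; rewrite /atanh; field.
  by rewrite lnK// posrE.
have -> : (e - e^-1) / (e + e^-1) = (e * e - 1) / (e * e + 1).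
  by field; rewrite !gt_eqF// addr_gt0// ?ltr01 ?mulr_gt0.
by rewrite e2; field; rewrite (gt_eqF p2) gt_eqF// addr_gt0.
Qed.

End Hyperbolic.

Section Domains.
Variable R : realType.

(* O(X, Y), for X open: maps are total functions whose values outside of X are
   irrelevant. The normed modules are over the complex field, so [differentiable]
   means that there is a C-linear Frechet derivative. On 'rV_n the library's norm
   is the sup norm, which defines the same differentiable maps as the Euclidean
   norm does. *)
Definition holomorphic_maps (V W : normedModType (Cplx R)) (X : set V)
    (Y : set W) : set (V -> W) :=
  [set f | (forall x, X x -> differentiable f x) /\ f @` X `<=` Y].

Definition unit_disk : set (Cplx R)^o := [set x | modulus x < 1].

Section Dimension.
Variable n : nat.
Implicit Types (D : set 'rV[Cplx R]_n) (z w : 'rV[Cplx R]_n) (r : R).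

Definition euclid_norm z : R := Num.sqrt (\sum_(i < n) modulus (z 0 i) ^+ 2).

Definition euclid_ball r : set 'rV[Cplx R]_n := [set z : 'rV[Cplx R]_n | euclid_norm z < r].

Definition unit_ball : set 'rV[Cplx R]_n := euclid_ball 1.

Definition polydisc r : set 'rV[Cplx R]_n :=
  [set z : 'rV[Cplx R]_n | forall i, modulus (z 0 i) < r].

Definition caratheodory D z w : \bar R :=
  ereal_sup [set (atanh (modulus (f w)))%:E | f in
    [set f : 'rV[Cplx R]_n -> (Cplx R)^o |
      holomorphic_maps D unit_disk f /\ f z = 0]].

Definition caratheodory_ball D z r : set 'rV[Cplx R]_n :=
  [set w | D w /\ (caratheodory D z w < r%:E)%E].

(* For n > 0, a bounded domain D and z in D, the sets in the next two definitions are
   nonempty and bounded above by 1, so that [sup] is their least upper bound. *)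
Definition squeezing D z : R :=
  sup [set r | 0 < r /\ exists f : 'rV[Cplx R]_n -> 'rV[Cplx R]_n,
    [/\ holomorphic_maps D unit_ball f, set_inj D f, f z = 0 &
        euclid_ball r `<=` f @` D]].

Definition fridman D z : R :=
  sup [set tanh r | r in
    [set r | 0 < r /\ exists f : 'rV[Cplx R]_n -> 'rV[Cplx R]_n,
      [/\ holomorphic_maps unit_ball D f, set_inj unit_ball f &
          caratheodory_ball D z r `<=` f @` unit_ball]]].

End Dimension.
End Domains.

Definition frontier (T : topologicalType) (A : set T) : set T :=
  closure A `\` A°.

Definition is_min (R : realType) (A : set R) (m : R) : Prop :=
  A m /\ lbound A m.

Arguments unit_ball {R n}.

(* Main.v *)
(* Let [phi] be the involutive automorphism of the ball exchanging [z] and [0], [K] the closed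
   polydisc and [D] its complement in the ball. By Hartogs, holomorphic functions on [D] extend
   to the ball, so the Schwarz lemma yields [|u| <= |phi|] for all [u] in [O(D, disc)] with
   [u z = 0]. Let [m] be the minimum of [|phi|] over [K]; it is attained at a boundary point [w],
   and rotating coordinates turns it into the minimum of the displayed expression. The maps
   [phi] and [x |-> phi (m x)] show that both invariants are at least [m]. If an injective map
   from [D] to the ball covered a ball of radius [t > m], the preimage of a slightly smaller
   closed ball would be a compact subset of [D] accumulating at [w]. If an injective map [f] from
   the ball to [D] covered [{|phi| < t}] with [t > m], its inverse would be defined near some
   open face of [K] and [|f^-1|] would tend to [1] there; a face contains discs, along which
   [f^-1] would be constant by the Schwarz-Pick lemma.
   Complex analysis is derived from the maximum principle: an exceptional set contained in the
   zeros of a function [chi] is harmless, because the principle applies to [u ^+ N * chi]. *)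
Require Import Defs.
From HB Require Import structures.
From mathcomp Require Import all_boot all_order all_algebra complex.
From mathcomp Require Import all_classical all_reals all_analysis.
From mathcomp Require Import zify ring lra.
Import Order.TTheory GRing.Theory Num.Theory numFieldNormedType.Exports.
Local Open Scope classical_set_scope.
Local Open Scope ring_scope.
Set Implicit Arguments.
Unset Strict Implicit.
Unset Printing Implicit Defensive.
Import complex.

(** * Real-valued norms *)

Section RealNorm.
Context {R : realType}.
Local Notation C := (Cplx R).

(** No contour integral and no analytic set is used. Goursat's theorem is proved for trapezoidal
    sums; only inequalities are extracted from it, with wasteful constants that disappear when they
    are applied to powers of the function. The main obstacle is the inverse of an injective
    holomorphic map: nothing rules out beforehand that the Jacobian vanishes somewhere. Hence the
    markers [chi]. They are the variable itself, for difference quotients; the Jacobian determinant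
    transported to the image, for inverses; products of rotates, to show that a marker with an open
    set of zeros vanishes at the centre as well. In Hartogs' extension, quotients of sums over roots
    of unity stand in for the Cauchy integral. The hypothesis r < 1/sqrt n leaves a margin between
    the closed polydisc and the sphere, where the extension takes place; a second coordinate is
    needed both there and for the discs in a face. *)

Definition rnorm (V : normedModType C) (v : V) : R := complex.Re (`|v| : R[i]).
End RealNorm.
Notation "⟦ x ⟧" := (rnorm x) (at level 0, x at level 99, format "⟦ x ⟧").

Section RealNormTheory.
Context {R : realType}.
Local Notation C := (Cplx R).
Implicit Types (V W : normedModType C).

Lemma rnormE V (v : V) : `|v| = (⟦v⟧)%:C%C.
Proof. by rewrite /rnorm RRe_real// ger0_real// normr_ge0. Qed.

Lemma rnorm_modulus (x : C) : ⟦x⟧ = modulus x.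
Proof. by []. Qed.

Lemma ltrC (a b : R) : ((a%:C%C : C) < b%:C%C) = (a < b).
Proof. exact: ltcR. Qed.

Lemma lerC (a b : R) : ((a%:C%C : C) <= b%:C%C) = (a <= b).
Proof. exact: lecR. Qed.

Lemma rnorm_ge0 V (v : V) : 0 <= ⟦v⟧.
Proof. by rewrite -lerC -rnormE normr_ge0. Qed.

Lemma rnormD V (v w : V) : ⟦v + w⟧ <= ⟦v⟧ + ⟦w⟧.
Proof. by rewrite -lerC -rnormE (le_trans (ler_normD _ _))// !rnormE -rmorphD. Qed.

Lemma rnormN V (v : V) : ⟦- v⟧ = ⟦v⟧.
Proof. by rewrite /rnorm normrN. Qed.

Lemma rnormB V (v w : V) : ⟦v - w⟧ <= ⟦v⟧ + ⟦w⟧.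
Proof. by rewrite -(rnormN w) rnormD. Qed.

Lemma rdistC V (v w : V) : ⟦v - w⟧ = ⟦w - v⟧.
Proof. by rewrite -rnormN opprB. Qed.

Lemma rdistT V (u v w : V) : ⟦u - w⟧ <= ⟦u - v⟧ + ⟦v - w⟧.
Proof. by rewrite -(subrKA v) rnormD. Qed.

Lemma rnorm_dist V (v w : V) : ⟦v⟧ <= ⟦w⟧ + ⟦v - w⟧.
Proof. by have := rnormD w (v - w); rewrite subrKC. Qed.

Lemma rnorm0 V : ⟦0 : V⟧ = 0.
Proof. by rewrite /rnorm normr0. Qed.

Lemma rnorm_eq0 V (v : V) : (⟦v⟧ == 0) = (v == 0).
Proof.
apply/eqP/eqP => [v0|->]; last exact: rnorm0.
by apply/eqP; rewrite -normr_eq0 rnormE v0.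
Qed.

Lemma rnorm_gt0 V (v : V) : (0 < ⟦v⟧) = (v != 0).
Proof. by rewrite lt_def rnorm_eq0 rnorm_ge0 andbT. Qed.

Lemma rnormM (x y : C) : ⟦x * y⟧ = ⟦x⟧ * ⟦y⟧.
Proof. exact: ComplexField.Normc.normcM. Qed.

Lemma rnorm1 : ⟦1 : C⟧ = 1.
Proof. exact: ComplexField.Normc.normc1. Qed.

Lemma rnormV (x : C) : ⟦x^-1⟧ = ⟦x⟧^-1.
Proof. exact: ComplexField.Normc.normcV. Qed.

Lemma rnormX (x : C) n : ⟦x ^+ n⟧ = ⟦x⟧ ^+ n.
Proof. by elim: n => [|n IH]; rewrite ?expr0 ?rnorm1// !exprS rnormM IH. Qed.

Lemma rnormZ V (a : C) (v : V) : ⟦a *: v⟧ = ⟦a⟧ * ⟦v⟧.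
Proof.
apply: (@complexI R); rewrite -rnormE normrZ.
by rewrite [`|v|]rnormE [`|a|]rnormE rmorphM.
Qed.

Lemma rnormC (a : R) : ⟦a%:C%C : C⟧ = `|a|.
Proof. by rewrite rnorm_modulus /modulus /= expr0n addr0 sqrtr_sqr. Qed.

Lemma rnorm_sqr (x : C) : ⟦x⟧ ^+ 2 = complex.Re x ^+ 2 + complex.Im x ^+ 2.
Proof.
case: x => a b; rewrite rnorm_modulus /modulus /ComplexField.Normc.normc /=.
by rewrite sqr_sqrtr// addr_ge0 ?sqr_ge0.
Qed.

Lemma Re_rnorm (x : C) : `|complex.Re x| <= ⟦x⟧.
Proof.
rewrite -(@ler_pXn2r _ 2) ?nnegrE ?rnorm_ge0//.
by rewrite rnorm_sqr real_normK ?num_real// lerDl sqr_ge0.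
Qed.

Lemma Im_rnorm (x : C) : `|complex.Im x| <= ⟦x⟧.
Proof.
rewrite -(@ler_pXn2r _ 2) ?nnegrE ?rnorm_ge0//.
by rewrite rnorm_sqr real_normK ?num_real// lerDr sqr_ge0.
Qed.

Lemma rnorm_ReIm (x : C) : ⟦x⟧ <= `|complex.Re x| + `|complex.Im x|.
Proof.
rewrite -(@ler_pXn2r _ 2) ?nnegrE ?rnorm_ge0 ?addr_ge0//.
rewrite rnorm_sqr sqrrD !real_normK ?num_real// lerD2r lerDl.
by rewrite mulrn_wge0// mulr_ge0.
Qed.

(** Radii of balls live in [R[i]], but a positive element of [R[i]] is real; from here on all
    estimates use real radii. *)
Lemma nbhsC V (x : V) (A : set V) :
  nbhs x A <-> exists2 d : R, 0 < d & forall y, ⟦y - x⟧ < d -> A y.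
Proof.
split=> [/nbhs_normP[e /= e0 eA]|[d d0 dA]].
  have eE : e = ((complex.Re e)%:C%C : C) by rewrite RRe_real// gtr0_real.
  exists (complex.Re e) => [|y yx]; first by rewrite -ltrC -eE.
  by apply: eA => /=; rewrite eE distrC rnormE ltrC.
apply/nbhs_normP; exists (d%:C%C : C) => /=; first by rewrite ltrC.
by move=> y /=; rewrite distrC rnormE ltrC => /dA.
Qed.

Lemma near_rnorm V (x : V) (d : R) : 0 < d -> \forall y \near x, ⟦y - x⟧ < d.
Proof. by move=> d0; apply/nbhsC; exists d. Qed.

Lemma continuousC V W (f : V -> W) x : {for x, continuous f} <->
  forall e : R, 0 < e -> \forall y \near x, ⟦f y - f x⟧ < e.
Proof.
split=> [fc e e0|fc].
  by apply: (fc [set w | ⟦w - f x⟧ < e]); apply/nbhsC; exists e.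
by move=> A /nbhsC[e e0 eA]; apply: filterS (fc e e0) => y /eA.
Qed.

Lemma rnorm_continuous V : continuous (@rnorm R V).
Proof.
move=> x; apply/(@cvgrPdist_lt R R^o) => e e0.
near=> y; rewrite ltr_norml; apply/andP; split.
  have := rnorm_dist y x.
  have : ⟦y - x⟧ < e by near: y; exact: near_rnorm.
  lra.
have := rnorm_dist x y; rewrite rdistC.
have : ⟦y - x⟧ < e by near: y; exact: near_rnorm.
lra.
Unshelve. all: by end_near. Qed.

Lemma continuous_rnorm (T : topologicalType) V (f : T -> V) x :
  {for x, continuous f} -> {for x, continuous (fun y => ⟦f y⟧)}.
Proof. by move=> fc; apply: (@continuous_comp _ _ _ f); [|apply: rnorm_continuous]. Qed.

Lemma diff_rnorm V W (f : V -> W) x : differentiable f x -> forall e : R, 0 < e ->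
  \forall h \near (0 : V), ⟦f (x + h) - f x - 'd f x h⟧ <= e * ⟦h⟧.
Proof.
move=> df e e0; have := diff_locallyxC df.
set o := (X in forall h, _ = _ + X h) => fE.
have /(_ (e%:C%C : C)) : forall e : C, 0 < e -> \forall h \near (0 : V), `|o h| <= e * `|h|.
  by move=> e' e'0; apply: littleoP.
rewrite ltrC => /(_ e0); apply: filterS => h.
rewrite fE -[X in ⟦X⟧ <= _]addrA -opprD addrC addKr.
by rewrite !rnormE -rmorphM lerC.
Qed.

Lemma differentiableC V W (f : V -> W) x : differentiable f x <->
  exists L : {linear V -> W}, continuous L /\ forall e : R, 0 < e ->
   \forall h \near (0 : V), ⟦f (x + h) - f x - L h⟧ <= e * ⟦h⟧.
Proof.
split=> [df|[L [Lc fL]]].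
  by exists ('d f x); split=> [|e]; [exact: diff_continuous|exact: diff_rnorm].
have fo : f \o shift x = cst (f x) + L +o_ (0 : V) id.
  apply/eqaddoP => e e0.
  have eE : e = ((complex.Re e)%:C%C : C) by rewrite RRe_real// gtr0_real.
  have /fL : 0 < complex.Re e by rewrite -ltrC -eE.
  apply: filterS => h; rewrite /= !fctE /= [h + x]addrC opprD addrA.
  by rewrite eE [in X in _ -> X]rnormE [`|h|]rnormE -rmorphM lerC.
have dL := diff_unique Lc fo.
by apply/diff_locallyP; rewrite dL.
Unshelve. all: by end_near. Qed.

End RealNormTheory.

(** * Compactness of discs and polydiscs, extreme values *)

Section Compactness.
Context {R : realType}.
Local Notation C := (Cplx R).
Implicit Types (V W : normedModType C).

Lemma EVT_compact (T : topologicalType) (f : T -> R) (A : set T) :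
  A !=set0 -> compact A -> (forall x, A x -> {for x, continuous f}) ->
  exists2 c, A c & forall t, A t -> f t <= f c.
Proof.
move=> A0 cA fc.
have [c] := compact_EVT_max A0 cA (continuous_in_subspaceT (fun x xA => fc x (set_mem xA))).
by move=> /set_mem Ac cmax; exists c => // t At; apply/cmax/mem_set.
Qed.

Lemma closed_rnorm_le (T : topologicalType) V (f : T -> V) (a : R) :
  continuous f -> closed [set x | ⟦f x⟧ <= a].
Proof.
move=> fc; rewrite [X in closed X](_ : _ = (fun x => ⟦f x⟧) @^-1` [set x | x <= a])//.
by apply: closed_comp (@closed_le _ a) => x _; apply: continuous_rnorm; exact: fc.
Qed.

Lemma closed_rnorm_ge (T : topologicalType) V (f : T -> V) (a : R) :
  continuous f -> closed [set x | a <= ⟦f x⟧].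
Proof.
move=> fc; rewrite [X in closed X](_ : _ = (fun x => ⟦f x⟧) @^-1` [set x | a <= x])//.
by apply: closed_comp (@closed_ge _ a) => x _; apply: continuous_rnorm; exact: fc.
Qed.

Lemma subr_continuous V (c : V) : continuous (fun x : V => x - c).
Proof. by move=> x; apply: cvgB; [exact: cvg_id|exact: cvg_cst]. Qed.

(** The disc is a closed subset of a square, which is a continuous image of a product of two real
    segments. *)
Lemma disc_compact (c : C) (r : R) : compact [set x : C | ⟦x - c⟧ <= r].
Proof.
pose f (p : R * R) : C := c + (p.1 +i* p.2)%C.
have fc : continuous f.
  move=> p A /nbhsC[e e0 eA].
  have e2 : 0 < e / 2 by rewrite divr_gt0.
  have n1 : \forall q \near p, `|q.1 - p.1| < e / 2.
    have /(@cvgrPdist_lt R R^o) /(_ _ e2) : (@fst R R) q @[q --> p] --> p.1.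
      exact: (@cvg_fst _ _ (nbhs p.1) (nbhs p.2)).
    by apply: filterS => q; rewrite distrC.
  have n2 : \forall q \near p, `|q.2 - p.2| < e / 2.
    have /(@cvgrPdist_lt R R^o) /(_ _ e2) : (@snd R R) q @[q --> p] --> p.2.
      exact: (@cvg_snd _ _ (nbhs p.1) (nbhs p.2)).
    by apply: filterS => q; rewrite distrC.
  apply: filterS2 n1 n2 => q q1 q2; apply: eA.
  rewrite /f opprD addrACA subrr add0r (le_lt_trans (rnorm_ReIm _))//=.
  lra.
have sc := @segment_compact R (- r) r.
apply: subclosed_compact (continuous_compact (continuous_subspaceT fc) (compact_setX sc sc)) _.
  by apply: closed_rnorm_le; exact: subr_continuous.
move=> x /= xr; exists (complex.Re (x - c), complex.Im (x - c)).
  rewrite /= !in_itv/= -!ler_norml.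
  by rewrite (le_trans (Re_rnorm _))//= (le_trans (Im_rnorm _)).
by rewrite /f /=; case: (x - c) (subrKC c x) => a b.
Qed.

Variable n : nat.
Implicit Types v : 'rV[C]_n.

Lemma rnorm_coord v i : ⟦v 0 i⟧ <= ⟦v⟧.
Proof.
rewrite -lerC -!rnormE [leRHS]/Num.norm /= mx_normE -[leLHS]nngE num_le.
exact: (@le_bigmax _ _ _ _ (fun j : 'I_1 * 'I_n => `|v j.1 j.2|%:nng) (0, i)).
Qed.

Lemma rnorm_row_le v (a : R) : 0 <= a -> (forall i, ⟦v 0 i⟧ <= a) -> ⟦v⟧ <= a.
Proof.
move=> a0 va; have [/eqP|v0] := eqVneq (mx_norm v) 0.
  by move=> /eqP /mx_norm_eq0 ->; rewrite rnorm0.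
have [[i j] /= vij] := mx_norm_neq0 v0.
rewrite -lerC -rnormE [leLHS]/Num.norm /= vij rnormE lerC.
by move: i {vij} => i; rewrite ord1.
Qed.

Lemma coord_differentiable i (v : 'rV[C]_n) :
  differentiable (fun v : 'rV[C]_n => v 0 i) v.
Proof. exact: differentiable_coord. Qed.

Lemma coord_continuous i : continuous (fun v : 'rV[C]_n => v 0 i).
Proof. by move=> v; apply/differentiable_continuous/coord_differentiable. Qed.

Lemma cball_compact (c : 'rV[C]_n) (r : R) : compact [set v : 'rV[C]_n | ⟦v - c⟧ <= r].
Proof.
apply: subclosed_compact (@rV_compact C n (fun i => [set x | ⟦x - c 0 i⟧ <= r]) _) _.
- by apply: closed_rnorm_le; exact: subr_continuous.
- by move=> i; exact: disc_compact.
- move=> v /= vr i; apply: le_trans vr.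
  by have := rnorm_coord (v - c) i; rewrite !mxE.
Qed.

Lemma compact_image_closed V W (f : V -> W) (A : set V) :
  compact A -> (forall x, A x -> {for x, continuous f}) -> closed (f @` A).
Proof.
move=> cA fc; apply: compact_closed; first exact: norm_hausdorff.
by apply: continuous_compact cA; apply: continuous_in_subspaceT => x /set_mem /fc.
Qed.

End Compactness.
Arguments disc_compact {R} c r.
Arguments cball_compact {R n} c r.

Section DifferentiableFun.
Context {K : numFieldType} {V : normedModType K}.
Implicit Types (f g : V -> K) (x : V).

Lemma dif_id (W : normedModType K) (x : W) : differentiable (fun y : W => y) x.
Proof. exact: ex_diff. Qed.

Lemma dif_cst (W W' : normedModType K) (c : W') (x : W) : differentiable (fun=> c) x.
Proof. exact: differentiable_cst. Qed.

Lemma dif_add f g x : differentiable f x -> differentiable g x ->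
  differentiable (fun y => f y + g y) x.
Proof. exact: differentiableD. Qed.

Lemma dif_sub f g x : differentiable f x -> differentiable g x ->
  differentiable (fun y => f y - g y) x.
Proof. exact: differentiableB. Qed.

Lemma dif_mul f g x : differentiable f x -> differentiable g x ->
  differentiable (fun y => f y * g y) x.
Proof. exact: differentiableM. Qed.

Lemma dif_exp f n x : differentiable f x -> differentiable (fun y => f y ^+ n) x.
Proof.
move=> df; elim: n => [|n IH]; first exact: differentiable_cst.
under eq_fun do rewrite exprS.
exact: dif_mul.
Qed.

Lemma dif_inv f x : differentiable f x -> f x != 0 -> differentiable (fun y => (f y)^-1) x.
Proof. exact: differentiableV. Qed.

Lemma dif_sum n (f : 'I_n -> V -> K) x : (forall i, differentiable (f i) x) ->
  differentiable (fun y => \sum_i f i y) x.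
Proof. by move=> /differentiable_sum; rewrite fct_sumE. Qed.

End DifferentiableFun.

(** * Trapezoidal sums and Goursat's theorem *)

Section Trapezoid.
Context {R : realType}.
Local Notation C := (Cplx R).
Implicit Types (u v : C -> C) (a b c x : C).

(** Trapezoidal sum with 2^k pieces for the integral of [u] from [a] to [b]. The recursion bisects
    the segment, so refinement by one level is a definitional splitting at the midpoint. *)
Fixpoint trap k u a b : C :=
  if k is k'.+1 then trap k' u a ((a + b) / 2) + trap k' u ((a + b) / 2) b
  else (u a + u b) / 2 * (b - a).

Lemma trap_sym k u a b : trap k u b a = - trap k u a b.
Proof.
elim: k a b => [|k IH] a b /=.
  by rewrite -(opprB b) mulrN addrC.
by rewrite [b + a]addrC (IH _ b) (IH a) opprD [LHS]addrC.
Qed.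

Lemma trapD k u v a b :
  trap k (fun x => u x + v x) a b = trap k u a b + trap k v a b.
Proof. by elim: k a b => [|k IH] a b /=; [ring|rewrite !IH; ring]. Qed.

Lemma trapZ k u c a b : trap k (fun x => c * u x) a b = c * trap k u a b.
Proof. by elim: k a b => [|k IH] a b /=; [ring|rewrite !IH; ring]. Qed.

(** The trapezoidal rule is exact on affine integrands, so their sums over closed contours vanish at
    every level, without passing to a limit. *)
Lemma trap_affine k c d a b :
  trap k (fun x => c + d * x) a b = c * (b - a) + d * (b ^+ 2 - a ^+ 2) / 2.
Proof. by elim: k a b => [|k IH] a b /=; [field|rewrite !IH; field]. Qed.

Lemma eq_trap k u v a b : u =1 v -> trap k u a b = trap k v a b.
Proof. by move=> uv; elim: k a b => [|k IH] a b /=; rewrite ?IH ?uv. Qed.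

Definition midpoint_closed (P : set C) := forall x y, P x -> P y -> P ((x + y) / 2).

(** The nodes arise from the end points by taking midpoints, so closure of [P] under midpoints does
    the work of convexity. *)
Lemma trap_le k u a b (P : set C) (M : R) : midpoint_closed P ->
  (forall x, P x -> ⟦u x⟧ <= M) -> P a -> P b -> ⟦trap k u a b⟧ <= M * ⟦b - a⟧.
Proof.
move=> Pm PM; have r2 : ⟦(2^-1 : C)⟧ = 2^-1 :> R.
  have -> : (2^-1 : C) = (2^-1%R)%:C%C by rewrite fmorphV rmorphMn.
  by rewrite rnormC ger0_norm// invr_ge0.
elim: k a b => [|k IH] a b Pa Pb /=.
  rewrite !rnormM ler_wpM2r ?rnorm_ge0// r2 ler_pdivrMr//.
  by rewrite (le_trans (rnormD _ _))// mulr_natr mulr2n lerD ?PM.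
have Pc := Pm _ _ Pa Pb; apply: le_trans (rnormD _ _) _.
have -> : ⟦b - a⟧ = ⟦(a + b) / 2 - a⟧ + ⟦b - (a + b) / 2⟧.
  have -> : (a + b) / 2 - a = (b - a) * 2^-1 by field.
  have -> : b - (a + b) / 2 = (b - a) * 2^-1 by field.
  rewrite rnormM r2; lra.
by rewrite mulrDr lerD ?IH.
Qed.

Local Notation I := ('i%C : C).

(** Contour sum, counterclockwise, over the square with lower left corner [a] and side [d]. *)
Definition sqint k u a d : C :=
  trap k u a (a + d) + trap k u (a + d) (a + d + I * d)
  + trap k u (a + d + I * d) (a + I * d) + trap k u (a + I * d) a.

Lemma sqintD k u v a d :
  sqint k (fun x => u x + v x) a d = sqint k u a d + sqint k v a d.
Proof. by rewrite /sqint !trapD; ring. Qed.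

Lemma sqintZ k u c a d : sqint k (fun x => c * u x) a d = c * sqint k u a d.
Proof. by rewrite /sqint !trapZ; ring. Qed.

Lemma sqint_affine k b c a d : sqint k (fun x => b + c * x) a d = 0.
Proof. by rewrite /sqint !trap_affine; field. Qed.

Lemma eq_sqint k u v a d : u =1 v -> sqint k u a d = sqint k v a d.
Proof. by move=> uv; rewrite /sqint !(eq_trap k _ _ uv). Qed.

(** The inner edges of the four quarters cancel, and the outer ones are the bisected sides. The
    identity is exact at every level. *)
Lemma sqint_split k u a d : sqint k.+1 u a d =
  sqint k u a (d / 2) + sqint k u (a + d / 2) (d / 2)
  + sqint k u (a + I * (d / 2)) (d / 2)
  + sqint k u (a + d / 2 + I * (d / 2)) (d / 2).
Proof.
rewrite /sqint /=.
have -> : (a + (a + d)) / 2 = a + d / 2 by field.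
have -> : (a + d + (a + d + I * d)) / 2 = a + d + I * (d / 2) by field.
have -> : (a + d + I * d + (a + I * d)) / 2 = a + d / 2 + I * d by field.
have -> : (a + I * d + a) / 2 = a + I * (d / 2) by field.
have -> : a + d / 2 + d / 2 = a + d by field.
have -> : a + I * (d / 2) + d / 2 = a + d / 2 + I * (d / 2) by field.
have -> : a + I * (d / 2) + I * (d / 2) = a + I * d by field.
have -> : a + d / 2 + I * (d / 2) + d / 2 = a + d + I * (d / 2) by field.
have -> : a + d + I * (d / 2) + I * (d / 2) = a + d + I * d by field.
have -> : a + d / 2 + I * (d / 2) + I * (d / 2) = a + d / 2 + I * d by field.
rewrite [trap k u (a + d / 2 + I * (d / 2)) (a + d / 2)]trap_sym.
rewrite [trap k u (a + d / 2 + I * (d / 2)) (a + I * (d / 2))]trap_sym.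
rewrite [trap k u (a + d + I * (d / 2)) (a + d / 2 + I * (d / 2))]trap_sym.
rewrite [trap k u (a + d / 2 + I * d) (a + d / 2 + I * (d / 2))]trap_sym.
ring.
Qed.

End Trapezoid.

(** * Null sequences and comparison of powers *)

Section NullSequences.
Context {R : realType}.
Local Notation C := (Cplx R).

Definition null_seq (t : nat -> C) := forall e : R, 0 < e -> \forall k \near \oo, ⟦t k⟧ <= e.

Lemma null_seqD t1 t2 : null_seq t1 -> null_seq t2 -> null_seq (fun k => t1 k + t2 k).
Proof.
move=> n1 n2 e e0; have e2 : 0 < e / 2 by rewrite divr_gt0.
apply: filterS2 (n1 _ e2) (n2 _ e2) => k k1 k2.
by rewrite (le_trans (rnormD _ _))//; lra.
Qed.

Lemma null_seqS t : null_seq t -> null_seq (fun k => t k.+1).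
Proof. by move=> n1 e /n1 [K _ KP]; exists K => // k /= Kk; apply: KP => /=; rewrite leqW. Qed.

(** Constant factors disappear on taking N-th roots. This is how a bound with a wasteful constant,
    applied to all powers, becomes sharp. *)
Lemma expr_le_all (a b x y : R) : 0 < a -> 0 <= x -> 0 <= y ->
  (forall N, a * x ^+ N <= b * y ^+ N) -> x <= y.
Proof.
move=> a0 x0 y0 H; rewrite leNgt; apply/negP => yx.
have xp : 0 < x := le_lt_trans y0 yx.
have := @cvg_geometric R b (y / x).
rewrite ger0_norm ?divr_ge0// ltr_pdivrMr// mul1r => /(_ yx).
move=> /(@cvgrPdist_lt R R^o)/(_ _ a0)[N _ /(_ N (leqnn N))].
rewrite sub0r normrN /geometric /= expr_div_n => /(le_lt_trans (ler_norm _)).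
rewrite mulrA ltr_pdivrMr ?exprn_gt0//.
by move=> /lt_le_trans/(_ (H N)); rewrite ltxx.
Qed.
End NullSequences.

Section Goursat.
Context {R : realType}.
Local Notation C := (Cplx R).
Local Notation I := ('i%C : C).
Local Notation Re := (@complex.Re R).
Local Notation Im := (@complex.Im R).
Implicit Types (u v : C -> C) (a b c x : C) (l s : R).

Lemma ReD x y : Re (x + y) = Re x + Re y. Proof. by case: x y => ? ? []. Qed.
Lemma ImD x y : Im (x + y) = Im x + Im y. Proof. by case: x y => ? ? []. Qed.
Lemma ReN x : Re (- x) = - Re x. Proof. by case: x. Qed.
Lemma ImN x : Im (- x) = - Im x. Proof. by case: x. Qed.
Lemma ReC l : Re (l%:C)%C = l. Proof. by []. Qed.
Lemma ImC l : Im (l%:C)%C = 0. Proof. by []. Qed.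
Lemma ReI x : Re (I * x) = - Im x. Proof. by case: x => ? ? /=; ring. Qed.
Lemma ImI x : Im (I * x) = Re x. Proof. by case: x => ? ? /=; ring. Qed.
Lemma ReZ l x : Re ((l%:C)%C * x) = l * Re x. Proof. by case: x => ? ? /=; ring. Qed.
Lemma ImZ l x : Im ((l%:C)%C * x) = l * Im x. Proof. by case: x => ? ? /=; ring. Qed.
Lemma half_realC : (2^-1 : C) = (2^-1%R)%:C%C. Proof. by rewrite fmorphV rmorphMn. Qed.
Lemma Re_half x : Re (x / 2) = Re x / 2.
Proof. by rewrite half_realC mulrC ReZ mulrC. Qed.
Lemma Im_half x : Im (x / 2) = Im x / 2.
Proof. by rewrite half_realC mulrC ImZ mulrC. Qed.
Definition ReImE := (ReD, ImD, ReN, ImN, ReI, ImI, ReC, ImC, Re_half, Im_half).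

Lemma rnormI x : ⟦I * x⟧ = ⟦x⟧.
Proof.
rewrite rnormM (_ : ⟦I⟧ = 1) ?mul1r//.
by apply/eqP; rewrite -(@eqrXn2 _ 2) ?rnorm_ge0// rnorm_sqr /= expr0n add0r.
Qed.

Definition in_square a l x := 0 <= Re (x - a) <= l /\ 0 <= Im (x - a) <= l.

Lemma differentiable1P u x : differentiable u x -> exists a, forall e : R, 0 < e ->
  \forall h \near (0 : C), ⟦u (x + h) - u x - a * h⟧ <= e * ⟦h⟧.
Proof.
move=> /differentiableC[L [_ H]]; exists (L 1) => e /H; apply: filterS => h.
suff -> : L h = L 1 * h by [].
by rewrite -[in LHS](mulr1 h) [LHS](linearZ_LR L h 1) [LHS]mulrC.
Qed.

Lemma in_square_mid a l : midpoint_closed (in_square a l).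
Proof. by move=> x y; rewrite /in_square !ReImE; lra. Qed.

Lemma sqint_le k u a l (M : R) : 0 <= l -> (forall x, in_square a l x -> ⟦u x⟧ <= M) ->
  ⟦sqint k u a (l%:C)%C⟧ <= 4 * M * l.
Proof.
move=> l0 uM.
have nl : ⟦(l%:C)%C : C⟧ = l by rewrite rnormC ger0_norm.
have side p q : in_square a l p -> in_square a l q -> ⟦q - p⟧ = l ->
    ⟦trap k u p q⟧ <= M * l.
  by move=> pS qS <-; apply: (trap_le _ (@in_square_mid a l)).
have s1 : ⟦trap k u a (a + (l%:C)%C)⟧ <= M * l.
  apply: side; try (rewrite /in_square !ReImE; lra).
  by rewrite addrC addKr.
have s2 : ⟦trap k u (a + (l%:C)%C) (a + (l%:C)%C + I * (l%:C)%C)⟧ <= M * l.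
  apply: side; try (rewrite /in_square !ReImE; lra).
  by rewrite addrC addKr rnormI.
have s3 : ⟦trap k u (a + (l%:C)%C + I * (l%:C)%C) (a + I * (l%:C)%C)⟧ <= M * l.
  apply: side; try (rewrite /in_square !ReImE; lra).
  by rewrite rdistC (_ : _ - _ = (l%:C)%C)//; ring.
have s4 : ⟦trap k u (a + I * (l%:C)%C) a⟧ <= M * l.
  apply: side; try (rewrite /in_square !ReImE; lra).
  by rewrite rdistC addrC addKr rnormI.
rewrite /sqint.
have := rnormD (trap k u a (a + (l%:C)%C)) (trap k u (a + (l%:C)%C) (a + (l%:C)%C + I * (l%:C)%C)).
set A := _ + _; have := rnormD A (trap k u (a + (l%:C)%C + I * (l%:C)%C) (a + I * (l%:C)%C)).
set B := _ + _; have := rnormD B (trap k u (a + I * (l%:C)%C) a).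
lra.
Qed.

(** Goursat's subdivision argument, with the contour integral replaced by the trapezoidal sums at
    all large levels. *)
Lemma goursat u a l : 0 < l -> (forall x, in_square a l x -> differentiable u x) ->
  null_seq (fun k => sqint k u a (l%:C)%C).
Proof.
move=> l0 udiff e0 e00; apply: contrapT.
pose e := e0 / l ^+ 2; have ep : 0 < e by rewrite divr_gt0// exprn_gt0.
have -> : e0 = e * l ^+ 2 by rewrite divfK// gt_eqF// exprn_gt0.
(* The bound is proportional to the area, so a square is good as soon as its four quarters are. *)
pose good b m := \forall k \near \oo, ⟦sqint k u b (m%:C)%C⟧ <= e * m ^+ 2.
move=> bad0; have {bad0} bad : ~ good a l := bad0.
(* The conditions stand inside the existential, so that choice gives a total function that can be
   iterated. *)
have step (p : C * R) : exists b, 0 < p.2 -> ~ good p.1 p.2 ->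
    ~ good b (p.2 / 2) /\ in_square p.1 (p.2 / 2) b.
  case: p => b m /=.
  have [[m0 ng]|ng] := pselect (0 < m /\ ~ good b m); last first.
    by exists b => m0 ng'; case: ng.
  apply: contrapT => H; apply: ng.
  have {}H b' : in_square b (m / 2) b' -> good b' (m / 2).
    by move=> Hb; apply: contrapT => ng; apply: H; exists b'.
  have mC : ((m / 2)%:C)%C = (m%:C)%C / 2 :> C by rewrite rmorphM /= -half_realC.
  have g1 : good b (m / 2) by apply: H; rewrite /in_square !ReImE; lra.
  have g2 : good (b + ((m / 2)%:C)%C) (m / 2) by apply: H; rewrite /in_square !ReImE; lra.
  have g3 : good (b + I * ((m / 2)%:C)%C) (m / 2) by apply: H; rewrite /in_square !ReImE; lra.
  have g4 : good (b + ((m / 2)%:C)%C + I * ((m / 2)%:C)%C) (m / 2).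
    by apply: H; rewrite /in_square !ReImE; lra.
  have := filterI (filterI g1 g2) (filterI g3 g4).
  (* Level k + 1 on a square is level k on its quarters, hence the shift. *)
  move=> [K _ KP]; exists K.+1 => // -[//|k] /= Kk.
  have [[+ +] [+ +]] := KP k Kk; rewrite sqint_split !mC.
  set A := sqint _ _ _ _; set B := sqint _ _ _ _.
  set A' := sqint _ _ _ _; set B' := sqint _ _ _ _.
  move=> h1 h2 h3 h4.
  have := rnormD (A + B + A') B'; have := rnormD (A + B) A'; have := rnormD A B.
  have : e * (m / 2) ^+ 2 = e * m ^+ 2 / 4 by field.
  lra.
have /choice[f fP] := step.
pose s k := iter k (fun p => (f p, p.2 / 2)) (a, l).
have s2 k : (s k).2 = l / 2 ^+ k.
  elim: k => [|k IH]; first by rewrite expr0 divr1.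
  by rewrite /s iterS -/(s k) /= IH exprS; field; rewrite expf_neq0.
have l2 k : 0 < l / 2 ^+ k by rewrite divr_gt0// exprn_gt0.
have sp k : 0 < (s k).2 by rewrite s2.
have sbad k : ~ good (s k).1 (s k).2.
  elim: k => [//|k IH].
  by have [] := fP (s k) (sp k) IH.
have sin k : in_square (s k).1 ((s k).2 / 2) (s k.+1).1.
  by have [] := fP (s k) (sp k) (sbad k).
have nest j k : (j <= k)%N ->
    0 <= Re ((s k).1 - (s j).1) <= (s j).2 - (s k).2 /\
    0 <= Im ((s k).1 - (s j).1) <= (s j).2 - (s k).2.
  elim: k => [|k IH]; first by rewrite leqn0 => /eqP ->; rewrite !ReImE !subrr lexx.
  rewrite leq_eqVlt => /predU1P[->|/IH]; first by rewrite !ReImE !subrr lexx.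
  have := sin k; rewrite /in_square.
  have -> : (s k.+1).2 = (s k).2 / 2 by [].
  by rewrite !ReImE; lra.
(* The corners move right and up, so the suprema of their coordinates give the common point of the
   nested squares. *)
pose X := [set Re (s k).1 | k in setT]; pose Y := [set Im (s k).1 | k in setT].
have ubX k : ubound X (Re (s k).1 + (s k).2).
  move=> _ [j _ <-]; have := s2 j; have := s2 k; have := l2 j; have := l2 k.
  have [/nest|/ltnW/nest] := leqP j k; rewrite !ReImE; lra.
have ubY k : ubound Y (Im (s k).1 + (s k).2).
  move=> _ [j _ <-]; have := s2 j; have := s2 k; have := l2 j; have := l2 k.
  have [/nest|/ltnW/nest] := leqP j k; rewrite !ReImE; lra.
have hsX : has_sup X by split; [exists (Re (s 0%N).1), 0%N|exists (Re (s 0%N).1 + (s 0%N).2)].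
have hsY : has_sup Y by split; [exists (Im (s 0%N).1), 0%N|exists (Im (s 0%N).1 + (s 0%N).2)].
have [x [xR xI]] : exists x, Re x = sup X /\ Im x = sup Y by exists (sup X +i* sup Y)%C.
have xs k : in_square (s k).1 (s k).2 x.
  rewrite /in_square !ReImE xR xI.
  have := sup_upper_bound hsX (ex_intro2 _ _ k Logic.I erefl).
  have := sup_upper_bound hsY (ex_intro2 _ _ k Logic.I erefl).
  have := ge_sup hsX.1 (ubX k); have := ge_sup hsY.1 (ubY k).
  lra.
have [b bP] := differentiable1P (udiff x (xs 0%N)).
(* In a square of side L the points are within 2L of [x]; the contour estimate then gives 4 (e/16 *
   2L) L = e L^2 / 2, which is below the bound of a bad square. *)
have e16 : 0 < e / 16 by rewrite divr_gt0.
have /nbhsC[d d0 dP] := bP _ e16.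
have [k kd] : exists k, 2 * (l / 2 ^+ k) < d.
  apply: contrapT => H; suff : (2 : R) <= 1 by lra.
  apply: (@expr_le_all R d (2 * l)) => // N; rewrite expr1n mulr1 -ler_pdivlMr ?exprn_gt0//.
  by rewrite -mulrA leNgt; apply/negP => ?; apply: H; exists N.
apply: (sbad k); exists 0%N => // j _ /=; rewrite s2.
pose w y := u y - u x - b * (y - x).
(* The affine part of [u] at [x] has contour sum exactly 0, so only the remainder [w] counts. *)
have wE : u =1 (fun y => (u x - b * x + b * y) + w y) by move=> y; rewrite /w; ring.
rewrite (eq_sqint _ _ _ wE) sqintD sqint_affine add0r.
apply: le_trans (sqint_le _ (ltW (l2 k)) (M := e / 16 * (2 * (l / 2 ^+ k))) _) _.
  move=> y yQ; have yx : ⟦y - x⟧ <= 2 * (l / 2 ^+ k).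
    apply: le_trans (rnorm_ReIm _) _; have := xs k; move: yQ.
    rewrite s2 /in_square !ReImE => yQ xQ.
    by rewrite mulr2n mulrDl mul1r lerD// ler_norml; lra.
  have := dP (y - x); rewrite subr0 subrKC => /(_ (le_lt_trans yx kd)).
  by move=> /le_trans; apply; rewrite ler_wpM2l// ltW.
have := l2 k; set L := l / 2 ^+ k => Lp.
have -> : 4 * (e / 16 * (2 * L)) * L = e * L ^+ 2 / 2 by field.
have : 0 < e * L ^+ 2 by rewrite mulr_gt0// exprn_gt0.
lra.
Qed.
End Goursat.

(** * Cauchy's formula on squares, as an inequality *)

Section SquareMaximum.
Context {R : realType}.
Local Notation C := (Cplx R).
Local Notation I := ('i%C : C).
Local Notation Re := (@complex.Re R).
Local Notation Im := (@complex.Im R).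
Implicit Types (u v : C -> C) (a b c x : C) (l s : R).

(** The maximum norm of the real plane, whose balls are squares with sides parallel to the axes. *)
Definition snorm x : R := Num.max `|Re x| `|Im x|.

Lemma snorm_le x s : (snorm x <= s) = (`|Re x| <= s) && (`|Im x| <= s).
Proof. by rewrite ge_max. Qed.

Lemma rnorm_snorm x : ⟦x⟧ <= 2 * snorm x.
Proof.
have := rnorm_ReIm x; have : snorm x <= snorm x by []. rewrite snorm_le => /andP[]; lra.
Qed.

Lemma snorm_rnorm x : snorm x <= ⟦x⟧.
Proof. by rewrite snorm_le Re_rnorm Im_rnorm. Qed.

Lemma snormB_le x y : snorm x <= snorm y + ⟦x - y⟧.
Proof.
have := Re_rnorm (x - y); have := Im_rnorm (x - y).
have : snorm y <= snorm y by []. rewrite !snorm_le !ReImE => /andP[a1 a2] b1 b2.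
have := ler_normD (Re x - Re y) (Re y); have := ler_normD (Im x - Im y) (Im y).
rewrite !subrK; lra.
Qed.

(* [1 / (x - c)] turns by [1 / 'i] when [x - c] turns by ['i], so [dx / (x - c)] is invariant. *)
Lemma trap_inv_rot k c p q :
  trap k (fun x => (x - c)^-1) (c + I * p) (c + I * q) =
  trap k (fun x => (x - c)^-1) (c + p) (c + q).
Proof.
elim: k p q => [|k IH] p q /=.
  rewrite ![c + _ - c]addrAC !subrr !add0r !invfM -!mulrDr.
  have -> : c + I * q - (c + I * p) = I * (q - p) by ring.
  have -> : c + q - (c + p) = q - p by ring.
  have I0 : I != 0 by rewrite -rnorm_gt0 -(mulr1 I) rnormI rnorm1.
  by move: p^-1 q^-1 => p' q'; field.
have -> : (c + I * p + (c + I * q)) / 2 = c + I * ((p + q) / 2) by field.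
have -> : (c + p + (c + q)) / 2 = c + (p + q) / 2 by field.
by rewrite !IH.
Qed.

Lemma oneI (y : R) : (1 +i* y)%C = 1 + I * (y%:C)%C :> C.
Proof. by apply/eqP; rewrite eq_complex !ReImE /= oppr0 addr0 add0r !eqxx. Qed.

(** The points run up the right side of the square about [c]. The integral would be arctan y2 -
    arctan y1; since Re (1/(1 + iy)) = 1/(1 + y^2) >= 1/2 for |y| <= 1, each trapezoid already
    contributes half of its height. *)
Lemma Im_trap_inv k c s (y1 y2 : R) : 0 < s -> -1 <= y1 -> y1 <= y2 -> y2 <= 1 ->
  (y2 - y1) / 2 <= Im (trap k (fun x => (x - c)^-1)
    (c + (s%:C)%C * (1 +i* y1)%C) (c + (s%:C)%C * (1 +i* y2)%C)).
Proof.
move=> s0; elim: k y1 y2 => [|k IH] y1 y2 h1 h2 h3 /=.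
  rewrite ![c + _ - c]addrAC !subrr !add0r.
  have s0' : (s%:C)%C != 0 :> C by rewrite -rnorm_gt0 rnormC normr_gt0 gt_eqF.
  have sE : I * (((y2 - y1)%:C)%C) = (1 +i* y2)%C - (1 +i* y1)%C :> C.
    by apply/eqP; rewrite eq_complex !ReImE /= subrr oppr0 !eqxx.
  rewrite [X in Im X](_ : _ = I * (((y2 - y1)%:C)%C * (((1 +i* y1)%C^-1 + (1 +i* y2)%C^-1) / 2))).
    have rI (y : R) : -1 <= y <= 1 -> 1 / 2 <= Re ((1 +i* y)%C : C)^-1.
      move=> hy; have yl : y ^+ 2 <= 1 by rewrite expr2; nra.
      have yg : 0 <= y ^+ 2 by exact: sqr_ge0.
      by rewrite /= expr1n ler_pdivlMr; lra.
    rewrite ImI ReZ Re_half ReD.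
    have r1 := rI y1; have r2 := rI y2.
    have {}r1 := r1 ltac:(lra); have {}r2 := r2 ltac:(lra).
    apply: ler_wpM2l; first lra.
    rewrite -[leLHS]mul1r ler_pM2r; last lra.
    by apply: le_trans (lerD r1 r2); lra.
  rewrite mulrA sE.
  move: ((1 +i* y2)%C : C) ((1 +i* y1)%C : C) => z2 z1.
  rewrite !invfM; move: (z1^-1) (z2^-1) => w1 w2.
  by field.
have := IH y1 ((y1 + y2) / 2); have := IH ((y1 + y2) / 2) y2.
have -> : (c + (s%:C)%C * (1 +i* y1)%C + (c + (s%:C)%C * (1 +i* y2)%C)) / 2 =
   c + (s%:C)%C * (1 +i* ((y1 + y2) / 2))%C :> C.
  have -> : (1 +i* ((y1 + y2) / 2))%C = ((1 +i* y1)%C + (1 +i* y2)%C) / 2 :> C.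
    by rewrite !oneI rmorphM rmorphD /= -half_realC; field.
  by field.
rewrite ImD => A B.
have {}A := A ltac:(lra) ltac:(lra) ltac:(lra).
have {}B := B ltac:(lra) ltac:(lra) ltac:(lra).
lra.
Qed.

Definition corner c s : C := c - (s%:C)%C - I * (s%:C)%C.

(** A crude substitute for the value 2 pi i: by rotation invariance the four sides contribute
    equally, and the right side has imaginary part at least 1. *)
Lemma sqint_inv k c s : 0 < s ->
  4 <= ⟦sqint k (fun x => (x - c)^-1) (corner c s) ((2 * s)%:C)%C⟧.
Proof.
(* Lower and upper end of the right side, relative to [c]. As I p = q, all corners are quarter turns
   of [p]. *)
move=> s0; pose p := (s%:C)%C * (1 +i* (-1))%C : C; pose q := (s%:C)%C * (1 +i* 1)%C : C.
have II : I * I = -1 by rewrite -expr2 sqr_i.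
have pE : p = (s%:C)%C - I * (s%:C)%C.
  by rewrite /p oneI ?rmorphN rmorph1; ring.
have qE : q = (s%:C)%C + I * (s%:C)%C.
  by rewrite /q oneI ?rmorphN rmorph1; ring.
have IqE : I * p = q by rewrite pE qE mulrBr mulrA II; ring.
have sE : ((2 * s)%:C)%C = (s%:C)%C + (s%:C)%C :> C by rewrite -rmorphD /= mulr2n mulrDl mul1r.
have e1 : corner c s = c + I * (I * (I * p)).
  by rewrite IqE qE !mulrDr !mulrA II /corner; ring.
have e2 : corner c s + ((2 * s)%:C)%C = c + p by rewrite sE pE /corner; ring.
have e3 : corner c s + ((2 * s)%:C)%C + I * ((2 * s)%:C)%C = c + q by rewrite sE qE /corner; ring.
have e4 : corner c s + I * ((2 * s)%:C)%C = c + I * q.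
  by rewrite sE qE !mulrDr mulrA II /corner; ring.
rewrite /sqint e3 e4 e2 e1.
have p4 : I * (I * (I * (I * p))) = p by rewrite !(mulrA I I) !II; ring.
rewrite -IqE -[X in trap k _ (c + I * (I * (I * p))) (c + X)]p4 !trap_inv_rot.
have := @Im_trap_inv k c s (-1) 1 s0; rewrite -/p -/q IqE => H.
have {}H := H ltac:(lra) ltac:(lra) ltac:(lra).
set t := trap _ _ _ _ in H *; have -> : t + t + t + t = (4%:C)%C * t by rewrite rmorph_nat; ring.
apply: le_trans (le_trans (ler_norm _) (Im_rnorm _)).
by rewrite ImZ; lra.
Qed.
End SquareMaximum.

Section SquareMaximum2.
Context {R : realType}.
Local Notation C := (Cplx R).
Local Notation I := ('i%C : C).
Local Notation Re := (@complex.Re R).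
Local Notation Im := (@complex.Im R).
Implicit Types (u v : C -> C) (a b c x : C) (l s : R).

Lemma eq_null_seq (t1 t2 : nat -> C) : t1 =1 t2 -> null_seq t1 -> null_seq t2.
Proof. by move=> /funext ->. Qed.

(** Cut the large square into a 4 by 4 grid; the four central cells form the small square. The
    twelve others avoid [c], so Goursat's theorem applies to each. Levels [k.+2] and [k.+1] on the
    two squares are both level [k] on the cells. *)
Lemma sqint_annulus v c s : 0 < s ->
  (forall x, snorm (x - c) <= s -> x != c -> differentiable v x) ->
  null_seq (fun k => sqint k.+2 v (corner c s) ((2 * s)%:C)%C -
                     sqint k.+1 v (corner c (s / 2)) ((2 * (s / 2))%:C)%C).
Proof.
move=> s0 vd.
(* Grid of mesh s/2 centred at [c]; [Sq k m i j] is the square of [m] meshes with lower left corner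
   [P i j]. *)
pose P (i j : R) : C := c + ((i * (s / 2))%:C)%C + I * ((j * (s / 2))%:C)%C.
pose Sq k (m i j : R) := sqint k v (P i j) ((m * (s / 2))%:C)%C.
have Sq_split k m i j : Sq k.+1 (2 * m) i j =
    Sq k m i j + Sq k m (i + m) j + Sq k m i (j + m) + Sq k m (i + m) (j + m).
  rewrite /Sq sqint_split.
  have -> : (2 * m * (s / 2))%:C%C / 2 = (m * (s / 2))%:C%C :> C.
    by rewrite -mulrA rmorphM rmorph_nat /=; field.
  by congr (_ + _ + _ + _); congr sqint; rewrite /P; rewrite !mulrDl ?rmorphD /=; ring.
have PE i j x : Re (x - P i j) = Re (x - c) - i * (s / 2) /\
    Im (x - P i j) = Im (x - c) - j * (s / 2).
  by rewrite /P !ReImE; split; ring.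
have cell i j : (forall x, 0 <= Re (x - P i j) <= s / 2 -> 0 <= Im (x - P i j) <= s / 2 ->
     snorm (x - c) <= s /\ ((Re (x - c) != 0) || (Im (x - c) != 0))) ->
    null_seq (fun k => Sq k 1 i j).
  move=> H; apply: goursat => [|x]; first by rewrite mul1r divr_gt0.
  rewrite /in_square mul1r => -[h1 h2]; have [h3 h4] := H x h1 h2.
  by apply: vd => //; apply/eqP => xc; move: h4; rewrite xc subrr eqxx.
have cellP (i j : R) : -2 <= i <= 1 -> -2 <= j <= 1 ->
    1 <= i \/ i <= -2 \/ 1 <= j \/ j <= -2 -> null_seq (fun k => Sq k 1 i j).
  move=> hi hj hij; apply: cell => x; have [-> ->] := PE i j x => hx hy.
  rewrite snorm_le !ler_norml; split.
    by apply/andP; split; nra.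
  move: hij => [h|[h|[h|h]]]; apply/orP; [left|left|right|right]; apply/eqP; nra.
have E4 : 4 * (s / 2) = 2 * s by field.
have PE2 : P (-2) (-2) = corner c s.
  have q : -2 * (s / 2) = - s by field.
  by rewrite /P /corner q rmorphN; ring.
have PE1 : P (-1) (-1) = corner c (s / 2).
  by rewrite /P /corner !mulN1r rmorphN; ring.
apply: (@eq_null_seq (fun k => Sq k.+2 (2 * (2 * 1)) (-2) (-2) - Sq k.+1 (2 * 1) (-1) (-1))).
  by move=> k; rewrite /Sq PE2 PE1 mulr1 -E4; congr (sqint _ _ _ _%:C%C - _); ring.
have n1 : -2 + 1 = -1 :> R by ring.
have n2 : -2 + 2 * 1 = 0 :> R by ring.
have n3 : -1 + 1 = 0 :> R by ring.
apply: (@eq_null_seq (fun k => Sq k 1 (-2) (-2) + (Sq k 1 (-1) (-2) + (Sq k 1 (-2) (-1) +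
  (Sq k 1 0 (-2) + (Sq k 1 1 (-2) + (Sq k 1 1 (-1) +
  (Sq k 1 (-2) 0 + (Sq k 1 (-2) 1 + (Sq k 1 (-1) 1 +
  (Sq k 1 1 0 + (Sq k 1 0 1 + Sq k 1 1 1)))))))))))).
  by move=> k; rewrite !Sq_split n1 n2 n3 !add0r; ring.
by repeat (apply: null_seqD; first (apply: cellP; lra)); apply: cellP; lra.
Qed.

Lemma sqint_shrink v c s j : 0 < s ->
  (forall x, snorm (x - c) <= s -> x != c -> differentiable v x) ->
  null_seq (fun k => sqint (k + j).+1 v (corner c s) ((2 * s)%:C)%C -
    sqint k.+1 v (corner c (s / 2 ^+ j)) ((2 * (s / 2 ^+ j))%:C)%C).
Proof.
move=> s0 vd; elim: j => [|j IH].
  apply: (@eq_null_seq (fun=> 0)); last by move=> e e0; near=> k; rewrite rnorm0 ltW.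
  by move=> k; rewrite addn0 expr0 divr1 subrr.
have sj : 0 < s / 2 ^+ j by rewrite divr_gt0// exprn_gt0.
have sjs : s / 2 ^+ j <= s.
  by rewrite ler_pdivrMr ?exprn_gt0// ler_peMr ?exprn_ege1 ?ler1n// ltW.
have := sqint_annulus sj (fun x xs => vd x (le_trans xs sjs)).
have -> : s / 2 ^+ j / 2 = s / 2 ^+ j.+1.
  by rewrite exprSr invfM mulrA.
move=> /(null_seqD (null_seqS IH)); apply: eq_null_seq => k /=.
by rewrite addnS addSn; ring.
Unshelve. all: by end_near. Qed.

Lemma sqint_le_boundary k u c s (M : R) : 0 < s ->
  (forall x, snorm (x - c) = s -> ⟦u x⟧ <= M) ->
  ⟦sqint k u (corner c s) ((2 * s)%:C)%C⟧ <= 8 * M * s.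
Proof.
move=> s0 uM; set d : C := ((2 * s)%:C)%C.
have nd : ⟦d⟧ = 2 * s by rewrite rnormC ger0_norm//; lra.
have side (P : set C) p q : midpoint_closed P -> P `<=` [set x | snorm (x - c) = s] ->
    P p -> P q -> ⟦q - p⟧ = 2 * s -> ⟦trap k u p q⟧ <= M * (2 * s).
  by move=> mP Ps Pp Pq <-; apply: (trap_le _ mP) => // x /Ps /uM.
have snE (y : C) : -s <= Re y <= s -> -s <= Im y <= s ->
    Re y = s \/ Re y = - s \/ Im y = s \/ Im y = - s -> snorm y = s.
  move=> h1 h2 h; apply/eqP; rewrite eq_le snorm_le !ler_norml h1 h2 /=.
  rewrite le_max; have ns : `|s| = s by rewrite ger0_norm ?ltW.
  by move: h => [->|[->|[->|->]]]; rewrite ?normrN ns lexx ?orbT.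
have s1 : ⟦trap k u (corner c s) (corner c s + d)⟧ <= M * (2 * s).
  apply: (side [set x | -s <= Re (x - c) <= s /\ Im (x - c) = - s]).
  - by move=> x y /=; rewrite !ReImE; lra.
  - by move=> x /= h; apply: snE; lra.
  - by rewrite /corner /= !ReImE; lra.
  - by rewrite /corner /d /= !ReImE; lra.
  - by rewrite addrC addKr.
have s2 : ⟦trap k u (corner c s + d) (corner c s + d + I * d)⟧ <= M * (2 * s).
  apply: (side [set x | -s <= Im (x - c) <= s /\ Re (x - c) = s]).
  - by move=> x y /=; rewrite !ReImE; lra.
  - by move=> x /= h; apply: snE; lra.
  - by rewrite /corner /d /= !ReImE; lra.
  - by rewrite /corner /d /= !ReImE; lra.
  - by rewrite addrC addKr rnormI.
have s3 : ⟦trap k u (corner c s + d + I * d) (corner c s + I * d)⟧ <= M * (2 * s).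
  apply: (side [set x | -s <= Re (x - c) <= s /\ Im (x - c) = s]).
  - by move=> x y /=; rewrite !ReImE; lra.
  - by move=> x /= h; apply: snE; lra.
  - by rewrite /corner /d /= !ReImE; lra.
  - by rewrite /corner /d /= !ReImE; lra.
  - by rewrite rdistC (_ : _ - _ = d)//; ring.
have s4 : ⟦trap k u (corner c s + I * d) (corner c s)⟧ <= M * (2 * s).
  apply: (side [set x | -s <= Im (x - c) <= s /\ Re (x - c) = - s]).
  - by move=> x y /=; rewrite !ReImE; lra.
  - by move=> x /= h; apply: snE; lra.
  - by rewrite /corner /d /= !ReImE; lra.
  - by rewrite /corner /= !ReImE; lra.
  - by rewrite rdistC addrC addKr rnormI.
rewrite /sqint; move: s1 s2 s3 s4.
set A1 := trap _ _ _ _; set A2 := trap _ _ _ _; set A3 := trap _ _ _ _; set A4 := trap _ _ _ _.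
have := rnormD A1 A2; have := rnormD (A1 + A2) A3; have := rnormD (A1 + A2 + A3) A4.
lra.
Qed.

Lemma exists_half_pow (a e : R) : 0 < e -> exists j, a / 2 ^+ j < e.
Proof.
move=> e0; apply: contrapT => H; suff : (2 : R) <= 1 by lra.
apply: (@expr_le_all R e a) => // N; rewrite expr1n mulr1 -ler_pdivlMr ?exprn_gt0//.
by rewrite leNgt; apply/negP => ?; apply: H; exists N.
Qed.

(** Cauchy's formula with a factor 2 lost. Write u(x)/(x - c) as u(c)/(x - c) plus a quotient
    bounded near [c]. The sum over the boundary is at most 8m, the sum over a tiny concentric square
    is at least 4|u(c)| up to small errors, and the two differ by a null sequence. *)
Lemma square_cauchy u c s (m : R) : 0 < s ->
  (forall x, snorm (x - c) <= s -> differentiable u x) ->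
  (forall x, snorm (x - c) = s -> ⟦u x⟧ <= m) -> ⟦u c⟧ <= 2 * m.
Proof.
move=> s0 ud um.
have udc : differentiable u c by apply: ud; rewrite subrr snorm_le !normr0 ltW.
have [a] := differentiable1P udc.
move=> /(_ 1 ltr01) /nbhsC[d d0 dP].
rewrite leNgt; apply/negP => uc; set A := ⟦a⟧ + 1.
have A0 : 0 < A by rewrite ltr_wpDl ?rnorm_ge0.
(* The gap to be contradicted. The tiny square is chosen so that the bounded quotient contributes
   less than g/2; the null sequence contributes at most g/4. *)
pose g := 4 * ⟦u c⟧ - 8 * m; have g0 : 0 < g by rewrite /g; lra.
have m0 : 0 < Num.min (d / 2) (g / (16 * A)) by rewrite lt_min !divr_gt0 ?mulr_gt0.
have [j] := exists_half_pow s m0; rewrite lt_min ltr_pdivlMr// ltr_pdivlMr ?mulr_gt0// => /andP[].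
have sj : 0 < s / 2 ^+ j by rewrite divr_gt0// exprn_gt0.
pose v x := u x * (x - c)^-1; pose w x := (u x - u c) * (x - c)^-1.
have vd x : snorm (x - c) <= s -> x != c -> differentiable v x.
  move=> xs xc; apply: dif_mul (ud _ xs) (dif_inv _ _); last by rewrite subr_eq0.
  by apply: dif_sub; [exact: dif_id|exact: dif_cst].
have g4 : 0 < g / 4 by rewrite divr_gt0.
have [k _ /(_ k (leqnn k))] := sqint_shrink j s0 vd g4.
have vE : v =1 (fun x => u c * (x - c)^-1 + w x) by move=> x; rewrite /v /w; ring.
move: sj; set t := s / 2 ^+ j => t0; rewrite [X in _ - X](eq_sqint _ _ _ vE) sqintD sqintZ.
have h1 := sqint_inv k.+1 c t0.
have h2 : ⟦sqint (k + j).+1 v (corner c s) ((2 * s)%:C)%C⟧ <= 8 * (m / s) * s.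
  apply: sqint_le_boundary => // x xs; rewrite rnormM rnormV.
  have sx : s <= ⟦x - c⟧ by rewrite -xs snorm_rnorm.
  rewrite ler_pdivrMr ?(lt_le_trans s0)//.
  have um0 := um _ xs; have mge0 := le_trans (rnorm_ge0 _) um0.
  by rewrite (le_trans um0)// -mulrA ler_peMr// mulrC ler_pdivlMr// mul1r.
have {}h2 : ⟦sqint (k + j).+1 v (corner c s) ((2 * s)%:C)%C⟧ <= 8 * m.
  by apply: le_trans h2 _; rewrite mulrA divfK// gt_eqF.
move=> h3 td tg.
have h4 : ⟦sqint k.+1 w (corner c t) ((2 * t)%:C)%C⟧ <= 4 * A * (2 * t).
  apply: sqint_le => [|x]; first lra.
  rewrite /in_square /corner !ReImE => xQ.
  have xd : ⟦x - c⟧ < d.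
    apply: le_lt_trans (rnorm_snorm _) _; suff : snorm (x - c) <= t by lra.
    by rewrite snorm_le !ReImE !ler_norml; lra.
  have [->|xc] := eqVneq x c; first by rewrite /w subrr mul0r rnorm0 ltW.
  rewrite rnormM rnormV ler_pdivrMr ?rnorm_gt0 ?subr_eq0//.
  have := dP (x - c); rewrite subr0 subrKC => /(_ xd).
  have := rnorm_dist (u x - u c) (a * (x - c)); rewrite rnormM /A mulrDl; lra.
move: h1 h2 h3 h4; set T1 := sqint _ _ _ _; set T2 := sqint _ _ _ _; set T3 := sqint _ _ _ _.
move=> h1 h2 h3 h4.
have h5 : ⟦u c * T1⟧ <= ⟦T2⟧ + ⟦T2 - (u c * T1 + T3)⟧ + ⟦T3⟧.
  have -> : u c * T1 = T2 - (T2 - (u c * T1 + T3)) - T3 by ring.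
  have := rnormB (T2 - (T2 - (u c * T1 + T3))) T3.
  have := rnormB T2 (T2 - (u c * T1 + T3)).
  have -> : T2 - (T2 - (T2 - (u c * T1 + T3)) - T3 + T3) = T2 - (u c * T1 + T3) by ring.
  lra.
have : ⟦u c⟧ * 4 <= ⟦u c * T1⟧ by rewrite rnormM ler_wpM2l ?rnorm_ge0.
have : 4 * A * (2 * t) = (t * (16 * A)) / 2 by field.
have gE : g = 4 * ⟦u c⟧ - 8 * m by [].
lra.
Qed.

(** The factor 2 of [square_cauchy] is removed by applying it to the powers of [u]. *)
Lemma square_maximum u c s (m : R) : 0 < s -> 0 <= m ->
  (forall x, snorm (x - c) <= s -> differentiable u x) ->
  (forall x, snorm (x - c) = s -> ⟦u x⟧ <= m) -> ⟦u c⟧ <= m.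
Proof.
move=> s0 m0 ud um; apply: (@expr_le_all R 1 2) => // [|N]; first exact: rnorm_ge0.
rewrite mul1r -rnormX; apply: (square_cauchy (u := fun x => u x ^+ N) s0).
  by move=> x /ud; apply: dif_exp.
by move=> x /um xm; rewrite rnormX lerXn2r// nnegrE ?rnorm_ge0.
Qed.

End SquareMaximum2.

(** * The maximum principle *)

Section MaximumPrinciple.
Context {R : realType}.
Local Notation C := (Cplx R).
Implicit Types (u v h : C -> C) (X : set C) (a b c x : C) (m s : R).

Lemma rnorm_nat n : ⟦n%:R : C⟧ = n%:R :> R.
Proof. by rewrite -(rmorph_nat (real_complex R)) rnormC normr_nat. Qed.

Lemma rnorm_parallelogram a b :
  ⟦a + b⟧ ^+ 2 + ⟦a - b⟧ ^+ 2 = 2 * ⟦a⟧ ^+ 2 + 2 * ⟦b⟧ ^+ 2.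
Proof. by rewrite !rnorm_sqr !ReImE; ring. Qed.

Lemma snorm_continuous c : continuous (fun x => snorm (x - c)).
Proof.
move=> x; apply/(@cvgrPdist_lt R R^o _ (nbhs x) (nbhs_filter x)) => e e0.
apply: filterS (near_rnorm x e0) => y yx.
have := snormB_le (x - c) (y - c); have := snormB_le (y - c) (x - c).
have -> : y - c - (x - c) = y - x by ring.
have -> : x - c - (y - c) = x - y by ring.
by rewrite (rdistC x) => h1 h2; rewrite ltr_norml; lra.
Qed.

Lemma square_boundary_compact c s : compact [set x | snorm (x - c) = s].
Proof.
have -> : [set x | snorm (x - c) = s] = (fun x => snorm (x - c)) @^-1` [set s] by [].
apply: (@subclosed_compact _ _ [set x | ⟦x - c⟧ <= 2 * s] _ (disc_compact _ _)).
  apply: closed_comp => [x _|].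
    exact: snorm_continuous.
  exact: closed_eq.
by move=> x /= <-; exact: rnorm_snorm.
Qed.

(* A maximum of [u] at [c] is made strict around [c] by the factor [(x - o) + (c - o)]
   when [c] is a point of the maximum set at largest distance from [o]. *)
Lemma max_principle X u m : compact X -> 0 <= m ->
  (forall c, X c -> (\forall x \near c, X x /\ differentiable u x) \/
    (forall e : R, 0 < e -> \forall x \near c, X x -> ⟦u x⟧ <= m + e)) ->
  forall c, X c -> ⟦u c⟧ <= m.
Proof.
move=> cX m0 H c1 Xc1; rewrite leNgt; apply/negP => m1.
have clX : closed X by apply: compact_closed cX; exact: norm_hausdorff.
pose A K := X `&` [set x | K <= ⟦u x⟧].
have type1 K c : m < K -> A K c -> \forall x \near c, X x /\ differentiable u x.
  move=> mK [Xc uc]; case: (H c Xc) => // /(_ ((K - m) / 2)) H2.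
  have /H2/nbhs_singleton/(_ Xc) : 0 < (K - m) / 2 by lra.
  by move: uc => /=; lra.
have clA K : m < K -> closed (A K).
  move=> mK c cc; have Xc : X c by apply: clX => B /cc[x [[Xx _] Bx]]; exists x.
  have clN (B : set C) : (\forall x \near c, B x -> ⟦u x⟧ < K) -> A K `<=` B -> False.
    by move=> /cc[x [Ax]] /= + AB => /(_ (AB _ Ax)); move: Ax => [_ /=]; lra.
  case: (H c Xc) => [n1|/(_ ((K - m) / 2)) n2].
    split=> //=; rewrite leNgt; apply/negP => uK; apply: (clN setT) => //.
    have /differentiable_continuous/continuousC uc := (nbhs_singleton n1).2.
    have /uc : 0 < K - ⟦u c⟧ by lra.
    by apply: filterS => x; have := rnorm_dist (u x) (u c); lra.
  exfalso; apply: (clN X) => [|x []//].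
  have /n2 : 0 < (K - m) / 2 by lra.
  by apply: filterS => x + Xx => /(_ Xx); lra.
have cA K : m < K -> compact (A K) by move=> mK; apply: subclosed_compact (clA _ mK) cX _ => x [].
have difA K c : m < K -> A K c -> differentiable u c.
  by move=> mK /(type1 _ _ mK)/nbhs_singleton[].
have [|x Ax|c2 Ac2 c2max] := @EVT_compact R _ (fun x => ⟦u x⟧) _ _ (cA _ m1).
- by exists c1; split=> /=.
- by apply: continuous_rnorm; exact/differentiable_continuous/difA/Ax.
set M := ⟦u c2⟧ in c2max *.
have m2 : m < M by apply: lt_le_trans m1 (c2max _ _); split => /=.
have XM x : X x -> ⟦u x⟧ <= M.
  move=> Xx; case: (lerP ⟦u c1⟧ ⟦u x⟧) => h; first by apply: c2max.
  by apply: le_trans (ltW h) (c2max _ _); split => /=.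
(* Any point off [c2] would do: it ensures that the farthest point [c] of the maximum set is not
   [o], so [p c] is not 0. *)
pose o := c2 + 1.
have [|x _|c Ac cmax] := @EVT_compact R _ (fun x => ⟦x - o⟧) _ _ (cA _ m2).
- by exists c2; split => //=; case: Ac2.
- by apply: continuous_rnorm; exact: subr_continuous.
have uc : ⟦u c⟧ = M by apply/eqP; rewrite eq_le XM ?Ac.1//; case: Ac.
have co : 1 <= ⟦c - o⟧.
  have -> : 1 = ⟦c2 - o⟧ :> R by rewrite rdistC /o addrC addKr rnorm1.
  by apply: cmax; split => //=; case: Ac2.
have /nbhsC[d d0 dP] := type1 _ _ m2 Ac.
pose s := d / 4; have s0 : 0 < s by rewrite divr_gt0.
have sP x : snorm (x - c) <= s -> X x /\ differentiable u x.
  by move=> xs; apply: dP; have := rnorm_snorm (x - c); rewrite /s in xs *; lra.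
pose p x := (x - o) + (c - o).
have pd x : differentiable p x.
  by apply: dif_add; [apply: dif_sub; [exact: dif_id|exact: dif_cst]|exact: dif_cst].
have pc : continuous p by move=> x; exact/differentiable_continuous.
(* The part of the boundary where |p| is not below |p c|. There |u| < M: a point of the maximum set
   is no farther from [o] than [c], and the parallelogram law would give |p x| < |p c|. *)
pose Z := [set x | snorm (x - c) = s] `&` [set x | ⟦p c⟧ <= ⟦p x⟧].
have cZ : compact Z.
  by apply: compact_closedI; [exact: square_boundary_compact|exact: closed_rnorm_ge].
have ZM x : Z x -> ⟦u x⟧ < M.
  move=> [/= xs px]; have [Xx _] : X x /\ differentiable u x by apply: sP; rewrite xs.
  rewrite lt_neqAle XM// andbT; apply/eqP => uxM.
  have xo : ⟦x - o⟧ <= ⟦c - o⟧ by apply: cmax; split => //=; rewrite uxM.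
  have := rnorm_parallelogram (x - o) (c - o).
  have -> : x - o - (c - o) = x - c by ring.
  have : ⟦p c⟧ ^+ 2 <= ⟦p x⟧ ^+ 2 by rewrite lerXn2r ?nnegrE ?rnorm_ge0.
  have -> : ⟦p c⟧ = 2 * ⟦c - o⟧.
    have -> : p c = 2%:R * (c - o) by rewrite /p; ring.
    by rewrite rnormM rnorm_nat.
  have : ⟦x - o⟧ ^+ 2 <= ⟦c - o⟧ ^+ 2 by rewrite lerXn2r ?nnegrE ?rnorm_ge0.
  have : 0 < ⟦x - c⟧ ^+ 2.
    by rewrite exprn_gt0// (lt_le_trans s0)// -xs snorm_rnorm.
  rewrite exprMn /p; lra.
have [M' M'0 [M'M ZM']] : exists2 M', 0 <= M' & M' < M /\ forall x, Z x -> ⟦u x⟧ <= M'.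
  have [Z0|Z0] := pselect (Z !=set0); last first.
    by exists 0 => //; split=> [|x Zx]; [exact: le_lt_trans m2|case: Z0; exists x].
  have [x [/= xs _]|z Zz zmax] := EVT_compact Z0 cZ (f := fun x => ⟦u x⟧).
    by apply/continuous_rnorm/differentiable_continuous; apply: (sP x _).2; rewrite xs.
  by exists ⟦u z⟧; [exact: rnorm_ge0|split; [exact: ZM|]].
suff : M <= M' by lra.
have pc0 : 0 < ⟦p c⟧.
  have -> : p c = 2%:R * (c - o) by rewrite /p; ring.
  by rewrite rnormM rnorm_nat; lra.
(* A maximum point of |u^N p| on the boundary must lie in [Z], where |u| <= M'. Hence M^N |p c| <=
   M'^N (|p c| + 2s) for every N. *)
apply: (@expr_le_all R ⟦p c⟧ (⟦p c⟧ + 2 * s)) => // [|N]; first exact: le_trans (ltW m2).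
pose v x := u x ^+ N * p x.
have vd x : snorm (x - c) <= s -> differentiable v x.
  move=> /sP[_ ux]; by apply: dif_mul; [apply: dif_exp; exact: ux|exact: pd].
have cs : [set x | snorm (x - c) = s] !=set0.
  exists (c + (s%:C)%C); rewrite /= addrC addKr /snorm ReC ImC normr0 ger0_norm ?ltW//.
  by rewrite max_l// ltW.
have [x /= xs|z /= zs zmax] := EVT_compact cs (@square_boundary_compact c s) (f := fun x => ⟦v x⟧).
  by apply/continuous_rnorm/differentiable_continuous/vd; rewrite xs.
have vz : ⟦v c⟧ <= ⟦v z⟧.
  by apply: (square_maximum s0 _ vd); [exact: rnorm_ge0|exact: zmax].
have uz : ⟦u z⟧ <= M by apply: XM; apply: (sP z _).1; rewrite zs.
move: vz; rewrite /v !rnormM !rnormX uc mulrC => vz.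
have zZ : Z z.
  split=> //=; rewrite -(@ler_pM2r _ (M ^+ N)) ?exprn_gt0//; last exact: le_lt_trans m2.
  apply: le_trans vz _; rewrite mulrC ler_wpM2l ?rnorm_ge0//.
  by rewrite lerXn2r ?nnegrE ?rnorm_ge0//; exact: le_trans (ltW m2).
apply: le_trans vz _; rewrite mulrC; apply: ler_pM; rewrite ?exprn_ge0 ?rnorm_ge0//.
  have := rnorm_dist (p z) (p c); have := rnorm_snorm (z - c); rewrite zs.
  have -> : p z - p c = z - c by rewrite /p; ring.
  lra.
by rewrite lerXn2r ?nnegrE ?rnorm_ge0//; exact: ZM'.
Qed.
End MaximumPrinciple.

(** * The maximum principle with exceptional points *)

Section Markers.
Context {R : realType}.
Local Notation C := (Cplx R).
Implicit Types (u v h chi : C -> C) (X : set C) (a b c x : C) (m s : R).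

(* Exceptional points of [u] are allowed at the zeros of [chi]: apply the maximum principle
   to [u ^+ N * chi] and let [N] grow. *)
Lemma max_principle_marker X u chi m B : compact X -> 0 <= m ->
  (forall x, X x -> ⟦chi x⟧ <= B) ->
  (forall c, X c ->
    [\/ \forall x \near c, [/\ X x, differentiable u x & differentiable chi x],
        (exists M, \forall x \near c, X x -> ⟦u x⟧ <= M) /\
          (forall e : R, 0 < e -> \forall x \near c, X x -> ⟦chi x⟧ <= e) |
        forall e : R, 0 < e -> \forall x \near c, X x -> ⟦u x⟧ <= m + e]) ->
  forall c, X c -> chi c != 0 -> ⟦u c⟧ <= m.
Proof.
move=> cX m0 chiB H c Xc chic; apply/ler_addgt0Pr => e e0.
have B0 : 0 <= B := le_trans (rnorm_ge0 _) (chiB _ Xc).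
have me : 0 <= m + e by lra.
apply: (@expr_le_all R ⟦chi c⟧ B) => // [||N]; [by rewrite rnorm_gt0|exact: rnorm_ge0|].
rewrite [leLHS]mulrC [leRHS]mulrC -rnormX -rnormM.
apply: (max_principle (u := fun x => u x ^+ N * chi x) cX) Xc => [|d Xd].
  by rewrite mulr_ge0// exprn_ge0.
case: (H d Xd) => [n1|[[M n1] n2]|n3].
- left; apply: filterS n1 => x [Xx ux cx]; split=> //.
  by apply: dif_mul; [apply: dif_exp; exact: ux|exact: cx].
- right => e' e'0; pose M' := Num.max M 1.
  have M'0 : 0 < M' by rewrite lt_max ltr01 orbT.
  have /n2 : 0 < e' / M' ^+ N by rewrite divr_gt0// exprn_gt0.
  apply: filterS2 n1 => x uM cM Xx; rewrite rnormM rnormX.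
  rewrite ler_wpDl ?mulr_ge0 ?exprn_ge0//.
  have := cM Xx; rewrite ler_pdivlMr ?exprn_gt0// mulrC; apply: le_trans.
  apply: ler_wpM2r; first exact: rnorm_ge0.
  have uM' : ⟦u x⟧ <= M' by rewrite le_max uM.
  by rewrite lerXn2r ?nnegrE ?rnorm_ge0// ltW.
- right => e' e'0; apply: filterS (n3 _ e0) => x ux Xx.
  rewrite rnormM rnormX; have e'1 := ltW e'0.
  apply: (@le_trans _ _ ((m + e) ^+ N * B)); last by rewrite lerDl.
  apply: ler_pM; rewrite ?exprn_ge0 ?rnorm_ge0 ?chiB//.
  by rewrite lerXn2r ?nnegrE ?rnorm_ge0// ux.
Qed.

Lemma rnorm_prod_le (T : eqType) (s : seq T) (f : T -> C) (M : R) : 1 <= M ->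
  (forall t, t \in s -> ⟦f t⟧ <= M) -> ⟦\prod_(t <- s) f t⟧ <= M ^+ size s.
Proof.
move=> M1; elim: s => [|t s IH] fM; first by rewrite big_nil rnorm1.
rewrite big_cons rnormM exprS ler_pM ?rnorm_ge0//; first by rewrite fM ?mem_head.
by apply: IH => r rs; apply: fM; rewrite inE rs orbT.
Qed.

Lemma rnorm_prod_small (T : eqType) (s : seq T) (f : T -> C) (M e : R) t0 : 1 <= M ->
  (forall t, t \in s -> ⟦f t⟧ <= M) -> t0 \in s -> ⟦f t0⟧ <= e ->
  ⟦\prod_(t <- s) f t⟧ <= e * M ^+ size s.
Proof.
move=> M1 fM; have M0 : 0 <= M by lra.
elim: s fM => [//|t s IH] fM; rewrite inE big_cons rnormM /= exprS.
have fM' r : r \in s -> ⟦f r⟧ <= M by move=> rs; apply: fM; rewrite inE rs orbT.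
have ft : ⟦f t⟧ <= M by rewrite fM ?mem_head.
move=> /predU1P[-> fe|t0s fe].
  have e0 := le_trans (rnorm_ge0 _) fe.
  apply: ler_pM; rewrite ?rnorm_ge0//; apply: le_trans (rnorm_prod_le M1 fM') _.
  by rewrite ler_peMl// exprn_ge0.
by rewrite mulrCA ler_pM ?rnorm_ge0// IH.
Qed.

Lemma near_dif_prod (T : eqType) (s : seq T) (f : T -> C -> C) c :
  (forall t, t \in s -> \forall x \near c, differentiable (f t) x) ->
  \forall x \near c, differentiable (fun x => \prod_(t <- s) f t x) x.
Proof.
elim: s => [|t s IH] H.
  by near=> x; under eq_fun do rewrite big_nil; exact: dif_cst.
have h1 := H t (mem_head _ _).
have h2 : \forall x \near c, differentiable (fun x => \prod_(t <- s) f t x) x.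
  by apply: IH => r rs; apply: H; rewrite inE rs orbT.
apply: filterS2 h1 h2 => x d1 d2; under eq_fun do rewrite big_cons.
by apply: dif_mul; [exact: d1|exact: d2].
Unshelve. all: by end_near. Qed.

Lemma near_affine (P : C -> Prop) c a w x :
  (\forall y \near (c + w * (x - a)), P y) -> \forall y \near x, P (c + w * (y - a)).
Proof.
move=> nP; have d : differentiable (fun y => c + w * (y - a)) x.
  apply: dif_add; [exact: dif_cst|apply: dif_mul; [exact: dif_cst|]].
  by apply: dif_sub; [exact: dif_id|exact: dif_cst].
exact: (differentiable_continuous d nP).
Qed.

Lemma dif_affine h c a w x : differentiable h (c + w * (x - a)) ->
  differentiable (fun y => h (c + w * (y - a))) x.
Proof.
move=> dh; have d : differentiable (fun y => c + w * (y - a)) x.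
  apply: dif_add; [exact: dif_cst|apply: dif_mul; [exact: dif_cst|]].
  by apply: dif_sub; [exact: dif_id|exact: dif_cst].
exact: (@differentiable_comp _ _ _ _ (fun y => c + w * (y - a)) h _ d dh).
Qed.

(* A product of finitely many rotates of [h] vanishes near the whole circle. *)
Lemma arc_vanish h c rho M c1 :
  (forall x, ⟦x - c⟧ < rho -> (\forall y \near x, differentiable h y) \/
     (forall e : R, 0 < e -> \forall y \near x, ⟦h y⟧ <= e)) ->
  (forall x, ⟦x - c⟧ <= rho -> ⟦h x⟧ <= M) ->
  ⟦c1 - c⟧ = rho -> (\forall y \near c1, h y = 0) -> h c = 0.
Proof.
move=> hd hM c1rho h1; have [->|c1c] := eqVneq c c1; first exact: nbhs_singleton h1.
have rho0 : 0 < rho by rewrite -c1rho rnorm_gt0 subr_eq0 eq_sym.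
pose r w x := c + w * (x - c).
have nr w x : ⟦w⟧ = 1 -> ⟦r w x - c⟧ = ⟦x - c⟧.
  by move=> w1; rewrite /r addrAC subrr add0r rnormM w1 mul1r.
have cc : compact [set x | ⟦x - c⟧ = rho].
  apply: (@subclosed_compact _ _ [set x | ⟦x - c⟧ <= rho] _ (disc_compact _ _)).
    rewrite (_ : [set _ | _] = [set x | ⟦x - c⟧ <= rho] `&` [set x | rho <= ⟦x - c⟧]).
      by apply: closedI; [apply: closed_rnorm_le|apply: closed_rnorm_ge]; exact: subr_continuous.
    by apply/seteqP; split=> x /= => [->|[h2 h3]]; [|apply/eqP; rewrite eq_le h2].
  by move=> x /= ->.
move: (cc); rewrite compact_cover.
move=> /(_ _ [set w : C | ⟦w⟧ = 1] (fun w => [set x | h (r w x) = 0]°)) [w _|x /= xr|D' D1 Dcov].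
- exact: open_interior.
- have xc : ⟦x - c⟧ != 0 by rewrite xr gt_eqF.
  (* The rotation about [c] that takes [x] to [c1], near which [h] vanishes. *)
  exists ((c1 - c) / (x - c)); first by rewrite /= rnormM rnormV c1rho xr divff// gt_eqF.
  apply: (@near_affine (fun y => h y = 0)); rewrite divfK; first by rewrite subrKC.
  by rewrite -rnorm_eq0.
pose s : seq C := finmap.enum_fset D'.
have s1 w : w \in s -> ⟦w⟧ = 1 by move=> /D1 /set_mem.
pose G x := \prod_(w <- s) h (r w x).
pose M' := Num.max M 1; have M1 : 1 <= M' by rewrite le_max lexx orbT.
have hM' w x : w \in s -> ⟦x - c⟧ <= rho -> ⟦h (r w x)⟧ <= M'.
  by move=> ws xr; rewrite le_max hM// nr// (s1 w).
(* At the centre every rotate takes the value [h c], so it is enough that the product vanishes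
   there. *)
suff /eqP : G c = 0.
  rewrite /G prodf_seq_eq0 => /hasP[w _ /=].
  by rewrite /r subrr mulr0 addr0 => /eqP.
apply/eqP; rewrite -rnorm_eq0 eq_le rnorm_ge0 andbT.
have small x : ⟦x - c⟧ <= rho -> forall w, w \in s ->
    (forall e : R, 0 < e -> \forall y \near x, ⟦h (r w y)⟧ <= e) ->
    forall e : R, 0 < e -> \forall y \near x, ⟦y - c⟧ <= rho -> ⟦G y⟧ <= 0 + e.
  move=> xr w ws hw e e0; have Mp : 0 < M' ^+ size s by rewrite exprn_gt0//; lra.
  have /hw : 0 < e / M' ^+ size s by rewrite divr_gt0.
  apply: filterS => y hy yr; rewrite add0r -(divfK (lt0r_neq0 Mp) e).
  apply: rnorm_prod_small hy => // t ts; exact: hM'.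
apply: (max_principle (u := G) (disc_compact c rho) (lexx 0)); last first.
  by rewrite /= subrr rnorm0 ltW.
move=> x /=; rewrite le_eqVlt => /predU1P[xr|xr].
  have [w ws /= hw] := Dcov _ xr; right; apply: (small x _ w ws); first by rewrite xr.
  move=> e e0; apply: filterS hw => y -> ; by rewrite rnorm0 ltW.
have [[w ws hw]|H] := pselect (exists2 w, w \in s &
    forall e : R, 0 < e -> \forall y \near x, ⟦h (r w y)⟧ <= e).
  by right; apply: (small x (ltW xr) w ws).
left; apply: filterI; last first.
  apply: near_dif_prod => w ws.
  have wr : ⟦r w x - c⟧ < rho by rewrite nr// (s1 w).
  case: (hd _ wr) => [n1|n2].
    by apply: filterS (@near_affine (fun z => differentiable h z) _ _ _ _ n1) => y; exact: dif_affine.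
  exfalso; apply: H; exists w => // e /n2; exact: (@near_affine (fun z => ⟦h z⟧ <= e)).
have : 0 < rho - ⟦x - c⟧ by lra.
move=> /near_rnorm n; apply: filterS (n _ x) => y yx /=.
by have := rdistT y x c; lra.
Qed.

End Markers.

(** * Cauchy estimates *)

Section CauchyEstimates.
Context {R : realType}.
Local Notation C := (Cplx R).
Implicit Types (f u v h chi mu : C -> C) (X : set C) (a b c d x : C) (m s : R).

Lemma cont_div f c d x : {for x, continuous f} -> x != d ->
  {for x, continuous (fun y => (f y - c) * (y - d)^-1)}.
Proof.
move=> fc xd; apply: (@cvgM _ _ (nbhs x)).
  by apply: cvgB; [exact: fc|exact: cvg_cst].
have : differentiable (fun y => (y - d)^-1) x.
  by apply: dif_inv; [apply: dif_sub; [exact: dif_id|exact: dif_cst]|rewrite subr_eq0].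
exact: differentiable_continuous.
Qed.

(** A bound near the rim suffices: the principle is applied on a closed disc containing [x] whose
    radius lies between [rho0] and [rho]. *)
Lemma disc_max_marker u mu (rho rho0 m B : R) : 0 <= m -> rho0 < rho ->
  (forall x, ⟦x⟧ < rho -> ⟦mu x⟧ <= B) ->
  (forall x, ⟦x⟧ < rho -> (\forall y \near x, differentiable u y /\ differentiable mu y) \/
     ((exists M, \forall y \near x, ⟦u y⟧ <= M) /\
      forall e : R, 0 < e -> \forall y \near x, ⟦mu y⟧ <= e)) ->
  (forall x, rho0 < ⟦x⟧ -> ⟦x⟧ < rho -> ⟦u x⟧ <= m) ->
  forall x, ⟦x⟧ < rho -> mu x != 0 -> ⟦u x⟧ <= m.
Proof.
move=> m0 rr muB H um x xr.
have [r [r1 r2 r3]] : exists r : R, [/\ ⟦x⟧ < r, r < rho & rho0 < r].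
  exists ((Num.max ⟦x⟧ rho0 + rho) / 2).
  have : Num.max ⟦x⟧ rho0 < rho by rewrite gt_max xr rr.
  have : ⟦x⟧ <= Num.max ⟦x⟧ rho0 by rewrite le_max lexx.
  have : rho0 <= Num.max ⟦x⟧ rho0 by rewrite le_max lexx orbT.
  by split; lra.
have rho' (y : C) : ⟦y - 0⟧ <= r -> ⟦y⟧ < rho by rewrite subr0 => /le_lt_trans; apply.
apply: (max_principle_marker (disc_compact 0 r) m0 (B := B)) => [y /= yr|c /= cr|] //.
- exact/muB/rho'.
- have [cr'|] := ltP ⟦c⟧ r; last first.
    move=> rc; apply: Or33 => e e0.
    have : 0 < r - rho0 by lra.
    move=> /near_rnorm n; apply: filterS (n _ c) => y yc yr.
    have yr' := rho' _ yr; have := rnorm_dist c y; rewrite rdistC => cy.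
    by have := um y ltac:(lra) yr'; lra.
  case: (H c (rho' _ cr)) => [n1|[n1 n2]].
    apply: Or31; have : 0 < r - ⟦c⟧ by lra.
    move=> /near_rnorm n; apply: filterS2 n1 (n _ c) => y [d1 d2] yc.
    by split=> //; rewrite subr0; have := rnorm_dist y c; lra.
  apply: Or32; split.
    by case: n1 => M n1; exists M; apply: filterS n1 => y yM _.
  by move=> e /n2; apply: filterS => y ? _.
- by rewrite /= subr0 ltW.
Qed.

(** [phi] is continuous, with derivative [a] at 0; elsewhere it is assumed differentiable only off
    the exceptional points, those at which [chi] tends to 0. *)
Variables (phi chi : C -> C) (rho M B : R) (a : C).
Hypothesis rho0 : 0 < rho.
Hypothesis phiM : forall x, ⟦x⟧ < rho -> ⟦phi x⟧ <= M.
Hypothesis chiB : forall x, ⟦x⟧ < rho -> ⟦chi x⟧ <= B.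
Hypothesis phichi : forall x, ⟦x⟧ < rho ->
  (\forall y \near x, differentiable phi y /\ differentiable chi y) \/
  (forall e : R, 0 < e -> \forall y \near x, ⟦chi y⟧ <= e).
Hypothesis phic : forall x, ⟦x⟧ < rho -> {for x, continuous phi}.
Hypothesis chi0 : chi 0 != 0.
Hypothesis phia : forall e : R, 0 < e -> \forall h \near (0 : C), ⟦phi h - phi 0 - a * h⟧ <= e * ⟦h⟧.

Let M0 : 0 <= M.
Proof. by have := phiM (x := 0); rewrite rnorm0 => /(_ rho0); apply: le_trans; exact: rnorm_ge0. Qed.

Let near_disc x : ⟦x⟧ < rho -> \forall y \near x, ⟦y⟧ < rho.
Proof.
move=> xr; have : 0 < rho - ⟦x⟧ by lra.
by move=> /near_rnorm n; apply: filterS (n _ x) => y; have := rnorm_dist y x; lra.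
Qed.

Let near_neq x c : x != c -> \forall y \near x, ⟦x - c⟧ / 2 < ⟦y - c⟧.
Proof.
rewrite -subr_eq0 -rnorm_gt0 => xc; have : 0 < ⟦x - c⟧ / 2 by lra.
move=> /near_rnorm n; apply: filterS (n _ x) => y.
by have := rdistT x y c; rewrite (rdistC x y); lra.
Qed.

(** If [chi] vanished near [x], then [arc_vanish] on the disc about 0 through [x] would give chi 0 =
    0. *)
Let chi_dense x (P : C -> Prop) : ⟦x⟧ < rho -> (\forall y \near x, P y) ->
  exists y, [/\ ⟦y⟧ < rho, chi y != 0 & P y].
Proof.
move=> xr nP; apply: contrapT => H.
have cx0 : \forall y \near x, chi y = 0.
  apply: filterS2 nP (near_disc xr) => y Py yr.
  by apply/eqP; apply: contrapT => cy; apply: H; exists y; split=> //; apply/negP.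
move: chi0; rewrite (@arc_vanish _ chi 0 ⟦x⟧ B x) ?eqxx//.
- move=> y; rewrite subr0 => yx; case: (phichi (lt_trans yx xr)) => [n1|]; last by right.
  by left; apply: filterS n1 => z [].
- by move=> y; rewrite subr0 => yx; apply: chiB; exact: le_lt_trans xr.
- by rewrite subr0.
Qed.

(** At 0 the convention 0^-1 = 0 gives the value 0 instead of [a]; the origin is handled as one more
    exceptional point, with the variable as its marker. *)
Let q x := (phi x - phi 0) * x^-1.

Let q_bounded0 : \forall y \near (0 : C), ⟦q y⟧ <= ⟦a⟧ + 1.
Proof.
apply: filterS (phia ltr01) => y yh.
have [->|y0] := eqVneq y 0.
  by rewrite /q invr0 mulr0 rnorm0 addr_ge0 ?rnorm_ge0.
rewrite rnormM rnormV ler_pdivrMr ?rnorm_gt0//.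
by have := rnorm_dist (phi y - phi 0) (a * y); rewrite rnormM; lra.
Qed.

Let q_le (r : R) x : 0 < r -> r <= ⟦x⟧ -> ⟦x⟧ < rho -> ⟦q x⟧ <= 2 * M / r.
Proof.
move=> r0 rx xr; rewrite rnormM rnormV ler_pM ?invr_ge0 ?rnorm_ge0//.
  have := phiM xr; have := phiM (x := 0); rewrite rnorm0 => /(_ rho0).
  by have := rnormB (phi x) (phi 0); lra.
by rewrite lef_pV2 ?posrE// (lt_le_trans r0).
Qed.

Let dif_q x : x != 0 -> differentiable phi x -> differentiable q x.
Proof.
move=> x0 dp; apply: dif_mul; first by apply: dif_sub => //; exact: dif_cst.
by apply: dif_inv => //; exact: dif_id.
Qed.

Let q_cont x : x != 0 -> ⟦x⟧ < rho -> {for x, continuous q}.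
Proof.
move=> x0 xr; have -> : q = fun y => (phi y - phi 0) * (y - 0)^-1.
  by apply/funext => y; rewrite subr0.
exact: (@cont_div phi (phi 0) 0 x (phic xr) x0).
Qed.

(** Schwarz's lemma with marker [chi x * x]: near the rim, where |x| > rho/2, the quotient is at
    most 2M/(rho/2). *)
Let quotient_bound_chi x : ⟦x⟧ < rho -> x != 0 -> chi x != 0 -> ⟦q x⟧ <= 4 * M / rho.
Proof.
move=> xr x0 cx; have rp := rho0.
have B0 : 0 <= B by apply: le_trans (chiB xr); exact: rnorm_ge0.
have m0 : 0 <= 4 * M / rho by rewrite divr_ge0 ?mulr_ge0// ltW.
have r2 : rho / 2 < rho by lra.
apply: (@disc_max_marker q (fun x => chi x * x) _ _ _ (B * rho) m0 r2) => //.
- by move=> y yr; rewrite rnormM ler_pM ?rnorm_ge0 ?chiB// ltW.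
- move=> y yr; have [->|y0] := eqVneq y 0.
    right; split; first by exists (⟦a⟧ + 1); exact: q_bounded0.
    move=> e e0; have B1 : 0 < B + 1 by lra.
    have eB : 0 < e / (B + 1) by rewrite divr_gt0.
    have eE : (B + 1) * (e / (B + 1)) = e by rewrite mulrC divfK// gt_eqF.
    have n := near_rnorm (0 : C) eB; have := near_disc (x := 0); rewrite rnorm0 => /(_ rho0).
    apply: filterS2 n => z; rewrite subr0 => ze zr; rewrite rnormM.
    apply: le_trans (_ : B * (e / (B + 1)) <= _).
      by apply: ler_pM; rewrite ?rnorm_ge0 ?chiB// ltW.
    by rewrite mulrDl in eE; lra.
  have ny := near_neq y0; case: (phichi yr) => [n1|n2]; [left|right; split].
  + apply: filterS2 n1 ny => z [d1 d2]; rewrite !subr0 => zy; split.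
      by apply: dif_q => //; rewrite -rnorm_gt0; have := rnorm_ge0 y; lra.
    by apply: dif_mul => //; exact: dif_id.
  + exists (2 * M / (⟦y⟧ / 2)); apply: filterS2 ny (near_disc yr) => z.
    rewrite !subr0 => /ltW zy zr; apply: q_le => //.
    by rewrite divr_gt0// rnorm_gt0.
  + move=> e e0; have : 0 < e / rho by rewrite divr_gt0.
    move=> /n2; apply: filterS2 (near_disc yr) => z zr cz; rewrite rnormM.
    by rewrite -(divfK (lt0r_neq0 rho0) e) ler_pM ?rnorm_ge0// ltW.
- move=> y yr yr'; have -> : 4 * M / rho = 2 * M / (rho / 2) by field; rewrite lt0r_neq0.
  by apply: q_le => //; lra.
- by rewrite mulf_neq0.
Qed.

(** Continuity carries a bound from the dense set of nonzeros of [chi] to all points. *)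
Let closed_bound (f : C -> C) (K : R) x : ⟦x⟧ < rho -> x != 0 -> {for x, continuous f} ->
  (forall y, ⟦y⟧ < rho -> y != 0 -> chi y != 0 -> ⟦f y⟧ <= K) -> ⟦f x⟧ <= K.
Proof.
move=> xr x0 fc H; rewrite leNgt; apply/negP => Kf.
have /continuousC/(_ (⟦f x⟧ - K)) fc' := fc.
have {}fc' := fc' ltac:(lra).
have [y [yr cy [y0 fy]]] := chi_dense xr (filterI (near_neq x0) fc').
have := H y yr; rewrite -rnorm_gt0; move: y0; rewrite !subr0 => y0.
move=> /(_ (le_lt_trans _ y0)) H'.
have {}H' := H' ltac:(by rewrite divr_ge0 ?rnorm_ge0) cy.
by have := rnorm_dist (f x) (f y); rewrite rdistC; lra.
Qed.

Let quotient_bound x : ⟦x⟧ < rho -> x != 0 -> ⟦q x⟧ <= 4 * M / rho.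
Proof.
move=> xr x0; apply: (closed_bound xr x0 (q_cont x0 xr)) => y yr y0 cy.
exact: quotient_bound_chi.
Qed.

Lemma lipschitz_estimate x : ⟦x⟧ < rho -> ⟦phi x - phi 0⟧ <= 4 * M / rho * ⟦x⟧.
Proof.
have [->|x0 xr] := eqVneq x 0; first by rewrite subrr rnorm0 mulr0.
by have := quotient_bound xr x0; rewrite rnormM rnormV ler_pdivrMr ?rnorm_gt0.
Qed.

Let q_to_a (e : R) : 0 < e -> \forall h \near (0 : C), h != 0 -> ⟦q h - a⟧ <= e.
Proof.
move=> e0; apply: filterS (phia e0) => h hh h0.
have -> : q h - a = (phi h - phi 0 - a * h) * h^-1 by rewrite /q; field.
by rewrite rnormM rnormV ler_pdivrMr ?rnorm_gt0.
Qed.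

Lemma derivative_estimate : ⟦a⟧ <= 4 * M / rho.
Proof.
apply/ler_addgt0Pr => e e0.
have /nbhsC[d d0 dP] : \forall h \near (0 : C), (h != 0 -> ⟦q h - a⟧ <= e) /\ ⟦h - 0⟧ < rho.
  exact: filterI (q_to_a e0) (near_rnorm (0 : C) rho0).
pose h : C := ((d / 2)%:C)%C.
have hn : ⟦h⟧ = d / 2 by rewrite rnormC ger0_norm//; lra.
have h0 : h != 0 by rewrite -rnorm_gt0 hn; lra.
have [] := dP h; rewrite ?subr0 ?hn; first lra.
rewrite -hn => /(_ h0) ha /quotient_bound/(_ h0).
by have := rnorm_dist a (q h); rewrite rdistC; lra.
Qed.

(** The difference quotient of [q] is based at a nearby point [xi], because [q] is not known to be
    differentiable at 0; later [xi] tends to 0 and q(xi) to [a]. For |y| > 3 rho/4 one has |y - xi|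
    > rho/2, whence the constant (4M/rho + 4M/rho)/(rho/2). *)
Let second_quotient x xi : ⟦x⟧ < rho -> x != 0 -> chi x != 0 ->
  ⟦xi⟧ < rho / 4 -> xi != 0 -> chi xi != 0 ->
  ⟦q x - q xi⟧ <= 16 * M / rho ^+ 2 * ⟦x - xi⟧.
Proof.
move=> xr x0 cx xir xi0 cxi; have rp := rho0.
have [->|xxi] := eqVneq x xi; first by rewrite !subrr !rnorm0 mulr0.
have xir' : ⟦xi⟧ < rho by lra.
pose u y := (q y - q xi) * (y - xi)^-1.
have dif_u y : y != 0 -> y != xi -> differentiable phi y -> differentiable u y.
  move=> y0 yxi dy; apply: dif_mul; first by apply: dif_sub; [exact: dif_q|exact: dif_cst].
  by apply: dif_inv; [apply: dif_sub; [exact: dif_id|exact: dif_cst]|rewrite subr_eq0].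
suff : ⟦u x⟧ <= 16 * M / rho ^+ 2.
  by rewrite rnormM rnormV ler_pdivrMr// rnorm_gt0 subr_eq0.
have B0 : 0 <= B by apply: le_trans (chiB xr); exact: rnorm_ge0.
have Mr : 0 <= 4 * M / rho by rewrite divr_ge0 ?mulr_ge0// ltW.
have u_le y K r : ⟦q y⟧ <= K -> 0 < r -> r <= ⟦y - xi⟧ -> ⟦u y⟧ <= (K + 4 * M / rho) / r.
  move=> qK r0 ry; rewrite rnormM rnormV; apply: ler_pM; rewrite ?invr_ge0 ?rnorm_ge0//.
    by apply: le_trans (rnormB _ _) _; rewrite lerD// quotient_bound.
  by rewrite lef_pV2 ?posrE// (lt_le_trans r0).
have qM y : ⟦y⟧ < rho -> ⟦q y⟧ <= 4 * M / rho.
  have [->|] := eqVneq y 0; last by move=> y0 yr; exact: quotient_bound.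
  by rewrite /q invr0 mulr0 rnorm0.
have small (mu : C -> C) y e : (forall z, ⟦z⟧ < rho -> ⟦mu z⟧ <= B * (2 * rho) * ⟦z - y⟧) ->
    ⟦y⟧ < rho -> 0 < e -> \forall z \near y, ⟦mu z⟧ <= e.
  move=> muP yr e0; have B1 : 0 < B * (2 * rho) + 1 by rewrite ltr_wpDl// mulr_ge0//; lra.
  have : 0 < e / (B * (2 * rho) + 1) by rewrite divr_gt0.
  move=> /(near_rnorm y) n; apply: filterS2 n (near_disc yr) => z zy zr.
  apply: le_trans (muP z zr) _.
  apply: le_trans (_ : (B * (2 * rho) + 1) * ⟦z - y⟧ <= _).
    by apply: ler_wpM2r; [exact: rnorm_ge0|rewrite lerDl].
  by rewrite mulrC -ler_pdivlMr// ltW.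
(* Marker for the three kinds of exceptional points: those of [chi], the origin and [xi]. *)
pose mu y := chi y * (y * (y - xi)).
have muB y : ⟦y⟧ < rho -> ⟦mu y⟧ <= B * (rho * (2 * rho)).
  move=> yr; rewrite !rnormM; apply: ler_pM; rewrite ?mulr_ge0 ?rnorm_ge0 ?chiB//.
  apply: ler_pM; rewrite ?rnorm_ge0// ?ltW//.
  by apply: le_lt_trans (rnormB _ _) _; lra.
have m0 : 0 <= 16 * M / rho ^+ 2 by rewrite divr_ge0 ?mulr_ge0 ?exprn_ge0// ltW.
have r3 : 3 / 4 * rho < rho by lra.
apply: (@disc_max_marker u mu _ _ _ (B * (rho * (2 * rho))) m0 r3) => //.
- move=> y yr; have [->|y0] := eqVneq y 0.
    right; split.
      exists ((4 * M / rho + 4 * M / rho) / (⟦xi⟧ / 2)).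
      have := near_neq (x := 0) (c := xi); rewrite eq_sym => /(_ xi0).
      rewrite sub0r rnormN => n.
      apply: filterS2 n (near_disc (x := 0) _) => [z zx zr|]; last by rewrite rnorm0.
      by apply: u_le; [exact: qM|rewrite divr_gt0// rnorm_gt0|exact: ltW].
    move=> e; apply: small; last by rewrite rnorm0.
    move=> z zr; rewrite subr0 !rnormM (mulrC ⟦z⟧) [leLHS]mulrA.
    apply: ler_wpM2r; first exact: rnorm_ge0.
    apply: ler_pM; rewrite ?rnorm_ge0 ?chiB//.
    by apply: le_trans (rnormB _ _) _; lra.
  have [yxi|yxi] := eqVneq y xi.
    right; split.
      rewrite yxi; have dxi : differentiable q xi.
        apply: dif_q => //; case: (phichi xir') => [/nbhs_singleton[]//|].
        have /[swap] /[apply] /nbhs_singleton : 0 < ⟦chi xi⟧ / 2 by rewrite divr_gt0// rnorm_gt0.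
        have : 0 < ⟦chi xi⟧ by rewrite rnorm_gt0.
        lra.
      have [b /(_ 1 ltr01)] := differentiable1P dxi.
      move=> /nbhsC[d d0 dP]; exists (⟦b⟧ + 1); apply/nbhsC; exists d => // z zd.
      have [->|zxi] := eqVneq z xi.
        by rewrite /u subrr mul0r rnorm0 addr_ge0 ?rnorm_ge0.
      rewrite rnormM rnormV ler_pdivrMr ?rnorm_gt0 ?subr_eq0//.
      have := dP (z - xi); rewrite subr0 subrKC => /(_ zd).
      by have := rnorm_dist (q z - q xi) (b * (z - xi)); rewrite rnormM; lra.
    rewrite yxi => e; apply: small => // z zr; rewrite !rnormM [leLHS]mulrA.
    apply: ler_wpM2r; first exact: rnorm_ge0.
    by apply: ler_pM; rewrite ?rnorm_ge0 ?chiB//; lra.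
  have ny := near_neq y0; have nyx := near_neq yxi.
  case: (phichi yr) => [n1|n2]; [left|right; split].
  + apply: filterS3 n1 ny nyx => z [d1 d2]; rewrite !subr0 => zy zyx; split.
      apply: dif_u => //; first by rewrite -rnorm_gt0; have := rnorm_ge0 y; lra.
      by rewrite -subr_eq0 -rnorm_gt0; have := rnorm_ge0 (y - xi); lra.
    apply: dif_mul; first exact: d2.
    apply: dif_mul; first exact: dif_id.
    by apply: dif_sub; [exact: dif_id|exact: dif_cst].
  + exists ((4 * M / rho + 4 * M / rho) / (⟦y - xi⟧ / 2)).
    apply: filterS2 nyx (near_disc yr) => z zx zr.
    by apply: u_le; [exact: qM|rewrite divr_gt0// rnorm_gt0 subr_eq0|exact: ltW].
  + move=> e e0; have rr : 0 < rho * (2 * rho) by rewrite mulr_gt0//; lra.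
    have : 0 < e / (rho * (2 * rho)) by rewrite divr_gt0.
    move=> /n2; apply: filterS2 (near_disc yr) => z zr cz; rewrite rnormM.
    rewrite -(divfK (lt0r_neq0 rr) e) ler_pM ?rnorm_ge0// rnormM.
    apply: ler_pM; rewrite ?rnorm_ge0 ?ltW//.
    by apply: le_lt_trans (rnormB _ _) _; lra.
- move=> y yr yr'.
  have -> : 16 * M / rho ^+ 2 = (4 * M / rho + 4 * M / rho) / (rho / 2) by field; rewrite lt0r_neq0.
  apply: u_le; [exact: qM|lra|].
  by have := rnorm_dist y xi; lra.
- by rewrite !mulf_neq0// subr_eq0.
Qed.

Lemma taylor_estimate x : ⟦x⟧ < rho -> ⟦phi x - phi 0 - a * x⟧ <= 16 * M / rho ^+ 2 * ⟦x⟧ ^+ 2.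
Proof.
have [->|x0 xr] := eqVneq x 0; first by rewrite subrr mulr0 subr0 rnorm0 expr0n mulr0.
set K := 16 * M / rho ^+ 2; have rp := rho0.
have K0 : 0 <= K by rewrite divr_ge0 ?mulr_ge0 ?exprn_ge0// ltW.
have chi_near0 : \forall y \near (0 : C), chi y != 0.
  have r0 : ⟦0 : C⟧ < rho by rewrite rnorm0.
  have c0 : 0 < ⟦chi 0⟧ by rewrite rnorm_gt0.
  case: (phichi r0) => [/nbhs_singleton[_ /differentiable_continuous/continuousC/(_ _ c0)]|].
    apply: filterS => y; have := rnorm_dist (chi 0) (chi y); rewrite rdistC -rnorm_gt0; lra.
  have /[swap] /[apply] /nbhs_singleton : 0 < ⟦chi 0⟧ / 2 by lra.
  lra.
have key y : ⟦y⟧ < rho -> y != 0 -> chi y != 0 -> ⟦(q y - a) * y^-1⟧ <= K.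
  move=> yr y0 cy; rewrite rnormM rnormV ler_pdivrMr ?rnorm_gt0//.
  (* (K + 1) e' = e pays for replacing [a] by [q h] and for replacing |y| by |y - h|. *)
  apply/ler_addgt0Pr => e e0; pose e' := e / (K + 1).
  have e'0 : 0 < e' by rewrite divr_gt0//; lra.
  have r4 : 0 < Num.min e' (rho / 4) by rewrite lt_min e'0; lra.
  have /nbhsC[d d0 dP] : \forall h \near (0 : C), (h != 0 -> ⟦q h - a⟧ <= e') /\
      (chi h != 0 /\ ⟦h - 0⟧ < Num.min e' (rho / 4)).
    exact: filterI (q_to_a e'0) (filterI chi_near0 (near_rnorm (0 : C) r4)).
  pose h : C := ((d / 2)%:C)%C.
  have hn : ⟦h⟧ = d / 2 by rewrite rnormC ger0_norm//; lra.
  have h0 : h != 0 by rewrite -rnorm_gt0 hn; lra.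
  have [|qa [ch]] := dP h; first by rewrite subr0 hn; lra.
  rewrite subr0 lt_min => /andP[he hr].
  have := second_quotient yr y0 cy hr h0 ch; rewrite -/K.
  have := qa h0; have := rdistT (q y) (q h) a; have := rnormB y h => h1 h2 h3 h4.
  have h5 : K * ⟦y - h⟧ <= K * (⟦y⟧ + e') by apply: ler_wpM2l => //; lra.
  have : (K + 1) * e' = e by rewrite /e' mulrC divfK// gt_eqF//; lra.
  by rewrite mulrDr in h5; rewrite mulrDl; lra.
have h : ⟦(q x - a) * x^-1⟧ <= K.
  apply: (closed_bound (f := fun x => (q x - a) * x^-1)) => //.
  have -> : (fun y => (q y - a) * y^-1) = fun y => (q y - a) * (y - 0)^-1.
    by apply/funext => y; rewrite subr0.
  exact: (@cont_div q a 0 x (q_cont x0 xr) x0).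
have -> : phi x - phi 0 - a * x = ((q x - a) * x^-1) * x ^+ 2 by rewrite /q; field.
rewrite rnormM (rnormX x); apply: ler_wpM2r => //.
by rewrite exprn_ge0 ?rnorm_ge0.
Qed.

End CauchyEstimates.

(** * Cauchy estimates in several variables *)

Section Slices.
Context {R : realType}.
Local Notation C := (Cplx R).
Variable V : normedModType C.
Implicit Types (u h : V -> C) (p x v k : V) (r M B : R).

Lemma dif_line (p k : V) (l : C) : differentiable (fun t : C => p + t *: k) l.
Proof.
apply: (@differentiableD C C V (cst p) (fun t : C => t *: k)); first exact: dif_cst.
by apply: (@differentiableZl C C V (fun t : C => t) k); exact: dif_id.
Qed.

Lemma dif_slice (W : normedModType C) (u : V -> W) p k (l : C) : differentiable u (p + l *: k) ->
  differentiable (fun t : C => u (p + t *: k)) l.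
Proof.
exact: (@differentiable_comp _ _ _ _ (fun t : C => p + t *: k) u _ (dif_line p k l)).
Qed.

Lemma near_slice (P : V -> Prop) p k (l : C) :
  (\forall x \near (p + l *: k), P x) -> \forall t \near l, P (p + t *: k).
Proof. exact: (differentiable_continuous (dif_line p k l)). Qed.

(** On the complex line through [p] in the direction [k] the one-variable estimates hold in a disc
    of radius r/|k|; read at parameter 1, and at 0 for the derivative, they are uniform in the
    direction. *)
Lemma cauchy_estimates u h p r M B (L : {linear V -> C}) : 0 < r ->
  (forall x, ⟦x - p⟧ < r -> ⟦u x⟧ <= M) ->
  (forall x, ⟦x - p⟧ < r -> ⟦h x⟧ <= B) ->
  (forall x, ⟦x - p⟧ < r -> {for x, continuous u}) ->
  (forall x, ⟦x - p⟧ < r -> (\forall y \near x, differentiable u y /\ differentiable h y) \/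
     (forall e : R, 0 < e -> \forall y \near x, ⟦h y⟧ <= e)) ->
  h p != 0 ->
  (forall e : R, 0 < e -> \forall k \near (0 : V), ⟦u (p + k) - u p - L k⟧ <= e * ⟦k⟧) ->
  [/\ forall k, ⟦L k⟧ <= 4 * M / r * ⟦k⟧,
      forall k, ⟦k⟧ < r -> ⟦u (p + k) - u p⟧ <= 4 * M / r * ⟦k⟧ &
      forall k, ⟦k⟧ < r -> ⟦u (p + k) - u p - L k⟧ <= 16 * M / r ^+ 2 * ⟦k⟧ ^+ 2].
Proof.
move=> r0 uM hB uc uh hp uL.
suff main k : k != 0 -> [/\ ⟦L k⟧ <= 4 * M / r * ⟦k⟧,
    ⟦k⟧ < r -> ⟦u (p + k) - u p⟧ <= 4 * M / r * ⟦k⟧ &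
    ⟦k⟧ < r -> ⟦u (p + k) - u p - L k⟧ <= 16 * M / r ^+ 2 * ⟦k⟧ ^+ 2].
  have e0 : u (p + 0) - u p = 0 by rewrite addr0 subrr.
  have L0 : L 0 = 0 by rewrite linear0.
  split=> k; (have [->|/main[]//] := eqVneq k 0) => *.
  - by rewrite L0 !rnorm0 mulr0.
  - by rewrite e0 !rnorm0 mulr0.
  - by rewrite e0 L0 subrr !rnorm0 expr0n mulr0.
move=> k0; have kp : 0 < ⟦k⟧ by rewrite rnorm_gt0.
pose rho := r / ⟦k⟧; have rho0 : 0 < rho by rewrite divr_gt0.
pose phi (t : C) := u (p + t *: k); pose chi (t : C) := h (p + t *: k).
have inb (t : C) : ⟦t⟧ < rho -> ⟦p + t *: k - p⟧ < r.
  by rewrite addrC addKr rnormZ /rho ltr_pdivlMr.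
have phiM t : ⟦t⟧ < rho -> ⟦phi t⟧ <= M by move=> /inb; exact: uM.
have chiB t : ⟦t⟧ < rho -> ⟦chi t⟧ <= B by move=> /inb; exact: hB.
have phichi t : ⟦t⟧ < rho ->
    (\forall y \near t, differentiable phi y /\ differentiable chi y) \/
    (forall e : R, 0 < e -> \forall y \near t, ⟦chi y⟧ <= e).
  move=> /inb /uh [n1|n2]; [left|right].
    apply: filterS (@near_slice (fun x => differentiable u x /\ differentiable h x) _ _ _ n1).
    by move=> y [d1 d2]; split; [exact: dif_slice d1|exact: dif_slice d2].
  by move=> e /n2; exact: (@near_slice (fun x => ⟦h x⟧ <= e)).
have phic t : ⟦t⟧ < rho -> {for t, continuous phi}.
  move=> /inb /uc uct; apply: (@continuous_comp _ _ _ (fun t : C => p + t *: k) u) => //.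
  exact: differentiable_continuous (dif_line p k t).
have chi0 : chi 0 != 0 by rewrite /chi scale0r addr0.
have phia (e : R) : 0 < e -> \forall t \near (0 : C), ⟦phi t - phi 0 - L k * t⟧ <= e * ⟦t⟧.
  move=> e0; have : 0 < e / ⟦k⟧ by rewrite divr_gt0.
  move=> /uL n; have {}n : \forall k0 \near (0 + (0 : C) *: k),
      ⟦u (p + k0) - u p - L k0⟧ <= e / ⟦k⟧ * ⟦k0⟧ by rewrite scale0r addr0.
  apply: filterS (@near_slice (fun k0 => ⟦u (p + k0) - u p - L k0⟧ <= e / ⟦k⟧ * ⟦k0⟧) _ _ _ n).
  move=> t; rewrite add0r /phi scale0r addr0 rnormZ => tn.
  have -> : L k * t = L (t *: k) by rewrite linearZ_LR mulrC.
  by apply: le_trans tn _; rewrite mulrCA mulrC divfK// gt_eqF.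
have k1 : ⟦k⟧ < r -> ⟦1 : C⟧ < rho by rewrite rnorm1 ltr_pdivlMr// mul1r.
have M4 : 4 * M / rho = 4 * M / r * ⟦k⟧ by rewrite /rho invfM invrK mulrA.
have phi1 : phi 1 = u (p + k) by rewrite /phi scale1r.
have phi0 : phi 0 = u p by rewrite /phi scale0r addr0.
split.
- by have := derivative_estimate rho0 phiM chiB phichi phic chi0 phia; rewrite M4.
- move=> /k1 t1; have := lipschitz_estimate rho0 phiM chiB phichi phic chi0 phia t1.
  by rewrite M4 phi0 phi1 rnorm1 mulr1.
- move=> /k1 t1; have := taylor_estimate rho0 phiM chiB phichi phic chi0 phia t1.
  rewrite phi0 phi1 rnorm1 expr1n !mulr1 /rho expr_div_n invfM invrK mulrA.
  by rewrite mulrAC.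
Qed.

Lemma near_ball p r x : ⟦x - p⟧ < r -> \forall y \near x, ⟦y - p⟧ < r.
Proof.
move=> xr; have : 0 < r - ⟦x - p⟧ by lra.
by move=> /near_rnorm n; apply: filterS (n _ x) => y; have := rdistT y x p; lra.
Qed.

Lemma cauchy_estimates_dif u p r M : 0 < r ->
  (forall x, ⟦x - p⟧ < r -> differentiable u x) ->
  (forall x, ⟦x - p⟧ < r -> ⟦u x⟧ <= M) ->
  [/\ forall k, ⟦'d u p k⟧ <= 4 * M / r * ⟦k⟧,
      forall k, ⟦k⟧ < r -> ⟦u (p + k) - u p⟧ <= 4 * M / r * ⟦k⟧ &
      forall k, ⟦k⟧ < r -> ⟦u (p + k) - u p - 'd u p k⟧ <= 16 * M / r ^+ 2 * ⟦k⟧ ^+ 2].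
Proof.
move=> r0 ud uM; have udp : differentiable u p by apply: ud; rewrite subrr rnorm0.
apply: (@cauchy_estimates u (fun=> 1) p r M 1 ('d u p) r0 uM).
- by move=> x _; rewrite rnorm1.
- by move=> x /ud /differentiable_continuous.
- move=> x /near_ball n; left; apply: filterS n => y /ud dy; split => //; exact: dif_cst.
- by rewrite oner_eq0.
- exact: diff_rnorm.
Qed.

End Slices.

Lemma rnorm_sum {R : realType} (V : normedModType (Cplx R)) (I : Type) (s : seq I)
  (P : pred I) (F : I -> V) :
  ⟦\sum_(i <- s | P i) F i⟧ <= \sum_(i <- s | P i) ⟦F i⟧ :> R.
Proof.
elim/big_rec2 : _ => [|i y x _ h]; first by rewrite rnorm0.
by apply: le_trans (rnormD _ _) _; rewrite lerD2l.
Qed.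

Section RowSpace.
Context {R : realType}.
Local Notation C := (Cplx R).
Variable n : nat.
Local Notation V := 'rV[C]_n.
Implicit Types (u h : V -> C) (p x v k a : V) (r M B : R).

Definition dotr a k : C := \sum_i k 0 i * a 0 i.

Lemma dotr_is_linear a : linear (dotr a).
Proof.
move=> c v w; rewrite /dotr scaler_sumr -big_split /=.
by apply: eq_bigr => i _; rewrite !mxE mulrDl -mulrA.
Qed.
HB.instance Definition _ a :=
  GRing.isLinear.Build C V C _ (dotr a) (dotr_is_linear a).

Lemma dotr_continuous a : continuous (dotr a).
Proof.
move=> x; apply: differentiable_continuous; apply: dif_sum => i.
by apply: dif_mul; [exact: coord_differentiable|exact: dif_cst].
Qed.

Lemma rnorm_dotr a k : ⟦dotr a k⟧ <= n%:R * ⟦a⟧ * ⟦k⟧.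
Proof.
apply: le_trans (_ : \sum_(i < n) ⟦a⟧ * ⟦k⟧ <= _); last first.
  by rewrite sumr_const card_ord -mulrA mulr_natl.
apply: le_trans (rnorm_sum _ _ _) _; apply: ler_sum => i _.
by rewrite rnormM mulrC ler_pM ?rnorm_ge0 ?rnorm_coord.
Qed.

Lemma dotr_lin (L : {linear V -> C}) k : L k = dotr (\row_i L (delta_mx 0 i)) k.
Proof.
rewrite [in LHS](row_sum_delta k) linear_sum; apply: eq_bigr => i _.
by rewrite mxE linearZ_LR.
Qed.

Lemma rnorm_delta i : ⟦delta_mx 0 i : V⟧ <= 1.
Proof.
by apply: rnorm_row_le => // j; rewrite mxE /=; case: (j == i); rewrite ?rnorm1 ?rnorm0.
Qed.

(** The linear maps are given by rows in a compact ball. A cluster point of the rows for e = 1/(m +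
    1) keeps the quadratic remainder and loses the additive error. *)
Lemma differentiable_limit u p r K M : 0 < r -> 0 <= M -> 0 <= K ->
  (forall e : R, 0 < e -> exists L : {linear V -> C},
     (forall k, ⟦L k⟧ <= M * ⟦k⟧) /\
     forall k, ⟦k⟧ < r -> ⟦u (p + k) - u p - L k⟧ <= K * ⟦k⟧ ^+ 2 + e) ->
  differentiable u p.
Proof.
move=> r0 M0 K0 H.
have /choice[a aP] : forall m : nat, exists a : V, ⟦a - 0⟧ <= M /\
    forall k, ⟦k⟧ < r -> ⟦u (p + k) - u p - dotr a k⟧ <= K * ⟦k⟧ ^+ 2 + m.+1%:R^-1.
  move=> m; have /H[L [L1 L2]] : 0 < m.+1%:R^-1 :> R by rewrite invr_gt0.
  exists (\row_i L (delta_mx 0 i)); split; last by move=> k /L2; rewrite (dotr_lin L).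
  rewrite subr0; apply: rnorm_row_le => // i; rewrite mxE.
  by apply: le_trans (L1 _) _; rewrite ler_piMr ?rnorm_delta.
have aM : (a @ \oo) [set v | ⟦v - 0⟧ <= M] by exists 0%N => // m _; exact: (aP m).1.
have [b [_ bc]] := cball_compact 0 M (a @ \oo) _ aM.
have bP k : ⟦k⟧ < r -> ⟦u (p + k) - u p - dotr b k⟧ <= K * ⟦k⟧ ^+ 2.
  move=> kr; apply/ler_addgt0Pr => e e0.
  pose d := e / 2 / (n%:R * ⟦k⟧ + 1).
  have nk : 0 <= n%:R * ⟦k⟧ by rewrite mulr_ge0 ?rnorm_ge0.
  have d0 : 0 < d by rewrite !divr_gt0//; lra.
  have [N NP] : exists N : nat, N.+1%:R^-1 < e / 2.
    have e2 : 0 < e / 2 by rewrite divr_gt0.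
    by have [N _ /(_ N (leqnn N))] := near_infty_natSinv_lt (PosNum e2); exists N.
  have [c [[m /= Nm <-] cb]] : ([set a m | m in [set m | (N <= m)%N]] `&` [set c | ⟦c - b⟧ < d]) !=set0.
    apply: bc; last exact: (near_rnorm (b : V) d0).
    by exists N => // m /= Nm; exists m.
  have := (aP m).2 k kr; have := rnorm_dotr (a m - b) k.
  have -> : dotr (a m - b) k = dotr (a m) k - dotr b k.
    by rewrite /dotr -sumrB; apply: eq_bigr => i _; rewrite !mxE mulrBr.
  have := rnormD (u (p + k) - u p - dotr (a m) k) (dotr (a m) k - dotr b k).
  rewrite addrA subrK; have : m.+1%:R^-1 <= N.+1%:R^-1 :> R.
    by rewrite lef_pV2 ?posrE// ler_nat.
  have dE : (n%:R * ⟦k⟧ + 1) * d = e / 2 by rewrite /d mulrC divfK// gt_eqF//; lra.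
  have h1 : n%:R * ⟦k⟧ * ⟦a m - b⟧ <= n%:R * ⟦k⟧ * d by apply: ler_wpM2l => //; exact: ltW.
  have -> : n%:R * ⟦a m - b⟧ * ⟦k⟧ = n%:R * ⟦k⟧ * ⟦a m - b⟧ by ring.
  move: NP h1 dE; rewrite mulrDl mul1r.
  move: (N.+1%:R^-1) (m.+1%:R^-1) (n%:R * ⟦k⟧ * ⟦a m - b⟧) (n%:R * ⟦k⟧ * d) (K * ⟦k⟧ ^+ 2).
  by move: ⟦_⟧ ⟦_⟧ ⟦_⟧ => *; lra.
apply/differentiableC; exists (dotr b); split; first exact: dotr_continuous.
move=> e e0; have rK : 0 < Num.min r (e / (K + 1)).
  by rewrite lt_min r0 divr_gt0//; lra.
apply: filterS (near_rnorm 0 rK) => k; rewrite subr0 lt_min => /andP[kr ke].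
apply: le_trans (bP k kr) _; rewrite expr2 mulrA; apply: ler_wpM2r; first exact: rnorm_ge0.
have K1 : 0 < K + 1 by lra.
move: ke; rewrite ltr_pdivlMr// => ke; have := rnorm_ge0 k; rewrite mulrDr in ke; lra.
Qed.
End RowSpace.

(** * Limits, removable singularities and derivatives *)

Section Regularity.
Context {R : realType}.
Local Notation C := (Cplx R).
Lemma local_bound (W W' : normedModType C) (u : W -> W') (p : W) : {for p, continuous u} ->
  exists2 r : R, 0 < r & forall x, ⟦x - p⟧ < r -> ⟦u x⟧ <= ⟦u p⟧ + 1.
Proof.
move=> /continuousC/(_ 1 ltr01)/nbhsC[r r0 rP]; exists r => // x /rP.
by have := rnorm_dist (u x) (u p); lra.
Qed.

Lemma near_eq_dif (W W' : normedModType C) (f g : W -> W') (x : W) :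
  (\forall y \near x, f y = g y) -> differentiable f x -> differentiable g x.
Proof.
move=> fg /differentiableC[L [Lc H]]; apply/differentiableC; exists L; split=> // e e0.
have fg0 := nbhs_singleton fg.
have : \forall h \near (0 : W), f (x + h) = g (x + h).
  have /nbhsC[d d0 dP] := fg; apply/nbhsC; exists d => // h; rewrite subr0 => hd.
  by apply: dP; rewrite addrC addKr.
by apply: filterS2 (H e e0) => h hh <-; rewrite -fg0.
Qed.

Variable n : nat.
Local Notation V := 'rV[C]_n.
Implicit Types (u h w : V -> C) (p x v k a : V) (r M B : R).

Lemma bound_ge0 u p r M : 0 < r -> (forall x, ⟦x - p⟧ < r -> ⟦u x⟧ <= M) -> 0 <= M.
Proof. by move=> r0 /(_ p); rewrite subrr rnorm0 => /(_ r0); apply: le_trans; exact: rnorm_ge0. Qed.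

(** By the Cauchy estimates the differentials of the approximants are uniformly bounded, with a
    uniform quadratic remainder: just what [differentiable_limit] asks. *)
Lemma weierstrass u p r M : 0 < r ->
  (forall e : R, 0 < e -> exists w, forall x, ⟦x - p⟧ < r ->
     [/\ differentiable w x, ⟦w x⟧ <= M & ⟦w x - u x⟧ <= e]) ->
  differentiable u p.
Proof.
move=> r0 H; have M0 : 0 <= M.
  by have [w wP] := H 1 ltr01; apply: (@bound_ge0 w p r) => // x /wP[].
have r1 : ⟦p - p⟧ < r by rewrite subrr rnorm0.
apply: (@differentiable_limit _ _ u p r (16 * M / r ^+ 2) (4 * M / r)) => //.
- by rewrite divr_ge0 ?mulr_ge0// ltW.
- by rewrite divr_ge0 ?mulr_ge0 ?exprn_ge0// ltW.
move=> e e0; have /H[w wP] : 0 < e / 2 by rewrite divr_gt0.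
have [] := @cauchy_estimates_dif _ _ w p r M r0; [by move=> x /wP[]|by move=> x /wP[]|].
move=> L1 _ L2; exists ('d w p); split=> // k kr.
have [_ _ h1] := wP _ r1; have := wP (p + k); rewrite addrC addKr => /(_ kr)[_ _ h2].
have h3 := L2 k kr.
rewrite (_ : u (p + k) - u p - 'd w p k =
  (w (p + k) - w p - 'd w p k) + (w p - u p) - (w (p + k) - u (p + k))); last by ring.
have := rnormB (w (p + k) - w p - 'd w p k + (w p - u p)) (w (p + k) - u (p + k)).
have := rnormD (w (p + k) - w p - 'd w p k) (w p - u p).
lra.
Qed.

(** The Taylor estimate holds at points [q] with [h q] nonzero, with constants independent of [q].
    Recentred at [p], it is spoilt by an error proportional to |p - q|, which can be made
    arbitrarily small. *)
Lemma removable u h p r M B : 0 < r ->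
  (forall x, ⟦x - p⟧ < r -> ⟦u x⟧ <= M) ->
  (forall x, ⟦x - p⟧ < r -> ⟦h x⟧ <= B) ->
  (forall x, ⟦x - p⟧ < r -> {for x, continuous u}) ->
  (forall x, ⟦x - p⟧ < r -> (\forall y \near x, differentiable u y /\ differentiable h y) \/
     (forall e : R, 0 < e -> \forall y \near x, ⟦h y⟧ <= e)) ->
  (forall d : R, 0 < d -> exists2 x, ⟦x - p⟧ < d & h x != 0) ->
  differentiable u p.
Proof.
move=> r0 uM hB uc uh hd; have M0 := bound_ge0 r0 uM.
have [K KE] : exists K, K = 64 * M / r ^+ 2 by exists (64 * M / r ^+ 2).
have [L1 L1E] : exists L1, L1 = 8 * M / r by exists (8 * M / r).
have K0 : 0 <= K by rewrite KE divr_ge0 ?mulr_ge0 ?exprn_ge0// ltW.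
have L10 : 0 <= L1 by rewrite L1E divr_ge0 ?mulr_ge0// ltW.
apply: (@differentiable_limit _ _ u p (r / 4) (2 * K) L1) => //.
- lra.
- by rewrite mulr_ge0.
(* Recentring costs K(2 d^2) from the quadratic term and L1 d twice from the linear ones; d <= 1
   allows d^2 <= d. *)
move=> e e0; pose d := Num.min (Num.min 1 (r / 4)) (e / (2 * K + 2 * L1 + 1)).
have D0 : 0 < 2 * K + 2 * L1 + 1 by lra.
have d0 : 0 < d by rewrite !lt_min ltr01 !divr_gt0.
have [d1 d2 d3] : [/\ d <= 1, d <= r / 4 & d * (2 * K + 2 * L1 + 1) <= e].
  by rewrite -ler_pdivlMr// !ge_min !lexx !orbT.
clearbody d; have [q qp hq] := hd d d0.
have r2 : 0 < r / 2 by lra.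
have inb x : ⟦x - q⟧ < r / 2 -> ⟦x - p⟧ < r.
  have := rdistT x q p; move: qp d2 r0; move: ⟦x - q⟧ ⟦x - p⟧ ⟦q - p⟧; clear; move=> a b c; lra.
have qd : differentiable u q.
  have qr : ⟦q - p⟧ < r by lra.
  case: (uh q qr) => [/nbhs_singleton[]//|].
  have /[swap] /[apply] /nbhs_singleton : 0 < ⟦h q⟧ / 2 by rewrite divr_gt0// rnorm_gt0.
  have : 0 < ⟦h q⟧ by rewrite rnorm_gt0.
  lra.
have [] := @cauchy_estimates _ _ u h q (r / 2) M B ('d u q) r2.
- by move=> x /inb; exact: uM.
- by move=> x /inb; exact: hB.
- by move=> x /inb; exact: uc.
- by move=> x /inb; exact: uh.
- exact: hq.
- exact: diff_rnorm.
have -> : 4 * M / (r / 2) = L1 by rewrite L1E; field; rewrite gt_eqF.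
have -> : 16 * M / (r / 2) ^+ 2 = K by rewrite KE; field; rewrite gt_eqF.
move=> h1 h2 h3; exists ('d u q); split => // k kr.
have pqd : ⟦p - q⟧ < d by rewrite rdistC.
have kq : ⟦k + (p - q)⟧ <= ⟦k⟧ + d.
  by apply: le_trans (rnormD _ _) _; rewrite lerD2l ltW.
have kqr : ⟦k + (p - q)⟧ < r / 2.
  by move: kq kr d2; move: ⟦k + _⟧ ⟦k⟧; clear; move=> a b; lra.
have pqr : ⟦p - q⟧ < r / 2 by move: pqd d2 r0; move: ⟦p - q⟧; clear; move=> a; lra.
have h4 := h3 (k + (p - q)) kqr; have h5 := h2 (p - q) pqr.
rewrite subrKC in h5; rewrite linearD (_ : q + (k + (p - q)) = p + k) in h4; last first.
  by rewrite addrCA subrKC addrC.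
have h6 : ⟦u p - u q⟧ <= L1 * d.
  by apply: le_trans h5 _; apply: ler_wpM2l => //; exact: ltW.
have h7 : ⟦'d u q (p - q)⟧ <= L1 * d.
  by apply: le_trans (h1 _) _; apply: ler_wpM2l => //; exact: ltW.
have h8 : K * ⟦k + (p - q)⟧ ^+ 2 <= K * (2 * ⟦k⟧ ^+ 2 + 2 * d).
  apply: ler_wpM2l => //; apply: (@le_trans _ _ ((⟦k⟧ + d) ^+ 2)).
    by rewrite lerXn2r ?nnegrE ?addr_ge0 ?rnorm_ge0// ltW.
  have : d ^+ 2 <= d by rewrite expr2 ler_piMl// ltW.
  have := sqr_ge0 (⟦k⟧ - d); rewrite sqrrB sqrrD.
  by move: ⟦k⟧; clear; move=> a; lra.
rewrite (_ : u (p + k) - u p - 'd u q k =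
  (u (p + k) - u q - ('d u q k + 'd u q (p - q))) - (u p - u q) + 'd u q (p - q)); last by ring.
have := rnormD (u (p + k) - u q - ('d u q k + 'd u q (p - q)) - (u p - u q)) ('d u q (p - q)).
have := rnormB (u (p + k) - u q - ('d u q k + 'd u q (p - q))) (u p - u q).
rewrite !mulrDr mulr1 in h8 d3.
have q1 : d * (2 * K) = 2 * (K * d) by ring.
have q2 : d * (2 * L1) = 2 * (L1 * d) by ring.
have q3 : K * (2 * ⟦k⟧ ^+ 2) = 2 * K * ⟦k⟧ ^+ 2 by ring.
have q4 : K * (2 * d) = 2 * (K * d) by ring.
move: h4 h6 h7 h8 d3 q1 q2 q3 q4 d0; clear; lra.
Qed.

(** The quotients (u(x + tv) - u(x))/t are holomorphic and, by the quadratic remainder, uniformly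
    close to the derivative along [v]. *)
Lemma partial_dif u p v : (\forall x \near p, differentiable u x) ->
  differentiable (fun x => 'd u x v) p.
Proof.
move=> nd; have /local_bound[r1 r10 r1P] := differentiable_continuous (nbhs_singleton nd).
have /nbhsC[r2 r20 r2P] := nd.
set M := ⟦u p⟧ + 1 in r1P; have M0 : 0 <= M by rewrite addr_ge0 ?rnorm_ge0.
pose r := Num.min r1 r2; have r0 : 0 < r by rewrite lt_min r10.
have rP y : ⟦y - p⟧ < r -> differentiable u y /\ ⟦u y⟧ <= M.
  by rewrite lt_min => /andP[/r1P ? /r2P].
clearbody r; have rr2 : 0 < r / 2 by lra.
have inb x y : ⟦x - p⟧ < r / 2 -> ⟦y - x⟧ < r / 2 -> differentiable u y /\ ⟦u y⟧ <= M.
  by move=> xp yx; apply: rP; rewrite (splitr r); apply: le_lt_trans (rdistT y x p) _; exact: ltrD.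
have est x : ⟦x - p⟧ < r / 2 -> _ := fun xp => @cauchy_estimates_dif _ _ u x (r / 2) M rr2
  (fun y yx => (inb x y xp yx).1) (fun y yx => (inb x y xp yx).2).
pose A := 4 * M / (r / 2) * ⟦v⟧; pose K := 16 * M / (r / 2) ^+ 2 * ⟦v⟧ ^+ 2.
have K0 : 0 <= K by rewrite mulr_ge0 ?exprn_ge0 ?rnorm_ge0// divr_ge0 ?mulr_ge0 ?exprn_ge0// ltW.
apply: (@weierstrass _ p (r / 2) A) => // e e0.
pose t := Num.min (r / 2 / (⟦v⟧ + 1)) (e / (K + 1)).
have v1 : 0 < ⟦v⟧ + 1 by have := rnorm_ge0 v; lra.
have t0 : 0 < t by rewrite lt_min !divr_gt0//; lra.
have [t1 t2] : t * (⟦v⟧ + 1) <= r / 2 /\ t * (K + 1) <= e.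
  by rewrite -!ler_pdivlMr ?ge_min ?lexx ?orbT//; lra.
pose tc : C := (t%:C)%C; have tcn : ⟦tc⟧ = t by rewrite rnormC ger0_norm// ltW.
have tc0 : tc != 0 by rewrite -rnorm_gt0 tcn.
have tv : ⟦tc *: v⟧ < r / 2 by rewrite rnormZ tcn; rewrite mulrDr in t1; lra.
exists (fun x => (u (x + tc *: v) - u x) * tc^-1) => x xp.
have [e1 e2 e3] := est x xp; split.
- apply: dif_mul; last exact: dif_cst.
  apply: dif_sub; last by apply: (inb x x xp _).1; rewrite subrr rnorm0.
  apply: (@differentiable_comp _ _ _ _ (fun x => x + tc *: v) u).
    by apply: (@differentiableD _ _ _ id (cst (tc *: v))); [exact: dif_id|exact: dif_cst].
  by apply: (inb x _ xp _).1; rewrite addrC addKr.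
- rewrite rnormM rnormV tcn ler_pdivrMr//; apply: le_trans (e2 _ tv) _.
  by rewrite rnormZ tcn /A (mulrC t) mulrA.
- have := e3 _ tv; rewrite linearZ_LR /= rnormZ tcn => e3'.
  have -> : (u (x + tc *: v) - u x) * tc^-1 - 'd u x v =
     (u (x + tc *: v) - u x - tc * 'd u x v) * tc^-1 by field.
  rewrite rnormM rnormV tcn ler_pdivrMr//; apply: le_trans e3' _.
  have -> : 16 * M / (r / 2) ^+ 2 * (t * ⟦v⟧) ^+ 2 = t * K * t.
    by rewrite /K; move: (16 * M / (r / 2) ^+ 2) => c; ring.
  by apply: ler_wpM2r; [exact: ltW|rewrite mulrDr in t2; lra].
Qed.

End Regularity.

(** * Injective holomorphic maps *)

Section Jacobian.
Context {R : realType}.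
Local Notation C := (Cplx R).

Lemma rdist_lt (V : normedModType C) (x y z : V) (a b r : R) :
  ⟦x - y⟧ < a -> ⟦y - z⟧ < b -> a + b <= r -> ⟦x - z⟧ < r.
Proof.
move=> xy yz; apply: lt_le_trans; apply: le_lt_trans (rdistT x y z) _.
exact: ltrD.
Qed.

Lemma EVT_compact_min (T : topologicalType) (f : T -> R) (A : set T) :
  A !=set0 -> compact A -> (forall x, A x -> {for x, continuous f}) ->
  exists2 c, A c & forall t, A t -> f c <= f t.
Proof.
move=> A0 cA fc.
have [|c Ac cmax] := @EVT_compact R T (fun x => - f x) A A0 cA.
  by move=> x /fc fx; apply: continuousN fx.
by exists c => // t /cmax; rewrite lerN2.
Qed.

Lemma coord_dotr n (v : 'rV[C]_n) i : v 0 i = dotr (delta_mx 0 i) v.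
Proof.
rewrite /dotr (bigD1 i)//= mxE !eqxx mulr1 big1 ?addr0// => j ji.
by rewrite mxE eqxx (negbTE ji) mulr0.
Qed.

Lemma dif_row (V : normedModType C) n (f : V -> 'rV[C]_n) x :
  (forall i, differentiable (fun y => f y 0 i) x) -> differentiable f x.
Proof.
move=> fi; have -> : f = fun y => \sum_i f y 0 i *: delta_mx 0 i.
  by apply/funext => y; rewrite [LHS]row_sum_delta.
rewrite -[X in differentiable X _]fct_sumE.
apply: differentiable_sum => i; apply: differentiableZl; exact: fi.
Qed.

Lemma dif_coord (V : normedModType C) n (f : V -> 'rV[C]_n) x i :
  differentiable f x -> differentiable (fun y => f y 0 i) x.
Proof.
move=> df; apply: (@differentiable_comp _ _ _ _ f (fun v : 'rV[C]_n => v 0 i)) => //.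
exact: coord_differentiable.
Qed.

Lemma diff_coord (V : normedModType C) n (f : V -> 'rV[C]_n) x i h :
  differentiable f x -> 'd (fun y => f y 0 i) x h = ('d f x h) 0 i.
Proof.
move=> df; have -> : (fun y => f y 0 i) = dotr (delta_mx 0 i) \o f.
  by apply/funext => y; rewrite coord_dotr.
have cd := @dotr_continuous R n (delta_mx 0 i).
have dc : differentiable (dotr (delta_mx 0 i)) (f x) by exact: linear_differentiable.
by rewrite (diff_comp df dc) /= (diff_lin _ cd) [RHS]coord_dotr.
Qed.

Variable n : nat.
Local Notation V := 'rV[C]_n.
Implicit Types (f g : V -> V) (x y v : V).

(** Vectors are rows and matrices act on the right, so this is the transpose of the usual
    Jacobian. *)
Definition jac f x : 'M[C]_n := \matrix_(i, j) 'd (fun y => f y 0 j) x (delta_mx 0 i).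

Lemma jacE f x v : differentiable f x -> 'd f x v = v *m jac f x.
Proof.
move=> df; apply/rowP => j; rewrite !mxE [in LHS](row_sum_delta v) linear_sum summxE.
by apply: eq_bigr => i _; rewrite linearZ_LR /= !mxE diff_coord.
Qed.

Lemma dif_prod_seq (T : Type) (s : seq T) (P : pred T) (F : T -> V -> C) x :
  (forall t, differentiable (F t) x) -> differentiable (fun y => \prod_(t <- s | P t) F t y) x.
Proof.
move=> dF; elim: s => [|t s IH]; first by under eq_fun do rewrite big_nil; exact: dif_cst.
under eq_fun do rewrite big_cons.
by case: (P t); [apply: dif_mul; [exact: dF|exact: IH]|exact: IH].
Qed.

Lemma dif_sum_seq (T : Type) (s : seq T) (P : pred T) (F : T -> V -> C) x :
  (forall t, differentiable (F t) x) -> differentiable (fun y => \sum_(t <- s | P t) F t y) x.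
Proof.
move=> dF; elim: s => [|t s IH]; first by under eq_fun do rewrite big_nil; exact: dif_cst.
under eq_fun do rewrite big_cons.
by case: (P t); [apply: dif_add; [exact: dF|exact: IH]|exact: IH].
Qed.

Lemma dif_jacobian f x : (\forall y \near x, differentiable f y) ->
  differentiable (fun y => \det (jac f y)) x.
Proof.
move=> nf; rewrite /determinant; apply: dif_sum_seq => s.
apply: dif_mul; first exact: dif_cst.
apply: dif_prod_seq => i; under eq_fun do rewrite mxE.
by apply: partial_dif; apply: filterS nf => y; exact: dif_coord.
Qed.

Lemma rnorm_mulmx_le (B : 'M[C]_n) : exists2 K : R, 0 < K & forall v, ⟦v *m B⟧ <= K * ⟦v⟧.
Proof.
pose K : R := \sum_i \sum_j ⟦B i j⟧ + 1.
have K0 : 0 <= \sum_i \sum_j ⟦B i j⟧ :> R.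
  by apply: sumr_ge0 => i _; apply: sumr_ge0 => j _; exact: rnorm_ge0.
exists K => [|v]; first by rewrite ltr_wpDl.
apply: rnorm_row_le => [|j]; first by rewrite mulr_ge0 ?rnorm_ge0// addr_ge0.
rewrite mxE; apply: le_trans (rnorm_sum _ _ _) _.
rewrite /K mulrDl mul1r ler_wpDr ?rnorm_ge0// mulr_suml; apply: ler_sum => i _.
rewrite rnormM mulrC ler_pM ?rnorm_ge0 ?rnorm_coord// (bigD1 j)//= lerDl.
by apply: sumr_ge0 => k _; exact: rnorm_ge0.
Qed.

Lemma mulmx_continuous (B : 'M[C]_n) : continuous (fun v : V => v *m B).
Proof.
move=> x; apply/continuousC => e e0; have [K K0 KP] := rnorm_mulmx_le B.
have : 0 < e / K by rewrite divr_gt0.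
move=> /near_rnorm nx; apply: filterS (nx _ x) => y; rewrite ltr_pdivlMr// => yx.
by rewrite -mulmxBl; apply: le_lt_trans (KP _) _; rewrite mulrC.
Qed.

(** On a ball of radius r, [f] minus its affine part at [x] is at most (e/8) r; the Lipschitz
    estimate on balls of radius r/2 gives the constant 4 (e r/8)/(r/2) = e. *)
Lemma strictly_differentiable f x (e : R) : 0 < e -> (\forall y \near x, differentiable f y) ->
  exists2 r : R, 0 < r & forall y z, ⟦y - x⟧ < r -> ⟦z - x⟧ < r ->
    ⟦f z - f y - 'd f x (z - y)⟧ <= e * ⟦z - y⟧.
Proof.
move=> e0 nf; have fx := nbhs_singleton nf.
pose g y := f y - 'd f x (y - x) - f x.
have e8 : 0 < e / 8 by rewrite divr_gt0.
have /nbhsC[r r0 rP] : \forall y \near x, differentiable f y /\ ⟦g y⟧ <= e / 8 * ⟦y - x⟧.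
  apply: filterI => //; have /nbhsC[d d0 dP] := diff_rnorm fx e8.
  apply/nbhsC; exists d => // y yx; have := dP (y - x); rewrite subr0 subrKC => /(_ yx).
  by rewrite /g addrAC.
have r4 : 0 < r / 4 by lra.
exists (r / 4) => // y z yx zx; apply: rnorm_row_le => [|i].
  by rewrite mulr_ge0 ?rnorm_ge0// ltW.
have r2 : 0 < r / 2 by lra.
have inb w : ⟦w - y⟧ < r / 2 -> ⟦w - x⟧ < r.
  by move=> wy; apply: le_lt_trans (rdistT w y x) _; clear -wy yx r0; lra.
have gb w : ⟦w - y⟧ < r / 2 -> ⟦g w 0 i⟧ <= e / 8 * r.
  move=> /inb wr; apply: le_trans (rnorm_coord _ _) _; apply: le_trans (rP _ wr).2 _.
  by apply: ler_wpM2l; exact: ltW.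
have gd w : ⟦w - y⟧ < r / 2 -> differentiable (fun w => g w 0 i) w.
  move=> /inb wr; apply: (@dif_coord _ _ g).
  apply: (@differentiableB _ _ _ (fun y => f y - 'd f x (y - x)) (cst (f x))); last exact: dif_cst.
  apply: (@differentiableB _ _ _ f (fun y => 'd f x (y - x))); first exact: (rP _ wr).1.
  apply: (@differentiable_comp _ _ _ _ (fun y => y - x) ('d f x)).
    by apply: (@differentiableB _ _ _ id (cst x)); [exact: dif_id|exact: dif_cst].
  by apply: linear_differentiable; exact: diff_continuous.
have [_ + _] := cauchy_estimates_dif r2 gd gb.
have zy : ⟦z - y⟧ < r / 2.
  by apply: le_lt_trans (rdistT z x y) _; rewrite (rdistC x); clear -yx zx; lra.
move=> /(_ _ zy); rewrite subrKC.
have -> : 4 * (e / 8 * r) / (r / 2) = e by field; rewrite gt_eqF.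
congr (_ <= _); congr rnorm; rewrite /g !mxE.
have -> : 'd f x (z - y) = 'd f x (z - x) - 'd f x (y - x).
  by rewrite -linearB opprB addrA subrK.
by rewrite !mxE; ring.
Qed.

Lemma local_injectivity f x : (\forall y \near x, differentiable f y) ->
  \det (jac f x) != 0 -> exists k r : R, [/\ 0 < k, 0 < r,
    forall y, ⟦y - x⟧ < r -> differentiable f y &
    forall y z, ⟦y - x⟧ < r -> ⟦z - x⟧ < r -> k * ⟦z - y⟧ <= ⟦f z - f y⟧].
Proof.
move=> nf d0; have fx := nbhs_singleton nf.
have Au : jac f x \in unitmx by rewrite unitmxE unitfE.
have [K K0 KP] := rnorm_mulmx_le (invmx (jac f x)).
pose k := K^-1 / 2; have k0 : 0 < k by rewrite divr_gt0 ?invr_gt0.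
have [r1 r10 r1P] := strictly_differentiable k0 nf.
have /nbhsC[r2 r20 r2P] := nf.
exists k, (Num.min r1 r2); split.
- exact: k0.
- by rewrite lt_min r10.
- by move=> y; rewrite lt_min => /andP[_ /r2P].
- move=> y z; rewrite !lt_min => /andP[y1 _] /andP[z1 _].
  have := r1P _ _ y1 z1; rewrite jacE//.
  have : K^-1 * ⟦z - y⟧ <= ⟦(z - y) *m jac f x⟧.
    by rewrite ler_pdivrMl// -[in leLHS](mulmxK Au (z - y)).
  have := rnorm_dist ((z - y) *m jac f x) (f z - f y); rewrite rdistC.
  have -> : K^-1 = k + k by rewrite /k; lra.
  rewrite mulrDl; move: (k * ⟦z - y⟧) ⟦f z - f y⟧ ⟦(z - y) *m jac f x⟧.
  by move: ⟦f z - f y - (z - y) *m jac f x⟧; clear; move=> *; lra.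
Qed.

Lemma jac_unit f x (k r : R) : 0 < k -> 0 < r -> differentiable f x ->
  (forall z, ⟦z - x⟧ < r -> k * ⟦z - x⟧ <= ⟦f z - f x⟧) -> \det (jac f x) != 0.
Proof.
move=> k0 r0 fx fk; apply/negP => /det0P[v v0 vA].
have vp : 0 < ⟦v⟧ by rewrite rnorm_gt0.
have k2 : 0 < k / 2 by lra.
have /nbhsC[d d0 dP] := diff_rnorm fx k2.
pose t := Num.min d r / 2 / ⟦v⟧; pose w := (t%:C)%C *: v.
have t0 : 0 < t by rewrite !divr_gt0// lt_min d0.
have wn : ⟦w⟧ = Num.min d r / 2.
  by rewrite /w rnormZ rnormC ger0_norm ?ltW// /t divfK// gt_eqF.
have m0 : 0 < Num.min d r by rewrite lt_min d0.
have [md mr] : Num.min d r <= d /\ Num.min d r <= r by rewrite !ge_min !lexx orbT.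
have := dP w; rewrite subr0 => /(_ ltac:(lra)).
rewrite jacE// /w -scalemxAl vA scaler0 subr0 -/w.
have := fk (x + w); rewrite addrC addKr [x + w]addrC => /(_ ltac:(lra)).
rewrite [w + x]addrC wn; nra.
Qed.

(** Minimize |f y - c| over a closed ball. The lower Lipschitz bound keeps the minimum off the
    sphere and makes the differential there invertible, so a positive minimum could be lowered. *)
Lemma local_surjectivity f x (k r : R) : 0 < k -> 0 < r ->
  (forall y, ⟦y - x⟧ < r -> differentiable f y) ->
  (forall y z, ⟦y - x⟧ < r -> ⟦z - x⟧ < r -> k * ⟦z - y⟧ <= ⟦f z - f y⟧) ->
  forall c, ⟦c - f x⟧ < k * r / 4 -> exists2 y, ⟦y - x⟧ < r & f y = c.
Proof.
move=> k0 r0 fd fk c cf.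
have rr (y : V) : ⟦y - x⟧ <= r / 2 -> ⟦y - x⟧ < r by lra.
have [|y yr|y /= yr ymin] := @EVT_compact_min _ (fun y => ⟦f y - c⟧) _ _ (cball_compact x (r / 2)).
- by exists x; rewrite /= subrr rnorm0; lra.
- apply: (@continuous_rnorm R _ _ (fun y => f y - c)).
  apply: (@differentiable_continuous C V V y (fun y => f y - c)).
  by apply: (@differentiableB _ _ _ f (cst c)); [exact/fd/rr|exact: dif_cst].
have yx : ⟦f y - c⟧ <= ⟦f x - c⟧ by apply: ymin; rewrite /= subrr rnorm0; lra.
have x0 : ⟦x - x⟧ < r by rewrite subrr rnorm0.
have yr2 : ⟦y - x⟧ < r / 2.
  rewrite rdistC in cf; have := fk x y x0 (rr _ yr).
  have := rdistT (f y) c (f x); rewrite (rdistC c).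
  rewrite -(ltr_pM2l k0 ⟦y - x⟧) mulrA; move: cf yx.
  by move: (k * ⟦y - x⟧) (k * r) ⟦f y - f x⟧ ⟦f x - c⟧ ⟦f y - c⟧; clear; move=> *; lra.
exists y; first exact: rr.
apply/eqP; rewrite -subr_eq0; apply: contrapT => /negP fyc.
have w0 : 0 < ⟦f y - c⟧ by rewrite rnorm_gt0.
have yd := fd _ (rr _ yr).
have Au : jac f y \in unitmx.
  have r2 : 0 < r / 2 by rewrite divr_gt0.
  rewrite unitmxE unitfE; apply: (@jac_unit f y k (r / 2) k0 r2 yd) => z zy.
  apply: fk; [exact: rr|apply: (rdist_lt zy yr2)].
  by rewrite -splitr.
(* Newton direction: a step t v reduces f y - c by the factor 1 - t, up to an error that [e] limits
   to half of the gain. *)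
pose v := (c - f y) *m invmx (jac f y).
have vA : 'd f y v = c - f y by rewrite jacE// /v mulmxKV.
have v0 : 0 < ⟦v⟧.
  rewrite rnorm_gt0; apply/eqP => v0; move: vA; rewrite v0 linear0 => /esym/eqP.
  by rewrite -oppr_eq0 opprB; apply/negP.
pose e := ⟦f y - c⟧ / 2 / ⟦v⟧; have e0 : 0 < e by rewrite !divr_gt0.
have /nbhsC[d d0 dP] := diff_rnorm yd e0.
pose m := Num.min (Num.min d (r / 2 - ⟦y - x⟧)) ⟦v⟧.
have m0 : 0 < m by rewrite !lt_min d0 v0 andbT subr_gt0.
have [m1 m2 m3] : [/\ m <= d, m <= r / 2 - ⟦y - x⟧ & m <= ⟦v⟧].
  by rewrite !ge_min !lexx !orbT.
pose t := m / 2 / ⟦v⟧; have t0 : 0 < t by rewrite !divr_gt0.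
have tv : t * ⟦v⟧ = m / 2 by rewrite /t divfK// gt_eqF.
have t1 : t <= 1 by rewrite /t ler_pdivrMr// mul1r; move: m0 m3; move: ⟦v⟧; clear; move=> *; lra.
pose w := (t%:C)%C *: v; have wn : ⟦w⟧ = t * ⟦v⟧ by rewrite rnormZ rnormC ger0_norm// ltW.
have wd : ⟦w - 0⟧ < d by rewrite subr0 wn tv; move: m0 m1; clear; lra.
have := dP w wd; rewrite wn.
have : ⟦f y - c⟧ <= ⟦f (y + w) - c⟧.
  apply: ymin => /=; apply: le_trans (rdistT (y + w) y x) _.
  have -> : y + w - y = w by rewrite addrC addKr.
  by rewrite wn tv; move: m0 m2; move: ⟦y - x⟧; clear; move=> *; lra.
rewrite linearZ_LR /= vA.
have -> : f (y + w) - c = (f (y + w) - f y - (t%:C)%C *: (c - f y)) + ((1 - t)%:C)%C *: (f y - c).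
  rewrite -[c - f y]opprB scalerN opprK -addrA -scalerDl -rmorphD /= addrCA subrr addr0.
  by rewrite rmorph1 scale1r addrA subrK.
have := rnormD (f (y + w) - f y - (t%:C)%C *: (c - f y)) (((1 - t)%:C)%C *: (f y - c)).
rewrite rnormZ rnormC ger0_norm ?subr_ge0//.
have -> : e * (t * ⟦v⟧) = t * ⟦f y - c⟧ / 2 by rewrite /e; field; rewrite gt_eqF.
have : 0 < t * ⟦f y - c⟧ by rewrite mulr_gt0.
rewrite mulrBl mul1r; move: (t * ⟦f y - c⟧) ⟦_⟧ ⟦f y - c⟧ ⟦_ + _⟧; clear; move=> *; lra.
Qed.

Lemma dif_inverse f g y (k : R) : 0 < k -> differentiable f (g y) ->
  \det (jac f (g y)) != 0 -> (\forall z \near y, f (g z) = z) ->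
  (\forall z \near y, k * ⟦g z - g y⟧ <= ⟦z - y⟧) -> differentiable g y.
Proof.
move=> k0 fd d0 fg gk; have Au : jac f (g y) \in unitmx by rewrite unitmxE unitfE.
apply/differentiableC; exists (mulmxr (invmx (jac f (g y)))); split=> [|e e0].
  exact: mulmx_continuous.
have [K K0 KP] := rnorm_mulmx_le (invmx (jac f (g y))).
have e1 : 0 < e * k / K by rewrite divr_gt0 ?mulr_gt0.
have /nbhsC[d1 d10 d1P] := diff_rnorm fd e1.
have /nbhsC[d2 d20 d2P] : \forall z \near y, f (g z) = z /\ k * ⟦g z - g y⟧ <= ⟦z - y⟧.
  exact: filterI fg gk.
have fgy : f (g y) = y by exact: nbhs_singleton fg.
have dd : 0 < Num.min d2 (k * d1) by rewrite lt_min d20 mulr_gt0.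
apply: filterS (near_rnorm 0 dd) => h; rewrite subr0 lt_min => /andP[hd2 hd1].
have yh : y + h - y = h by rewrite addrC addKr.
have [] := d2P (y + h); rewrite yh // => fgh gh.
have := d1P (g (y + h) - g y); rewrite subr0 subrKC fgh fgy jacE// yh => H.
have gn : ⟦g (y + h) - g y⟧ < d1.
  by rewrite -(ltr_pM2l k0); apply: le_lt_trans gh hd1.
have {}H := H gn.
have -> : g (y + h) - g y - mulmxr (invmx (jac f (g y))) h =
   - ((h - (g (y + h) - g y) *m jac f (g y)) *m invmx (jac f (g y))).
  by rewrite mulmxBl mulmxK//= opprB.
rewrite rnormN; apply: le_trans (KP _) _.
rewrite -ler_pdivlMl//; apply: le_trans H _.
have -> : K^-1 * (e * ⟦h⟧) = e / K * ⟦h⟧ by ring.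
have -> : e * k / K * ⟦g (y + h) - g y⟧ = e / K * (k * ⟦g (y + h) - g y⟧) by ring.
by apply: ler_wpM2l => //; rewrite divr_ge0// ltW.
Qed.

End Jacobian.
#[global] Opaque jac.

(** In bases where [A] is the projection onto the first k coordinates, A P + Q takes these from [A]
    and the others from the identity. The vector [b] is the first of the others, so v A' P = 0;
    equality of ranks forces ker A' = ker (A' P). *)
Lemma rank_chart (F : fieldType) n (A : 'M[F]_n) : (\rank A < n)%N ->
  exists P Q : 'M[F]_n, exists b : 'rV[F]_n, [/\ b != 0, A *m P + Q \in unitmx &
    forall (A' : 'M[F]_n) v, (\rank A' <= \rank A)%N -> A' *m P + Q \in unitmx ->
      v *m (A' *m P + Q) = b -> v *m A' = 0].
Proof.
set k := \rank A => kn.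
pose L := col_ebase A; pose E := row_ebase A.
have Lu : L \in unitmx := col_ebase_unit A; have Eu : E \in unitmx := row_ebase_unit A.
pose pid : 'M[F]_n := pid_mx k.
have pid2 : pid *m pid = pid by exact: pid_mx_id (ltnW kn).
have AE : A = L *m pid *m E by rewrite mulmx_ebase.
exists (invmx E *m pid), (L *m copid_mx k), (delta_mx 0 (Ordinal kn)); split.
- by apply/eqP => /rowP/(_ (Ordinal kn))/eqP; rewrite !mxE !eqxx oner_eq0.
- rewrite {1}AE mulmxA (mulmxK Eu) -mulmxA pid2 -mulmxDr.
  by rewrite /copid_mx addrC subrK mulmx1.
move=> A' v rA' u vb.
set X := A' *m (invmx E *m pid).
have vX : v *m X = 0.
  have := congr1 (fun w => w *m pid) vb; rewrite mulmxDr mulmxDl -/X.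
  rewrite -[v *m (L *m _) *m pid]mulmxA -[L *m _ *m pid]mulmxA mul_copid_mx_pid ?(ltnW kn)//.
  rewrite !mulmx0 addr0 -mulmxA /X -!mulmxA pid2 => ->.
  apply/rowP => j; rewrite !mxE (bigD1 (Ordinal kn))//= big1 => [|i ik].
    by rewrite !mxE ltnn andbF mulr0 addr0.
  by rewrite !mxE eqxx (negbTE ik) mul0r.
have rX : (k <= \rank X)%N.
  have := u; rewrite -row_free_unit /row_free => /eqP ru.
  have := mxrank_add X (L *m copid_mx k); rewrite ru.
  have : (\rank (L *m copid_mx k : 'M[F]_n) <= n - k)%N.
    by apply: leq_trans (mxrankM_maxr _ _) _; rewrite rank_copid_mx// ltnW.
  move: (\rank _) (\rank X) => a c; have := kn; clear; lia.
have sub : (kermx A' <= kermx X)%MS.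
  by apply/sub_kermxP; rewrite /X mulmxA mulmx_ker mul0mx.
have : (kermx A' == kermx X)%MS.
  rewrite -(geq_leqif (mxrank_leqif_eq sub)) !mxrank_ker.
  by apply: leq_sub2l; exact: leq_trans rA' rX.
move=> /eqmxP kk; apply/sub_kermxP; rewrite kk; exact/sub_kermxP.
Qed.

Section RankLemma.
Context {R : realType}.
Local Notation C := (Cplx R).

(** Zero derivative implies constancy: the last parameter up to which |F s - F 0| <= e s holds is
    reached and can only be 1. *)
Lemma flat_segment (V : normedModType C) (F : R -> V) :
  (forall t, 0 <= t <= 1 -> forall e : R, 0 < e -> exists2 d : R, 0 < d &
     forall s, 0 <= s <= 1 -> `|s - t| < d -> ⟦F s - F t⟧ <= e * `|s - t|) ->
  F 1 = F 0.
Proof.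
move=> H; apply/eqP; rewrite -subr_eq0 -rnorm_eq0 eq_le rnorm_ge0 andbT.
apply/ler_addgt0Pr => e e0; rewrite add0r.
pose S := [set t : R | 0 <= t <= 1 /\ forall s, 0 <= s <= t -> ⟦F s - F 0⟧ <= e * s].
have S0 : S 0.
  split=> [|s]; first by rewrite lexx ler01.
  by move=> /le_anti <-; rewrite subrr rnorm0 mulr0.
have hS : has_sup S by split; [exists 0|exists 1 => t [/andP[]]].
set tau := sup S.
have t0 : 0 <= tau by exact: sup_upper_bound S0.
have t1 : tau <= 1 by apply: ge_sup => [|t [/andP[]]//]; exists 0.
have [d d0 dP] := H tau ltac:(by rewrite t0 t1) e e0.
have St : S tau.
  split=> [|s /andP[s0]]; first by rewrite t0 t1.
  rewrite le_eqVlt => /predU1P[->|st]; last first.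
    have ts : 0 < tau - s by rewrite subr_gt0.
    have [t [_ tP] ts'] := sup_adherent ts hS.
    by apply: tP; rewrite s0 /= ltW//; rewrite subKr in ts'.
  have [t [/andP[t2 t3] tP] ts'] := sup_adherent d0 hS.
  have tt : t <= tau by apply: sup_upper_bound; [exact: hS|split; [rewrite t2|]].
  have n1 : `|t - tau| = tau - t by rewrite distrC ger0_norm ?subr_ge0.
  have := dP t ltac:(by rewrite t2) ltac:(by rewrite n1 ltrBlDr -ltrBlDl).
  rewrite n1 rdistC => h1; have h2 := tP t ltac:(by rewrite t2 lexx).
  have := rdistT (F tau) (F t) (F 0); move: h1 h2; rewrite mulrBr.
  by move: (e * t) (e * tau) ⟦_⟧ ⟦F t - F 0⟧ ⟦_⟧; clear; move=> *; lra.
have tau1 : tau = 1.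
  apply/eqP; rewrite eq_le t1 leNgt; apply/negP => tau1.
  pose t := Num.min 1 (tau + d / 2).
  have tt : tau < t by rewrite lt_min tau1 ltrDl divr_gt0.
  have [ta tb] : t <= 1 /\ t <= tau + d / 2 by rewrite !ge_min !lexx orbT.
  have : S t.
    split; first by rewrite (le_trans t0 (ltW tt)).
    move=> s /andP[s0 st]; have [stau|stau] := leP s tau.
      by apply: St.2; rewrite s0.
    have n1 : `|s - tau| = s - tau by rewrite ger0_norm ?subr_ge0 ?ltW.
    have := dP s ltac:(by rewrite s0 (le_trans st)) ltac:(rewrite n1; clear -st tb d0; lra).
    rewrite n1 => h1; have h2 := St.2 tau ltac:(by rewrite t0 lexx).
    have := rdistT (F s) (F tau) (F 0); move: h1 h2; rewrite mulrBr.
    by move: (e * s) (e * tau) ⟦_⟧ ⟦F tau - F 0⟧ ⟦_⟧; clear; move=> *; lra.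
  by move=> /(sup_upper_bound hS); rewrite leNgt tt.
by have := St.2 tau ltac:(by rewrite t0 lexx); rewrite tau1 mulr1.
Qed.

Variable n : nat.
Local Notation V := 'rV[C]_n.
Implicit Types (f g : V -> V) (x y v : V).

Lemma mulmx_linear_diff (B : 'M[C]_n) x : differentiable (fun v : V => v *m B) x /\
  'd (fun v : V => v *m B) x = (fun v : V => v *m B) :> (V -> V).
Proof.
have cB : continuous (mulmxr B : V -> V) by exact: mulmx_continuous.
split; first exact: (@linear_differentiable _ _ _ (mulmxr B) x cB).
exact: (@diff_lin _ _ _ (mulmxr B) x cB).
Qed.

Lemma jac_affine f (P Q : 'M[C]_n) x : differentiable f x ->
  let F := fun y => f y *m P + y *m Q in
  differentiable F x /\ jac F x = jac f x *m P + Q.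
Proof.
move=> df F; have [dP PE] := mulmx_linear_diff P (f x).
have [dQ QE] := mulmx_linear_diff Q x.
have dfP := @differentiable_comp _ _ _ _ f (fun v : V => v *m P) x df dP.
have dF : differentiable F x.
  exact: (@differentiableD _ _ _ ((fun v : V => v *m P) \o f) (fun v : V => v *m Q) x dfP dQ).
have e1 v : 'd F x v = 'd ((fun v : V => v *m P) \o f) x v + 'd (fun v : V => v *m Q) x v.
  exact: (congr1 (fun h : V -> V => h v) (diffD dfP dQ)).
have e2 v : 'd ((fun v : V => v *m P) \o f) x v = 'd (fun v : V => v *m P) (f x) ('d f x v).
  exact: (congr1 (fun h : V -> V => h v) (diff_comp df dP)).
have e3 v := congr1 (fun h : V -> V => h v) PE.
have e4 v := congr1 (fun h : V -> V => h v) QE.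
split; first exact: dF.
apply/row_matrixP => i; rewrite !rowE.
apply: (etrans (esym (jacE _ dF))); apply: (etrans (e1 _)).
rewrite mulmxDr mulmxA; congr (_ + _); last exact: e4.
by apply: (etrans (e2 _)); apply: (etrans (e3 _)); congr (_ *m P); exact: jacE.
Qed.

(* On the open set where the rank is maximal, say [k < n], the map [psi] is a chart in which
   [f] only depends on the first [k] coordinates. *)
Lemma exists_jac_unit f x0 (r : R) : 0 < r ->
  (forall y, ⟦y - x0⟧ < r -> differentiable f y) ->
  (forall y z, ⟦y - x0⟧ < r -> ⟦z - x0⟧ < r -> f y = f z -> y = z) ->
  exists2 y, ⟦y - x0⟧ < r & \det (jac f y) != 0.
Proof.
move=> r0 fd fi.
pose Pr k := `[< exists2 y, ⟦y - x0⟧ < r & \rank (jac f y) = k >].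
have exP : exists k, Pr k by exists (\rank (jac f x0)); apply/asboolP; exists x0; rewrite ?subrr ?rnorm0.
have ubP k : Pr k -> (k <= n)%N by move=> /asboolP[y _ <-]; exact: rank_leq_row.
case: (ex_maxnP exP ubP) => k /asboolP[x1 x1r rk] kmax.
have [kn|kn] := leqP n k.
  exists x1 => //; rewrite -unitfE -unitmxE -row_free_unit /row_free rk.
  by rewrite eqn_leq kn -rk rank_leq_row.
exfalso.
rewrite -rk in kn; have [P [Q [b1 [b10 Pu PQ]]]] := rank_chart kn.
pose psi y := f y *m P + y *m Q.
have psid y : ⟦y - x0⟧ < r -> differentiable psi y /\ jac psi y = jac f y *m P + Q.
  by move=> /fd; exact: jac_affine.
clearbody psi.
have npsi : \forall y \near x1, differentiable psi y.
  by apply: filterS (near_ball x1r) => y /psid[].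
have [|ka [r1 [ka0 r10 _ psiL]]] := local_injectivity npsi.
  by rewrite (psid _ x1r).2 -unitfE -unitmxE.
pose rho := Num.min r1 (r - ⟦x1 - x0⟧).
have rho0 : 0 < rho by rewrite lt_min r10 subr_gt0.
have inr y : ⟦y - x1⟧ < rho -> ⟦y - x0⟧ < r.
  rewrite lt_min ltrBrDr => /andP[_]; apply: le_lt_trans; exact: rdistT.
have inr1 y : ⟦y - x1⟧ < rho -> ⟦y - x1⟧ < r1 by rewrite lt_min => /andP[].
have psid' y : ⟦y - x1⟧ < rho -> differentiable psi y by move=> /inr /psid[].
have psiL' y z : ⟦y - x1⟧ < rho -> ⟦z - x1⟧ < rho -> ka * ⟦z - y⟧ <= ⟦psi z - psi y⟧.
  by move=> /inr1 y1 /inr1 z1; exact: psiL.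
have surj := local_surjectivity ka0 rho0 psid' psiL'.
have Ju y : ⟦y - x1⟧ < rho -> jac psi y \in unitmx.
  move=> yr; rewrite unitmxE unitfE; have h : 0 < rho - ⟦y - x1⟧ by rewrite subr_gt0.
  apply: (jac_unit ka0 h (psid' _ yr)) => z zy; apply: psiL' => //.
  by rewrite ltrBrDr in zy; apply: le_lt_trans zy; exact: rdistT.
pose dl := ka * rho / 4; have dl0 : 0 < dl by rewrite divr_gt0// mulr_gt0.
have dlE : dl = ka * rho / 4 by [].
clearbody dl.
have b1p : 0 < ⟦b1⟧ by rewrite rnorm_gt0.
pose sc : C := ((dl / 2 / ⟦b1⟧)%:C)%C; pose b := sc *: b1.
have bn : ⟦b⟧ = dl / 2.
  have sp : 0 < dl / 2 / ⟦b1⟧ by rewrite !divr_gt0.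
  by rewrite rnormZ rnormC ger0_norm ?(ltW sp)// divfK// gt_eqF.
have b0 : b != 0 by rewrite -rnorm_gt0 bn divr_gt0.
(* No rank near [x1] exceeds that at [x1], so [rank_chart] applies at each such point: a velocity
   that the chart maps to [b] is annihilated by the differential of [f]. *)
have ker y v : ⟦y - x1⟧ < rho -> v *m jac psi y = b -> v *m jac f y = 0.
  move=> yr vb; have s0 : sc != 0 by apply: contraNneq b0; rewrite /b => ->; rewrite scale0r.
  suff : (sc^-1 *: v) *m jac f y = 0.
    by rewrite -scalemxAl => /eqP; rewrite scaler_eq0 invr_eq0 (negbTE s0) => /eqP.
  have [_ yJ] := psid _ (inr _ yr).
  apply: (PQ (jac f y) (sc^-1 *: v)).
  - apply: (@leq_trans k); last exact: eq_leq (esym rk).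
    by apply: kmax; apply/asboolP; exists y; [exact: inr|exact: erefl].
  - by rewrite -yJ; exact: Ju.
  - by rewrite -yJ -scalemxAl vb /b scalerA mulVf ?scale1r.
clearbody b.
(* Lift through the chart of the segment from [psi x1] in the direction [b], with an arbitrary value
   for t outside [0, 1]. Constancy of [f] along it contradicts injectivity. *)
have /choice[G GP] : forall t : R, exists y, 0 <= t <= 1 ->
    ⟦y - x1⟧ < rho /\ psi y = psi x1 + (t%:C)%C *: b.
  move=> t; have [t01|] := boolP (0 <= t <= 1); last by exists 0.
  have [|y y1 y2] := surj (psi x1 + (t%:C)%C *: b); last by exists y.
  rewrite addrC addKr rnormZ rnormC bn -dlE; move: t01 => /andP[t0 t1].
  rewrite ger0_norm//; apply: le_lt_trans (_ : dl / 2 < _).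
    by rewrite ler_piMl// divr_ge0// ltW.
  by clear -dl0; lra.
suff fG : f (G 1) = f (G 0).
  have [g1 p1] := GP 1 ltac:(by rewrite ler01 lexx).
  have [g0 p0] := GP 0 ltac:(by rewrite ler01 lexx).
  have := fi _ _ (inr _ g1) (inr _ g0) fG => gg.
  move: p0; rewrite -gg p1 => /addrI/eqP; rewrite scale0r scale1r.
  by apply/negP.
apply: (@flat_segment _ (fun t => f (G t))) => t t01 e e0.
have [gt pt] := GP t t01.
have [K K0 KP] := rnorm_mulmx_le (jac f (G t)).
have [K' K'0 KP'] := rnorm_mulmx_le (invmx (jac psi (G t))).
pose M := ⟦b⟧ / ka; have M0 : 0 < M by rewrite divr_gt0// rnorm_gt0.
have ME : M = ⟦b⟧ / ka by [].
clearbody M.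
(* Half of [e] covers the remainder of [f]. The other half covers that of [psi], magnified by K'
   through the inverse of its differential and by K through the differential of [f]. *)
pose e1 := e / 2 / M; have e10 : 0 < e1 by rewrite !divr_gt0.
pose e2 := e / 2 / M / (K * K'); have e20 : 0 < e2 by rewrite !divr_gt0// mulr_gt0.
have dfG := fd _ (inr _ gt); have dpG := psid' _ gt.
have /nbhsC[d1 d10 d1P] := diff_rnorm dfG e10.
have /nbhsC[d2 d20 d2P] := diff_rnorm dpG e20.
exists (Num.min d1 d2 / M) => [|s s01 st]; first by rewrite divr_gt0// lt_min d10.
have [gs ps] := GP s s01.
set w := G s - G t.
have psw : psi (G s) - psi (G t) = ((s - t)%:C)%C *: b.
  by rewrite ps pt opprD addrACA subrr add0r -scalerBl rmorphB.
have wn : ⟦w⟧ <= M * `|s - t|.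
  have := psiL' _ _ gt gs; rewrite psw rnormZ rnormC -/w => h.
  by rewrite ME mulrAC ler_pdivlMr// mulrC [leRHS]mulrC.
have wd : ⟦w⟧ < Num.min d1 d2.
  by apply: le_lt_trans wn _; rewrite mulrC -ltr_pdivlMr.
move: wd; rewrite lt_min => /andP[wd1 wd2].
have := d1P w; rewrite subr0 => /(_ wd1); rewrite (jacE _ dfG).
have := d2P w; rewrite subr0 => /(_ wd2); rewrite (jacE _ dpG).
have -> : G t + w = G s by rewrite /w subrKC.
rewrite psw => h2 h1; clearbody w.
pose v := w - ((s - t)%:C)%C *: (b *m invmx (jac psi (G t))).
have vE : v = - ((((s - t)%:C)%C *: b - w *m jac psi (G t)) *m invmx (jac psi (G t))).
  by rewrite /v mulmxBl -scalemxAl (mulmxK (Ju _ gt)) opprB.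
have wA : w *m jac f (G t) = v *m jac f (G t).
  have := ker (G t) (b *m invmx (jac psi (G t))) gt (mulmxKV (Ju _ gt) b) => k0.
  by rewrite /v mulmxBl -scalemxAl k0 scaler0 subr0.
have h3 : ⟦w *m jac f (G t)⟧ <= K * (K' * (e2 * ⟦w⟧)).
  rewrite wA; apply: le_trans (KP _) _; apply: ler_wpM2l; first exact: ltW.
  rewrite vE rnormN; apply: le_trans (KP' _) _; apply: ler_wpM2l; first exact: ltW.
  exact: h2.
have h4 : K * (K' * (e2 * ⟦w⟧)) = e / 2 / M * ⟦w⟧.
  by rewrite /e2; move: ⟦w⟧ => x; field; rewrite !lt0r_neq0.
have h5 : e / 2 / M * ⟦w⟧ <= e / 2 * `|s - t|.
  by rewrite -mulrA; apply: ler_wpM2l; [rewrite divr_ge0// ltW|rewrite ler_pdivrMl].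
have := rnorm_dist (f (G s) - f (G t)) (w *m jac f (G t)).
move: h1 h3 h5; rewrite h4 /e1.
have -> : e / 2 * `|s - t| = (e * `|s - t|) / 2 by rewrite mulrAC.
move: (e / 2 / M * ⟦w⟧) (e * `|s - t|) ⟦w *m jac f (G t)⟧ ⟦f (G s) - f (G t)⟧.
by move: ⟦_⟧; clear; move=> *; lra.
Qed.

End RankLemma.

(** * Open mapping and holomorphy of inverses *)

Section OpenMapping.
Context {R : realType}.
Local Notation C := (Cplx R).
Variable n : nat.
Local Notation V := 'rV[C]_n.
Implicit Types (f g : V -> V) (h : V -> C) (x y v c : V).

Lemma closed_setI_ge (T : topologicalType) (W : normedModType C) (X : set T) (F : T -> W) (e : R) :
  closed X -> (forall t, X t -> {for t, continuous F}) -> closed (X `&` [set t | e <= ⟦F t⟧]).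
Proof.
move=> clX Fc c cc; have Xc : X c by apply: clX => B /cc[x [[Xx _] Bx]]; exists x.
split=> //=; rewrite leNgt; apply/negP => Fe.
have d0 : 0 < e - ⟦F c⟧ by rewrite subr_gt0.
have nF : \forall t \near c, ⟦F t⟧ < e.
  have : \forall w \near F c, ⟦w⟧ < e.
    apply: filterS (near_rnorm (F c) d0) => w; have := rnorm_dist w (F c).
    by move: ⟦w⟧ ⟦_⟧ ⟦F c⟧; clear; move=> *; lra.
  exact: Fc Xc _.
by have [x [[_ /= eF]]] := cc _ nF; rewrite ltNge eF.
Qed.

Lemma cont_subr (T : topologicalType) (W : normedModType C) (F : T -> W) (a : W) (t : T) :
  {for t, continuous F} -> {for t, continuous (fun s => F s - a)}.
Proof.
move=> Fc; apply: (@continuous_comp _ _ _ F (fun w => w - a)); first exact: Fc.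
exact: subr_continuous.
Qed.

Lemma cball_closed x (r : R) : closed [set y : V | ⟦y - x⟧ <= r].
Proof. by apply: closed_rnorm_le; exact: subr_continuous. Qed.

(** The marker [h] is the Jacobian determinant at the preimage. Where it is nonzero the inverse
    function theorem applies; elsewhere it tends to 0. Since its zeros contain no ball near [f x0],
    the image is dense there, and being compact it contains a ball. *)
Lemma inverse_marker f x0 (r : R) : 0 < r ->
  (forall y, ⟦y - x0⟧ < r -> differentiable f y) ->
  (forall y z, ⟦y - x0⟧ < r -> ⟦z - x0⟧ < r -> f y = f z -> y = z) ->
  exists (g : V -> V) (h : V -> C) (d B : R), [/\ 0 < d,
    forall c, ⟦c - f x0⟧ < d -> ⟦g c - x0⟧ < r /\ f (g c) = c,
    forall c, ⟦c - f x0⟧ < d -> ⟦h c⟧ <= B,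
    forall c, ⟦c - f x0⟧ < d ->
      (\forall z \near c, differentiable g z /\ differentiable h z) \/
      (forall e : R, 0 < e -> \forall z \near c, ⟦h z⟧ <= e) &
    forall e : R, 0 < e -> exists2 c, ⟦c - f x0⟧ < e & h c != 0].
Proof.
move=> r0 fd fi.
have s0 : 0 < r / 2 by rewrite divr_gt0.
have x00 : ⟦x0 - x0⟧ < r by rewrite subrr rnorm0.
have sr : r / 2 < r by rewrite ltr_pdivrMr// ltr_pMr// ltr1n.
pose X := [set y : V | ⟦y - x0⟧ <= r / 2].
have Xr y : X y -> ⟦y - x0⟧ < r by move=> Xy; apply: le_lt_trans sr.
have cX : compact X by exact: cball_compact.
have clX : closed X by exact: cball_closed.
have fc y : X y -> {for y, continuous f} by move=> /Xr /fd; exact: differentiable_continuous.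
have nfd y : ⟦y - x0⟧ < r -> \forall z \near y, differentiable f z.
  by move=> /near_ball; apply: filterS => z; exact: fd.
pose J y := \det (jac f y).
have Jc y : X y -> {for y, continuous J}.
  by move=> /Xr /nfd /dif_jacobian /differentiable_continuous.
pose S := X `&` [set y | r / 2 <= ⟦y - x0⟧].
have cS : compact S.
  by apply: compact_closedI => //; apply: closed_rnorm_ge; exact: subr_continuous.
(* A lower bound for the distance from [f x0] to the image of the sphere: closer values have all
   their preimages inside it. *)
have [d0 d00 d0P] : exists2 d0 : R, 0 < d0 & forall y, S y -> d0 <= ⟦f y - f x0⟧.
  have [S0|S0] := pselect (S !=set0); last first.
    by exists 1 => // y Sy; case: S0; exists y.
  have [y [/fc fy _]|y Sy ymin] := @EVT_compact_min _ _ (fun y => ⟦f y - f x0⟧) S S0 cS.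
    by apply: continuous_rnorm; exact: cont_subr fy.
  exists ⟦f y - f x0⟧; last exact: ymin.
  rewrite rnorm_gt0 subr_eq0; apply/eqP => /(fi _ _ (Xr _ Sy.1) x00) yx.
  by case: Sy => _ /=; rewrite yx subrr rnorm0 leNgt s0.
have inS y c : X y -> f y = c -> ⟦c - f x0⟧ < d0 -> ⟦y - x0⟧ < r / 2.
  move=> Xy fy cd; rewrite ltNge; apply/negP => ys.
  by have := d0P _ (conj Xy ys); rewrite fy leNgt cd.
pose g c := xget x0 [set y | X y /\ f y = c].
have gE y : X y -> g (f y) = y.
  move=> Xy; rewrite /g; case: xgetP => [z _ [Xz fz]|/(_ y)]; last by case.
  exact: fi (Xr _ Xz) (Xr _ Xy) fz.
(* Points off the image count as exceptional until they are shown to be absent near [f x0]. *)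
pose h c := if pselect ((f @` X) c) then J (g c) else 0.
have hE y : X y -> h (f y) = J y.
  move=> Xy; rewrite /h; case: pselect => [fX|nfX] /=; first by rewrite (gE _ Xy).
  by exfalso; apply: nfX; exists y.
have h0 c : h c != 0 -> exists2 y, X y & f y = c /\ J y != 0.
  rewrite /h; case: pselect => [fX|nfX] /=; last by rewrite eqxx.
  by case: fX => y Xy fy; rewrite -fy gE// => Jy; exists y.
clearbody h g.
have loc c : ⟦c - f x0⟧ < d0 -> h c != 0 ->
    differentiable g c /\ \forall z \near c, exists2 y, X y & f y = z.
  move=> cd /h0[y Xy [fy Jy]].
  have ys := inS _ _ Xy fy cd.
  have [ka [r1 [ka0 r10 f1 fL]]] := local_injectivity (nfd _ (Xr _ Xy)) Jy.
  pose rho := Num.min r1 (r / 2 - ⟦y - x0⟧).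
  have rho0 : 0 < rho by rewrite lt_min r10 subr_gt0.
  have rhoX z : ⟦z - y⟧ < rho -> X z.
    by rewrite lt_min ltrBrDr => /andP[_] /ltW; apply: le_trans; exact: rdistT.
  have rho1 z : ⟦z - y⟧ < rho -> ⟦z - y⟧ < r1 by rewrite lt_min => /andP[].
  have f1' z : ⟦z - y⟧ < rho -> differentiable f z by move=> /rho1; exact: f1.
  have fL' z w : ⟦z - y⟧ < rho -> ⟦w - y⟧ < rho -> ka * ⟦w - z⟧ <= ⟦f w - f z⟧.
    by move=> /rho1 ? /rho1; exact: fL.
  have dl : 0 < ka * rho / 4 by rewrite divr_gt0// mulr_gt0.
  have near_c : \forall z \near c, exists2 w, ⟦w - y⟧ < rho & f w = z.
    apply: filterS (near_rnorm c dl) => z; rewrite -fy.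
    exact: local_surjectivity ka0 rho0 f1' fL' z.
  have gc : g c = y by rewrite -fy gE.
  split; last by apply: filterS near_c => z [w /rhoX Xw fw]; exists w.
  apply: (@dif_inverse _ _ f g c ka ka0); rewrite ?gc.
  - exact: fd (Xr _ Xy).
  - exact: Jy.
  - by apply: filterS near_c => z [w /rhoX Xw <-]; rewrite gE.
  - apply: filterS near_c => z [w wr <-]; rewrite (gE _ (rhoX _ wr)) -fy.
    by apply: fL'; [rewrite subrr rnorm0|exact: wr].
have hd c : ⟦c - f x0⟧ < d0 -> h c != 0 -> differentiable h c.
  move=> cd hc; have [dg nX] := loc c cd hc; have [y Xy [fy Jy]] := h0 c hc.
  have gc : g c = y by rewrite -fy gE.
  apply: (@near_eq_dif _ _ _ (fun c => J (g c))).
    by apply: filterS nX => z [w Xw <-]; rewrite (hE _ Xw) (gE _ Xw).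
  apply: (@differentiable_comp _ _ _ _ g J); first exact: dg.
  by rewrite gc; apply: dif_jacobian; exact: nfd (Xr _ Xy).
have near1 c : ⟦c - f x0⟧ < d0 -> h c != 0 ->
    \forall z \near c, differentiable g z /\ differentiable h z.
  move=> cd hc; have /continuousC hcont := differentiable_continuous (hd c cd hc).
  have hp : 0 < ⟦h c⟧ by rewrite rnorm_gt0.
  apply: filterS2 (hcont _ hp) (near_ball cd) => z hz zd.
  have hz0 : h z != 0.
    by apply: contraTneq hz => ->; rewrite sub0r rnormN ltxx.
  by split; [exact: (loc z zd hz0).1|exact: hd].
(* The points with |J| >= e have a compact image, which misses [c]. *)
have near2 c : h c = 0 -> forall e : R, 0 < e -> \forall z \near c, ⟦h z⟧ <= e.
  move=> hc e e0; pose Xe := X `&` [set y | e <= ⟦J y⟧].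
  have cXe : compact Xe.
    by apply: subclosed_compact (closed_setI_ge clX Jc) cX _ => y [].
  have clf : closed (f @` Xe) by apply: compact_image_closed cXe _ => y [/fc].
  have nc : \forall z \near c, ~ (f @` Xe) z.
    apply: open_nbhs_nbhs; split; first by rewrite openC.
    move=> [y [Xy /=]] + fy; rewrite -(hE y Xy) fy hc rnorm0.
    by rewrite leNgt e0.
  apply: filterS nc => z nz; rewrite leNgt; apply/negP => ez; apply: nz.
  have [|y Xy [fy Jy]] := h0 z; first by rewrite -rnorm_gt0; exact: lt_trans ez.
  by exists y => //; split=> //=; rewrite -(hE y Xy) fy ltW.
have near12 c : ⟦c - f x0⟧ < d0 ->
    (\forall z \near c, differentiable g z /\ differentiable h z) \/
    (forall e : R, 0 < e -> \forall z \near c, ⟦h z⟧ <= e).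
  move=> cd; have [hc|hc] := eqVneq (h c) 0; first by right; exact: near2.
  by left; exact: near1.
have [B BP] : exists B : R, forall c, ⟦h c⟧ <= B.
  have X0 : X !=set0 by exists x0; rewrite /X /= subrr rnorm0 ltW.
  have [y /Jc|y Xy ymax] := @EVT_compact _ _ (fun y => ⟦J y⟧) X X0 cX.
    exact: continuous_rnorm.
  exists ⟦J y⟧ => c; have [->|/h0[z Xz [<- _]]] := eqVneq (h c) 0.
    by rewrite rnorm0 rnorm_ge0.
  by rewrite (hE _ Xz); exact: ymax.
have dense0 (e : R) : 0 < e -> exists2 c, ⟦c - f x0⟧ < e & h c != 0.
  have Xx0 : X x0 by rewrite /X /= subrr rnorm0 ltW.
  move=> e0; have /continuousC/(_ e e0)/nbhsC[d d_gt0 dP] := fc x0 Xx0.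
  have rho0 : 0 < Num.min d (r / 2) by rewrite lt_min d_gt0.
  have [|y|y yr Jy] := @exists_jac_unit _ _ f x0 _ rho0.
  - by move=> y; rewrite lt_min => /andP[_ yr]; apply: fd; exact: lt_trans sr.
  - move=> z; rewrite !lt_min => /andP[_ yr] /andP[_ zr].
    by apply: fi; [exact: lt_trans sr|exact: lt_trans sr].
  - move: yr; rewrite lt_min => /andP[yd yr]; exists (f y); first exact: dP.
    by rewrite hE; [exact: Jy|exact: ltW].
(* For [c] and [c1] within d1 of [f x0], the disc about [c1] through [c] stays within 3 d1 < d0. *)
pose d1 := d0 / 4; have d10 : 0 < d1 by rewrite divr_gt0.
have dense c : ⟦c - f x0⟧ < d1 -> forall e : R, 0 < e -> exists2 c', ⟦c' - c⟧ < e & h c' != 0.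
  move=> cd e e0; apply: contrapT => H.
  have hz z : ⟦z - c⟧ < e -> h z = 0.
    by move=> ze; apply/eqP; apply: contrapT => hz; apply: H; exists z => //; exact/negP.
  have [c1 c1d hc1] := dense0 d1 d10.
  move/eqP: hc1; apply.
  pose phi (t : C) := h (c1 + t *: (c - c1)).
  have inb (t : C) : ⟦t⟧ <= 1 -> ⟦c1 + t *: (c - c1) - f x0⟧ < d0.
    move=> t1; rewrite addrAC; apply: le_lt_trans (rnormD _ _) _.
    have tc : ⟦t *: (c - c1)⟧ <= ⟦c - f x0⟧ + ⟦c1 - f x0⟧.
      rewrite rnormZ (rdistC c1); apply: le_trans (rdistT c (f x0) c1).
      by rewrite ler_piMl// rnorm_ge0.
    move: tc cd c1d; rewrite /d1; move: ⟦t *: _⟧ ⟦c - f x0⟧ ⟦c1 - f x0⟧.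
    by clear -d00; move=> *; lra.
  suff : phi 0 = 0 by rewrite /phi scale0r addr0.
  apply: (@arc_vanish _ phi 0 1 B 1).
  - move=> t; rewrite subr0 => /ltW/inb/near12[n1|n2]; [left|right].
      apply: filterS (@near_slice _ _ (fun x => differentiable g x /\ differentiable h x) _ _ _ n1).
      by move=> z [_]; exact: dif_slice.
    by move=> e' /n2; exact: (@near_slice _ _ (fun x => ⟦h x⟧ <= e')).
  - by move=> t _; exact: BP.
  - by rewrite subr0 rnorm1.
  - apply: (@near_slice _ _ (fun x => h x = 0)); rewrite scale1r subrKC.
    by apply: filterS (near_rnorm c e0) => z; exact: hz.
have clfX : closed (f @` X) by exact: compact_image_closed.
have surj c : ⟦c - f x0⟧ < d1 -> (f @` X) c.
  move=> cd; apply: clfX => A /nbhsC[e e0 eA].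
  have [c' c'e /h0[y Xy [fy _]]] := dense c cd e e0.
  by exists c'; split; [exists y|exact: eA].
have d1d0 c : ⟦c - f x0⟧ < d1 -> ⟦c - f x0⟧ < d0.
  move=> cd; apply: lt_trans cd _; rewrite /d1; clear -d00; lra.
exists g, h, d1, B; split=> //.
- by move=> c /surj[y Xy <-]; rewrite (gE _ Xy); split; [exact: Xr|].
- by move=> c /d1d0; exact: near12.
Qed.

Lemma open_mapping f x0 (r : R) : 0 < r ->
  (forall y, ⟦y - x0⟧ < r -> differentiable f y) ->
  (forall y z, ⟦y - x0⟧ < r -> ⟦z - x0⟧ < r -> f y = f z -> y = z) ->
  \forall c \near f x0, exists2 y, ⟦y - x0⟧ < r & f y = c.
Proof.
move=> r0 fd fi; have [g [h [d [B [d0 gP _ _ _]]]]] := inverse_marker r0 fd fi.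
by apply: filterS (near_rnorm (f x0) d0) => c /gP[gr fg]; exists (g c).
Qed.

Lemma inverse_continuous f g x0 (r : R) : 0 < r ->
  (forall y, ⟦y - x0⟧ < r -> differentiable f y) ->
  (forall y, ⟦y - x0⟧ < r -> g (f y) = y) -> {for f x0, continuous g}.
Proof.
move=> r0 fd gf; apply/continuousC => e e0.
have m0 : 0 < Num.min e r by rewrite lt_min e0.
have [mr me] : (forall y, ⟦y - x0⟧ < Num.min e r -> ⟦y - x0⟧ < r) /\
    (forall y, ⟦y - x0⟧ < Num.min e r -> ⟦y - x0⟧ < e).
  by split=> y; rewrite lt_min => /andP[].
have op : \forall c \near f x0, exists2 y, ⟦y - x0⟧ < Num.min e r & f y = c.
  apply: open_mapping => // [y /mr|y z /mr yr /mr zr fyz]; first exact: fd.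
  by rewrite -(gf _ yr) fyz gf.
apply: filterS op => c [y ye <-]; rewrite (gf _ (mr _ ye)) gf ?subrr ?rnorm0//.
exact: me.
Qed.

(** The inverse is continuous by the open mapping property and differentiable off the zeros of the
    marker, which are removable coordinate by coordinate. *)
Lemma inverse_differentiable f g x0 (r : R) : 0 < r ->
  (forall y, ⟦y - x0⟧ < r -> differentiable f y) ->
  (forall y, ⟦y - x0⟧ < r -> g (f y) = y) -> differentiable g (f x0).
Proof.
move=> r0 fd gf.
have fi y z : ⟦y - x0⟧ < r -> ⟦z - x0⟧ < r -> f y = f z -> y = z.
  by move=> yr zr fyz; rewrite -(gf _ yr) fyz gf.
have [g1 [h [d [B [d0 g1P hB gh dense]]]]] := inverse_marker r0 fd fi.
have gE c : ⟦c - f x0⟧ < d -> g1 c = g c.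
  by move=> /g1P[g1r fg1]; rewrite -[in RHS]fg1 gf.
have gn c : ⟦c - f x0⟧ < d -> \forall z \near c, g1 z = g z.
  by move=> /near_ball; apply: filterS => z; exact: gE.
apply: dif_row => i; apply: (@removable _ _ (fun c => g c 0 i) h (f x0) d (⟦x0⟧ + r) B d0).
- move=> c cd; apply: le_trans (rnorm_coord _ _) _; rewrite -(gE _ cd).
  have [g1r _] := g1P _ cd; apply: le_trans (rnorm_dist _ x0) _.
  by rewrite lerD2l ltW.
- exact: hB.
- move=> c cd; apply: (@continuous_comp _ _ _ g (fun v : V => v 0 i)); last exact: coord_continuous.
  have [g1r <-] := g1P _ cd; have s0 : 0 < r - ⟦g1 c - x0⟧ by rewrite subr_gt0.
  have inr y : ⟦y - g1 c⟧ < r - ⟦g1 c - x0⟧ -> ⟦y - x0⟧ < r.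
    by rewrite ltrBrDr; apply: le_lt_trans; exact: rdistT.
  by apply: (inverse_continuous s0) => y /inr; [exact: fd|exact: gf].
- move=> c cd; case: (gh c cd) => nh; [left|by right].
  apply: filterS2 nh (near_ball cd) => z [dg dh] zd; split; last exact: dh.
  by apply: dif_coord; apply: near_eq_dif (gn z zd) dg.
- exact: dense.
Qed.

End OpenMapping.

(** * Hartogs extension *)

Section DiscreteMean.
Context {R : realType}.
Local Notation C := (Cplx R).
Implicit Types (u v chi phi : C -> C) (c x y z w p : C).

Definition root_net (w : C) (N : nat) (e : R) :=
  [/\ (0 < N)%N, w ^+ N = 1, ⟦w⟧ = 1 &
    forall z, ⟦z⟧ = 1 -> exists2 k, (k < N)%N & ⟦w ^+ k - z⟧ <= e].

(** Roots of unity are produced by repeated square roots of -1. If w = w'^2, the product of |w'^k -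
    z|^2 and |w'^k + z|^2 is the old squared distance and their sum is 4, so the smaller one is at
    most half of it. *)
Lemma root_net_exists (e : R) : 0 < e -> exists w N, root_net w N e.
Proof.
move=> e0.
(* The invariant w^N = -1 makes -w^k a power of [w] too, as needed to choose the better sign. *)
suff main j : exists (w : C) N, [/\ (0 < N)%N, w ^+ N = -1, ⟦w⟧ = 1 &
    forall z, ⟦z⟧ = 1 -> exists2 k, (k < N + N)%N & ⟦w ^+ k - z⟧ ^+ 2 <= 2 / 2 ^+ j].
  have [|j je] := @exists_half_pow R 2 (e ^+ 2); first by rewrite exprn_gt0.
  have [w [N [N0 wN w1 wz]]] := main j.
  exists w, (N + N)%N; split => //; first by rewrite addn_gt0 N0.
    by rewrite exprD wN mulrNN mulr1.
  move=> z /wz[k kN wk]; exists k => //.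
  rewrite -(@ler_pXn2r _ 2) ?nnegrE ?rnorm_ge0 ?ltW//.
  exact: le_lt_trans wk je.
elim: j => [|j [w [N [N0 wN w1 wz]]]].
  exists (-1), 1%N; split=> //; first by rewrite rnormN rnorm1.
  move=> z z1; have := rnorm_parallelogram 1 z; rewrite z1 rnorm1 expr1n.
  have [h|h] := leP (⟦1 - z⟧ ^+ 2) 2 => H.
    by exists 0%N => //; rewrite !expr0 divr1.
  by exists 1%N => //; rewrite expr0 divr1 expr1 -opprD rnormN; lra.
pose w' : C := sqrtC w; have w'2 : w' ^+ 2 = w by exact: sqrtCK.
have w'1 : ⟦w'⟧ = 1.
  by apply/eqP; rewrite -(@eqrXn2 _ 2) ?rnorm_ge0// -rnormX w'2 w1 expr1n.
exists w', (N + N)%N; split=> //; first by rewrite addn_gt0 N0.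
  by rewrite addnn -mul2n exprM w'2 wN.
move=> z z1; have z2 : ⟦z ^+ 2⟧ = 1 by rewrite rnormX z1 expr1n.
have [k kN wk] := wz _ z2.
have E : w ^+ k - z ^+ 2 = (w' ^+ k - z) * (w' ^+ k + z).
  by rewrite -w'2 -exprM mulnC exprM subr_sqr.
have P := rnorm_parallelogram (w' ^+ k) z.
rewrite !rnormX w'1 z1 !expr1n in P.
move: wk; rewrite E rnormM exprMn [2 ^+ j.+1]exprS invfM.
set A := ⟦w' ^+ k - z⟧ ^+ 2 in P *; set B := ⟦w' ^+ k + z⟧ ^+ 2 in P *.
have A0 : 0 <= A by rewrite exprn_ge0 ?rnorm_ge0.
have B0 : 0 <= B by rewrite exprn_ge0 ?rnorm_ge0.
have q0 : 0 <= (2 ^+ j)^-1 :> R by rewrite invr_ge0 exprn_ge0.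
move: q0; move: ((2 ^+ j)^-1) => q q0 AB.
have [AB'|AB'] := leP A B.
  exists k; first by rewrite (leq_trans kN)// leq_addr.
  have : A * 2 <= A * B by apply: ler_wpM2l => //; lra.
  by rewrite -/A; lra.
have wNN : w' ^+ (N + N) = -1 by rewrite addnn -mul2n exprM w'2 wN.
exists (k + (N + N))%N; first by rewrite ltn_add2r.
rewrite exprD wNN mulrN1 -opprD rnormN -/B.
have : B * 2 <= A * B by rewrite [A * B]mulrC; apply: ler_wpM2l => //; lra.
lra.
Qed.

Lemma sum_rot (w : C) N (v : C -> C) : (0 < N)%N -> w ^+ N = 1 -> forall z k,
  \sum_(i < N) v (w ^+ i * (w ^+ k * z)) = \sum_(i < N) v (w ^+ i * z).
Proof.
move=> N0 wN z; elim=> [|k IH]; first by rewrite expr0 mul1r.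
rewrite -IH; case: N N0 wN {IH} => [//|N] _ wN.
rewrite big_ord_recr [RHS]big_ord_recl /= addrC; congr (_ + _).
  by rewrite expr0 mul1r exprS mulrA mulrA -exprSr wN mul1r.
by apply: eq_bigr => i _; rewrite (exprS w k) /bump /= add1n exprSr !mulrA.
Qed.

(* The average of [v] over equidistributed rotates is almost constant on the circle, so the
   maximum principle compares it with its value [v 0] at the centre. *)
Lemma mean_estimate v chi (rho rho' L eta e B : R) w N : 0 < rho -> rho < rho' -> 0 <= L ->
  root_net w N e -> e * rho < eta -> chi 0 != 0 ->
  (forall x, ⟦x⟧ < rho' -> ⟦chi x⟧ <= B) ->
  (forall x, ⟦x⟧ < rho' -> [/\ exists M, \forall y \near x, ⟦v y⟧ <= M &
     (\forall y \near x, differentiable v y /\ differentiable chi y) \/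
     forall e : R, 0 < e -> \forall y \near x, ⟦chi y⟧ <= e]) ->
  (forall x, ⟦x⟧ = rho -> {for x, continuous v}) ->
  (forall x y, ⟦x⟧ = rho -> ⟦y⟧ = rho -> ⟦y - x⟧ < eta -> ⟦v y - v x⟧ <= L * ⟦y - x⟧) ->
  ⟦\sum_(i < N) v (w ^+ i * (rho%:C)%C) - v 0 *+ N⟧ <= N%:R * (L * (e * rho)).
Proof.
move=> rho0 rr L0 [N0 wN w1 wz] er chi0 chiB vH vc vL.
have rw k x : ⟦w ^+ k * x⟧ = ⟦x⟧ by rewrite rnormM rnormX w1 expr1n mul1r.
pose S x := \sum_(i < N) v (w ^+ i * x); pose T x := \prod_(i < N) chi (w ^+ i * x).
have e0 : 0 <= e by have [k _] := wz 1 rnorm1; apply: le_trans; exact: rnorm_ge0.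
pose m := N%:R * (L * (e * rho)).
have m0 : 0 <= m by rewrite !mulr_ge0// ltW.
have rn : ⟦(rho%:C)%C : C⟧ = rho by rewrite rnormC ger0_norm// ltW.
(* Rotating by a power of [w] leaves [S] unchanged, and some power brings the base point within e
   rho of [x]. *)
have circ x : ⟦x⟧ = rho -> ⟦S x - S (rho%:C)%C⟧ <= m.
  move=> xr; have rc0 : (rho%:C)%C != 0 :> C by rewrite -rnorm_gt0 rn.
  have [|k kN wk] := wz (x / (rho%:C)%C); first by rewrite rnormM rnormV rn xr divff// gt_eqF.
  have xk : ⟦w ^+ k * (rho%:C)%C - x⟧ <= e * rho.
    have -> : w ^+ k * (rho%:C)%C - x = (w ^+ k - x / (rho%:C)%C) * (rho%:C)%C by field.
    by rewrite rnormM rn ler_pM2r.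
  rewrite /S -(sum_rot v N0 wN (rho%:C)%C k) -sumrB.
  apply: le_trans (rnorm_sum _ _ _) _.
  apply: le_trans (_ : \sum_(i < N) L * (e * rho) <= _); last first.
    by rewrite sumr_const card_ord -mulr_natl.
  apply: ler_sum => i _; rewrite rdistC.
  have h : ⟦w ^+ i * (w ^+ k * (rho%:C)%C) - w ^+ i * x⟧ <= e * rho by rewrite -mulrBr rw.
  apply: le_trans (vL _ _ _ _ (le_lt_trans h er)) _; rewrite ?rw//.
  exact: ler_wpM2l.
have S0 : S 0 = v 0 *+ N.
  by rewrite /S; under eq_bigr do rewrite mulr0; rewrite sumr_const card_ord.
have T0 : T 0 != 0.
  by rewrite /T; under eq_bigr do rewrite mulr0; rewrite prodr_const expf_neq0.
rewrite -S0 rdistC -/(S _) -/m.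
have rotn (P : C -> Prop) k x : (\forall y \near (w ^+ k * x), P y) ->
    \forall y \near x, P (w ^+ k * y).
  have := @near_affine R P 0 0 (w ^+ k) x; rewrite add0r subr0 => H /H.
  by apply: filterS => y; rewrite add0r subr0.
have rotd (f : C -> C) k x : differentiable f (w ^+ k * x) ->
    differentiable (fun y => f (w ^+ k * y)) x.
  move=> df; apply: (@differentiable_comp _ _ _ _ (fun y => w ^+ k * y) f _ _ df).
  by apply: dif_mul; [exact: dif_cst|exact: dif_id].
have rr0 x : ⟦x - 0⟧ <= rho -> ⟦x⟧ < rho' by rewrite subr0 => /le_lt_trans; apply.
pose B' := Num.max B 1.
have B1 : 1 <= B' by rewrite le_max lexx orbT.
have chiB' x : ⟦x⟧ < rho' -> ⟦chi x⟧ <= B' by move=> h; rewrite le_max chiB.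
have Sn x : ⟦x⟧ < rho' -> (\forall y \near x, forall i : 'I_N, ⟦w ^+ i * y⟧ < rho').
  move=> xr; have : 0 < rho' - ⟦x⟧ by rewrite subr_gt0.
  move=> /near_rnorm n; apply: filterS (n _ x) => y yx i; rewrite rw.
  by have := rnorm_dist y x; lra.
apply: (max_principle_marker (u := fun x => S x - S (rho%:C)%C) (chi := T)
  (disc_compact 0 rho) m0 (B := B' ^+ size (index_enum 'I_N))) => [x /= xr|x /= xr||].
- by apply: rnorm_prod_le => // i _; apply: chiB'; rewrite rw; exact: rr0.
- move: xr; rewrite le_eqVlt subr0 => /predU1P[xr|xr].
    apply: Or33 => d d0; have N0' : 0 < N%:R :> R by rewrite ltr0n.
    have cv (i : 'I_N) : \forall y \near x, ⟦v (w ^+ i * y) - v (w ^+ i * x)⟧ < d / N%:R.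
      apply: (rotn (fun z => ⟦v z - v (w ^+ i * x)⟧ < d / N%:R)).
      have /vc/continuousC : ⟦w ^+ i * x⟧ = rho by rewrite rw.
      by apply; rewrite divr_gt0.
    have cvA : \forall y \near x, forall i : 'I_N, ⟦v (w ^+ i * y) - v (w ^+ i * x)⟧ < d / N%:R.
      exact: (@filter_forall C _ (fun (i : 'I_N) y => ⟦v (w ^+ i * y) - v (w ^+ i * x)⟧ < d / N%:R) (nbhs x) _ cv).
    apply: filterS cvA => y yd _.
    have h : ⟦S y - S x⟧ <= d.
      rewrite /S -sumrB; apply: le_trans (rnorm_sum _ _ _) _.
      apply: le_trans (_ : \sum_(i < N) d / N%:R <= _).
        by apply: ler_sum => i _; exact/ltW/yd.
      by rewrite sumr_const card_ord -[(d / _) *+ N]mulr_natr divfK// gt_eqF.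
    have := rdistT (S y) (S x) (S (rho%:C)%C); have := circ _ xr; lra.
  have xr' : ⟦x⟧ < rho' by rewrite (lt_trans xr).
  have [[i hi]|nA] := pselect (exists i : 'I_N, forall d : R, 0 < d ->
      \forall y \near (w ^+ i * x), ⟦chi y⟧ <= d).
    apply: Or32; split.
      have /choice[Mf HM] : forall j : 'I_N, exists M, \forall y \near x, ⟦v (w ^+ j * y)⟧ <= M.
        move=> j; have [|[M nM] _] := vH (w ^+ j * x); first by rewrite rw.
        by exists M; exact: (rotn (fun z => ⟦v z⟧ <= M)).
      exists (\sum_j Mf j + ⟦S (rho%:C)%C⟧); have HMA : \forall y \near x, forall j : 'I_N, ⟦v (w ^+ j * y)⟧ <= Mf j by exact: (@filter_forall C _ (fun (j : 'I_N) y => ⟦v (w ^+ j * y)⟧ <= Mf j) (nbhs x) _ HM).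
      apply: filterS HMA => y yM _.
      apply: le_trans (rnormB _ _) _; rewrite lerD2r; apply: le_trans (rnorm_sum _ _ _) _.
      by apply: ler_sum => j _; exact: yM.
    move=> d d0; have Mp : 0 < B' ^+ size (index_enum 'I_N) by rewrite exprn_gt0//; lra.
    have /hi/(rotn (fun z => ⟦chi z⟧ <= _)) : 0 < d / B' ^+ size (index_enum 'I_N) by rewrite divr_gt0.
    move=> h2; apply: filterS2 (Sn _ xr') h2 => y yn hy _; rewrite -(divfK (lt0r_neq0 Mp) d).
    by apply: rnorm_prod_small hy => // j _; exact/chiB'/yn.
  have vd i : \forall y \near x, differentiable v (w ^+ (i : 'I_N) * y) /\ differentiable chi (w ^+ i * y).
    have [|_ [n|n]] := vH (w ^+ i * x); first by rewrite rw.
      exact: (rotn (fun z => differentiable v z /\ differentiable chi z)).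
    by exfalso; apply: nA; exists i.
  have nT : \forall y \near x, differentiable T y.
    by apply: near_dif_prod => i _; apply: filterS (vd i) => y [_]; exact: rotd.
  have vdA : \forall y \near x, forall i : 'I_N, differentiable v (w ^+ i * y) /\ differentiable chi (w ^+ i * y).
    exact: (@filter_forall C _ (fun (i : 'I_N) y => differentiable v (w ^+ i * y) /\ differentiable chi (w ^+ i * y)) (nbhs x) _ vd).
  have : 0 < rho - ⟦x⟧ by rewrite subr_gt0.
  move=> /near_rnorm nr; apply: Or31; apply: filterS3 (nr _ x) vdA nT => y yx dv dT.
  split; last exact: dT.
    by rewrite subr0; have := rnorm_dist y x; lra.
  apply: dif_sub; last exact: dif_cst.
  by apply: dif_sum => i; apply: rotd; exact: (dv i).1.
- by rewrite /= subrr rnorm0 ltW.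
- exact: T0.
Qed.
End DiscreteMean.

(** * Barycentric quotients in place of the Cauchy integral *)

Section Barycentric.
Context {R : realType}.
Local Notation C := (Cplx R).
Implicit Types (phi : C -> C) (x y z w : C).

(** The map x -> 1/(1 - x) sends the unit disc to the half-plane Re > 1/2. *)
Lemma Re_inv_half x : ⟦x⟧ < 1 -> 2^-1 <= complex.Re ((1 - x)^-1).
Proof.
move=> x1; have x0 : 1 - x != 0.
  by rewrite subr_eq0 eq_sym; apply: contraTneq x1 => ->; rewrite rnorm1 ltxx.
have : ⟦1 - x⟧ ^+ 2 <= 2 * (1 - complex.Re x).
  have := rnorm_sqr (1 - x); have := rnorm_sqr x.
  have : ⟦x⟧ ^+ 2 <= 1 by rewrite expr_le1// ?rnorm_ge0// ltW.
  by case: x {x1 x0} => a b; rewrite /= => h1 h2 h3; rewrite h3; nra.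
have n0 : 0 < ⟦1 - x⟧ ^+ 2 by rewrite exprn_gt0// rnorm_gt0.
move=> h; suff -> : complex.Re ((1 - x)^-1) = (1 - complex.Re x) / ⟦1 - x⟧ ^+ 2.
  by rewrite ler_pdivlMr// mulrC ler_pdivrMr// mulrC.
rewrite rnorm_sqr; by case: x {x1 x0 h n0} => a b.
Qed.

(** The mean of zeta/(zeta - x) over the circle is 1; for the discrete sum it is enough that every
    term has real part at least 1/2, so that division by it is safe. *)
Lemma bary_weight (zeta : nat -> C) (N : nat) x (a : R) : (0 < N)%N ->
  (forall k, ⟦zeta k⟧ = a) -> ⟦x⟧ < a ->
  N%:R / 2 <= ⟦\sum_(k < N) zeta k / (zeta k - x)⟧.
Proof.
move=> N0 za xa.
have h k : 2^-1 <= complex.Re (zeta k / (zeta k - x)).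
  have a0 : 0 < a by apply: le_lt_trans xa; exact: rnorm_ge0.
  have z0 : zeta k != 0 by rewrite -rnorm_gt0 za.
  have -> : zeta k / (zeta k - x) = (1 - x / zeta k)^-1.
    have z1 : zeta k - x != 0 by rewrite subr_eq0; apply: contraTneq xa => <-; rewrite za ltxx.
    by field; rewrite z0.
  by apply: Re_inv_half; rewrite rnormM rnormV za ltr_pdivrMr// mul1r.
apply: le_trans (le_trans (ler_norm _) (Re_rnorm _)).
apply: le_trans (_ : \sum_(k < N) complex.Re (zeta k / (zeta k - x)) <= _); last first.
  by rewrite (big_morph (@complex.Re R) (id1 := 0) (op1 := +%R))// => -[? ?] [? ?].
apply: le_trans (_ : \sum_(k < N) 2^-1 <= _); last by apply: ler_sum.
by rewrite sumr_const card_ord -[2^-1 *+ N]mulr_natl.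
Qed.

(* The quotient [(phi z - phi x) z / (z - x)] vanishes at [0] and has a removable
   singularity at [x], so its average over the roots is small. *)
Lemma bary_estimate (r1 s : R) : 0 < r1 -> 0 < s -> exists2 K : R, 0 <= K &
  forall phi x w N e, ⟦x⟧ < r1 ->
    (forall z, ⟦z⟧ < r1 + s + s -> differentiable phi z /\ ⟦phi z⟧ <= 1) ->
    root_net w N e -> e * (r1 + s) < s / 2 ->
  ⟦\sum_(k < N) phi (w ^+ k * ((r1 + s)%:C)%C) *
      (w ^+ k * ((r1 + s)%:C)%C / (w ^+ k * ((r1 + s)%:C)%C - x)) -
   phi x * \sum_(k < N) (w ^+ k * ((r1 + s)%:C)%C / (w ^+ k * ((r1 + s)%:C)%C - x))⟧
  <= N%:R * (K * e).
Proof.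
move=> r10 s0; set r2 := r1 + s; set r3 := r2 + s.
have [r20 r30] : 0 < r2 /\ 0 < r3 by rewrite /r3 /r2; split; lra.
(* Bound for the quotient at distance s/2 or more from [x]; [L] is the Lipschitz constant it gives
   on discs of radius s/2 about points of the circle of radius r2. *)
pose M := 2 * r3 / (s / 2); have M0 : 0 <= M by rewrite /M ltW// !divr_gt0// mulr_gt0.
pose L := 4 * M / (s / 2); have L0 : 0 <= L by apply: divr_ge0; [exact: mulr_ge0|lra].
exists (L * r2); first by rewrite mulr_ge0// ltW.
move=> phi x w N e xr1 hphi net er.
pose v z := (phi z - phi x) * (z / (z - x)).
(* The marker z - x is nonzero at the centre unless x = 0. In that case the quotient is just phi z -
   phi x, without an exceptional point. *)
pose chi z := if x == 0 then 1 else z - x.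
have x3 : ⟦x⟧ < r3 by rewrite /r3 /r2; lra.
have dv z : ⟦z⟧ < r3 -> z != x -> differentiable v z.
  move=> z3 zx; apply: dif_mul; first by apply: dif_sub; [exact: (hphi z z3).1|exact: dif_cst].
  apply: dif_mul; first exact: dif_id.
  apply: dif_inv; first by apply: dif_sub; [exact: dif_id|exact: dif_cst].
  by rewrite subr_eq0.
have vx0 : v 0 = 0 by rewrite /v mul0r mulr0.
have near3 z : ⟦z⟧ < r3 -> \forall y \near z, ⟦y⟧ < r3.
  move=> z3; have := @near_ball R _ 0 r3 z; rewrite subr0 => /(_ z3).
  by apply: filterS => y; rewrite subr0.
have vb z : ⟦z⟧ < r3 -> s / 2 < ⟦z - x⟧ -> ⟦v z⟧ <= M.
  move=> z3 zx; have zx0 : 0 < ⟦z - x⟧ by lra.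
  rewrite /v !rnormM rnormV /M mulrA; apply: ler_pM.
  - by rewrite mulr_ge0 ?rnorm_ge0.
  - by rewrite invr_ge0 rnorm_ge0.
  - apply: ler_pM; rewrite ?rnorm_ge0//; last exact: ltW.
    apply: le_trans (rnormB _ _) _.
    by have := (hphi z z3).2; have := (hphi x x3).2; lra.
  - by rewrite lef_pV2 ?posrE//; lra.
have vbd z : differentiable v z -> exists B, \forall y \near z, ⟦v y⟧ <= B.
  move=> /differentiable_continuous/local_bound[d d0 hd]; exists (⟦v z⟧ + 1).
  exact: filterS hd (near_rnorm z d0).
have vball c y : ⟦c⟧ = r2 -> ⟦y - c⟧ < s / 2 -> ⟦y⟧ < r3 /\ s / 2 < ⟦y - x⟧.
  move=> cr yc; have := rnorm_dist c y; have := rnorm_dist y c; have := rnorm_dist y x.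
  by rewrite [⟦c - y⟧]rdistC cr /r3 /r2; move: yc xr1 s0; rewrite /r2; clear; lra.
have := @mean_estimate R v chi r2 r3 L (s / 2) e (r3 + r3 + 1) w N.
rewrite vx0 mul0rn subr0 => H; suff <- : \sum_(i < N) v (w ^+ i * (r2%:C)%C) =
    \sum_(k < N) phi (w ^+ k * (r2%:C)%C) * (w ^+ k * (r2%:C)%C / (w ^+ k * (r2%:C)%C - x)) -
   phi x * \sum_(k < N) (w ^+ k * (r2%:C)%C / (w ^+ k * (r2%:C)%C - x)).
  have r23 : r2 < r3 by rewrite /r3; lra.
  rewrite -mulrA [r2 * e]mulrC; apply: (H r20 r23 L0 net er).
  - by rewrite /chi; case: ifPn => [_|x0]; rewrite ?sub0r ?oppr_eq0// oner_eq0.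
  - move=> z z3; rewrite /chi; case: ifP => _; first by rewrite rnorm1; lra.
    by have := rnormB z x; lra.
  - move=> z z3; have [x0|x0] := eqVneq x 0.
      have vE : v = (fun y => phi y - phi x).
        apply/funext => y; rewrite /v x0 subr0; have [->|y0] := eqVneq y 0; first by rewrite subrr mul0r.
        by rewrite divff ?mulr1.
      have dvy y : ⟦y⟧ < r3 -> differentiable v y.
        by move=> y3; rewrite vE; apply: dif_sub; [exact: (hphi y y3).1|exact: dif_cst].
      split; first exact: vbd (dvy z z3).
      left; apply: filterS (near3 z z3) => y y3; split; first exact: dvy.
      by rewrite /chi x0 eqxx; exact: dif_cst.
    have chiE : chi = (fun y => y - x) by rewrite /chi (negbTE x0).
    have dchi y : differentiable chi y by rewrite chiE; apply: dif_sub; [exact: dif_id|exact: dif_cst].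
    have [zx|zx] := eqVneq z x; last first.
      split; first exact: vbd (dv z z3 zx).
      left; have : 0 < ⟦z - x⟧ by rewrite rnorm_gt0 subr_eq0.
      move=> /near_rnorm nz; apply: filterS2 (near3 z z3) (nz _ z) => y y3 yz; split; last exact: dchi.
      by apply: (dv y y3); apply: contraTneq yz => ->; rewrite rdistC ltxx.
    rewrite zx; split; last first.
      by right=> d d0; apply: filterS (near_rnorm x d0) => y /ltW; rewrite chiE.
    have d0 : 0 < r3 - ⟦x⟧ by rewrite subr_gt0.
    have [||_ h _] := @cauchy_estimates_dif R _ phi x (r3 - ⟦x⟧) 1 d0.
    + by move=> y yx; apply: (hphi _ _).1; have := rnorm_dist y x; lra.
    + by move=> y yx; apply: (hphi _ _).2; have := rnorm_dist y x; lra.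
    exists (4 * 1 / (r3 - ⟦x⟧) * r3); apply: filterS2 (near_rnorm x d0) (near3 x x3) => y yx y3.
    have [->|yx0] := eqVneq y x.
      by rewrite /v subrr mul0r rnorm0 mulr_ge0 ?divr_ge0// ltW.
    have yx1 : 0 < ⟦y - x⟧ by rewrite rnorm_gt0 subr_eq0.
    have := h (y - x) yx; rewrite subrKC => hy.
    rewrite /v !rnormM rnormV mulrA ler_pdivrMr// mulrAC; apply: ler_pM; rewrite ?rnorm_ge0//.
    exact: ltW.
  - move=> z zr; have [//|h1 h2] := vball z z zr; first by rewrite subrr rnorm0; lra.
    apply: differentiable_continuous; apply: dv => //.
    by rewrite -subr_eq0 -rnorm_gt0; lra.
  - move=> a y ar yr ya.
    have [|||_ h _] := @cauchy_estimates_dif R _ v a (s / 2) M; first by lra.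
    + move=> y' /(vball _ _ ar)[h1 h2]; apply: dv => //.
      by rewrite -subr_eq0 -rnorm_gt0; lra.
    + by move=> y' /(vball _ _ ar)[h1 h2]; exact: vb.
    by have := h (y - a) ya; rewrite subrKC.
rewrite mulr_sumr -sumrB; apply: eq_bigr => i _.
by rewrite /v mulrBl.
Qed.
End Barycentric.

Section DiscMax.
Context {R : realType}.
Local Notation C := (Cplx R).

Lemma disc_max (u : C -> C) (rho rho0 m : R) : 0 <= m -> rho0 < rho ->
  (forall x, ⟦x⟧ < rho -> differentiable u x) ->
  (forall x, rho0 < ⟦x⟧ -> ⟦x⟧ < rho -> ⟦u x⟧ <= m) ->
  forall x, ⟦x⟧ < rho -> ⟦u x⟧ <= m.
Proof.
move=> m0 rr du um x xr.
apply: (@disc_max_marker R u (fun=> 1) rho rho0 m 1) => //.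
- by move=> y _; rewrite rnorm1.
- move=> y yr; left; have := @near_ball R _ 0 rho y; rewrite subr0 => /(_ yr).
  by apply: filterS => t; rewrite subr0 => tr; split; [exact: du|exact: dif_cst].
Qed.

End DiscMax.

Section SetCoordinate.
Context {R : realType} {n : nat}.
Local Notation C := (Cplx R).
Local Notation V := 'rV[C]_n.
Implicit Types (p : V) (i j : 'I_n) (c : C).

Definition setc p i c : V := p + (c - p 0 i) *: delta_mx 0 i.

Lemma setcE p i c j : setc p i c 0 j = if j == i then c else p 0 j.
Proof.
rewrite /setc !mxE eqxx /=; case: eqP => [->|_]; first by rewrite mulr1 subrKC.
by rewrite mulr0 addr0.
Qed.

Lemma rnorm_setc p i c (r : R) : ⟦p⟧ < r -> ⟦c⟧ < r -> ⟦setc p i c⟧ < r.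
Proof.
move=> pr cr; apply: le_lt_trans (_ : Num.max ⟦p⟧ ⟦c⟧ < r); last by rewrite gt_max pr.
apply: rnorm_row_le => [|j]; first by rewrite le_max rnorm_ge0.
by rewrite setcE le_max; case: eqP => _; rewrite ?lexx ?orbT// rnorm_coord.
Qed.

Lemma rnorm_row_gt (r : R) p : 0 <= r -> r < ⟦p⟧ -> exists i, r < ⟦p 0 i⟧.
Proof.
move=> r0 rp; apply: contrapT => H; move: rp; rewrite ltNge => /negP; apply.
by apply: rnorm_row_le => // i; rewrite leNgt; apply/negP => ri; apply: H; exists i.
Qed.

Lemma setc_dif_l i c p : differentiable (fun q => setc q i c) p.
Proof.
apply: dif_row => j; under eq_fun do rewrite setcE.
by case: eqP => _; [exact: dif_cst|exact: coord_differentiable].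
Qed.

Lemma setc_dif_r p i c : differentiable (fun d => setc p i d) c.
Proof.
apply: dif_row => j; under eq_fun do rewrite setcE.
by case: eqP => _; [exact: dif_id|exact: dif_cst].
Qed.

End SetCoordinate.

(** * Extension across the polydisc *)

Section Hartogs.
Context {R : realType} {n : nat}.
Local Notation C := (Cplx R).
Local Notation V := 'rV[C]_n.
Implicit Types (u F : V -> C) (p : V).

(** F is the barycentric quotient of the values of [u] at roots of unity on a circle of radius r +
    2s in the coordinate [i1]. These nodes lie in the shell whatever the other coordinates are, so F
    is holomorphic on the whole polydisc. Where |p i2| > r the entire [i1]-disc lies in the shell,
    and [bary_estimate] compares F with [u]. *)
Lemma hartogs_approx (i1 i2 : 'I_n) u (r s : R) : i1 != i2 -> 0 < r -> 0 < s ->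
  (forall p, r < ⟦p⟧ -> ⟦p⟧ < r + s + s + s -> differentiable u p /\ ⟦u p⟧ <= 1) ->
  exists M : R, forall e : R, 0 < e -> exists F, forall p, ⟦p⟧ < r + s ->
    [/\ differentiable F p, ⟦F p⟧ <= M & r < ⟦p 0 i2⟧ -> ⟦F p - u p⟧ <= e].
Proof.
move=> i12 r0 s0 hu; have r10 : 0 < r + s by lra.
have [K K0 HK] := bary_estimate r10 s0.
pose r2 := r + s + s; have r20 : 0 < r2 by rewrite /r2; lra.
exists (2 * (r2 / s)) => e e0.
have [d [d0 d1 d2]] : exists d : R, [/\ 0 < d, d * r2 < s / 2 & 2 * (K * d) <= e].
  pose a := s / 4 / r2; pose b := e / (2 * (K + 1)).
  have a0 : 0 < a by rewrite !divr_gt0.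
  have b0 : 0 < b by rewrite divr_gt0// mulr_gt0//; lra.
  exists (Num.min a b); split; first by rewrite lt_min a0.
    apply: le_lt_trans (_ : a * r2 < _); first by rewrite ler_pM2r// ge_min lexx.
    by rewrite /a divfK ?gt_eqF//; lra.
  apply: le_trans (_ : 2 * (K * b) <= _).
    by rewrite !ler_wpM2l// ge_min lexx orbT.
  have -> : e = 2 * ((K + 1) * b) by rewrite /b; field; lra.
  by rewrite ler_pM2l// ler_wpM2r// ?ltW//; lra.
have [w [N [N0 wN w1 wz]]] := root_net_exists d0.
have net : root_net w N d by [].
pose zeta k : C := w ^+ k * (r2%:C)%C.
have zr k : ⟦zeta k⟧ = r2 by rewrite rnormM rnormX w1 expr1n mul1r rnormC ger0_norm// ltW.
pose kap k (x : C) := zeta k / (zeta k - x).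
pose D x := \sum_(k < N) kap k x.
have Npos : 0 < N%:R / 2 :> R by rewrite divr_gt0// ltr0n.
have D1 x : ⟦x⟧ < r + s -> N%:R / 2 <= ⟦D x⟧.
  by move=> xr; apply: bary_weight zr _ => //; rewrite /r2; lra.
have D0 x : ⟦x⟧ < r + s -> D x != 0 by move=> /D1 h; rewrite -rnorm_gt0; lra.
have zx k x : ⟦x⟧ < r + s -> s <= ⟦zeta k - x⟧.
  by have := rnorm_dist (zeta k) x; rewrite zr /r2; lra.
exists (fun p => (\sum_(k < N) u (setc p i1 (zeta k)) * kap k (p 0 i1)) / D (p 0 i1)).
move=> p pr; have p1r : ⟦p 0 i1⟧ < r + s by apply: le_lt_trans pr; exact: rnorm_coord.
have dk k : differentiable (fun q : V => kap k (q 0 i1)) p.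
  apply: dif_mul; first exact: dif_cst.
  apply: dif_inv; first by apply: dif_sub; [exact: dif_cst|exact: coord_differentiable].
  by rewrite -rnorm_gt0; have := zx k _ p1r; lra.
have hz k : differentiable u (setc p i1 (zeta k)) /\ ⟦u (setc p i1 (zeta k))⟧ <= 1.
  apply: hu.
    apply: lt_le_trans (rnorm_coord _ i1); rewrite setcE eqxx zr /r2; lra.
  by apply: rnorm_setc; rewrite ?zr /r2; lra.
split.
- apply: dif_mul; last first.
    by apply: dif_inv; [apply: dif_sum => k; exact: dk|exact: D0].
  apply: dif_sum => k; apply: dif_mul; last exact: dk.
  apply: (@differentiable_comp _ _ _ _ (fun q => setc q i1 (zeta k)) u).
    exact: setc_dif_l.
  exact: (hz k).1.
- rewrite rnormM rnormV ler_pdivrMr; last by have := D1 _ p1r; lra.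
  apply: le_trans (rnorm_sum _ _ _) _.
  apply: le_trans (_ : \sum_(k < N) r2 / s <= _).
    apply: ler_sum => k _; rewrite rnormM -[r2 / s]mul1r; apply: ler_pM; rewrite ?rnorm_ge0//.
      exact: (hz k).2.
    rewrite rnormM rnormV zr ler_pM2l// lef_pV2 ?posrE//; first exact: zx.
    by have := zx k _ p1r; lra.
  rewrite sumr_const card_ord -[(r2 / s) *+ N]mulr_natl.
  have a0 : 0 <= r2 / s by rewrite ltW// divr_gt0.
  have := ler_wpM2l a0 (D1 _ p1r).
  by move: (r2 / s) ⟦D _⟧ N%:R; clear; move=> a b c; lra.
- move=> p2r; have Dp := D1 _ p1r.
  have Dp0 := D0 _ p1r.
  pose phi c := u (setc p i1 c).
  have uE : u p = phi (p 0 i1) by rewrite /phi /setc subrr scale0r addr0.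
  set S := \sum_(k < N) _.
  have -> : S / D (p 0 i1) - u p = (S - phi (p 0 i1) * D (p 0 i1)) / D (p 0 i1).
    by rewrite uE; move: S (phi _) (D _) Dp0 => a b c c0; field.
  rewrite rnormM rnormV ler_pdivrMr; last by lra.
  have hphi z : ⟦z⟧ < r + s + s + s -> differentiable phi z /\ ⟦phi z⟧ <= 1.
    move=> z3; have [h1 h2] : differentiable u (setc p i1 z) /\ ⟦u (setc p i1 z)⟧ <= 1.
      apply: hu; last by apply: rnorm_setc => //; lra.
      by apply: lt_le_trans (rnorm_coord _ i2); rewrite setcE eq_sym (negbTE i12).
    split=> //; apply: (@differentiable_comp _ _ _ _ (fun c => setc p i1 c) u).
      exact: setc_dif_r.
    exact: h1.
  have := HK phi (p 0 i1) w N d p1r hphi net d1.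
  rewrite -/S -/(D _) => h; apply: le_trans h _.
  have := ler_wpM2l (ltW e0) Dp; have := ler_wpM2r (ltW Npos) d2.
  by move: (K * d) ⟦D _⟧ N%:R; clear; move=> a b c; lra.
Qed.

(** The approximants are close to [u], hence to each other, where |p i2| > r. The maximum principle
    in the coordinate [i2] spreads this to the polydisc, so they converge uniformly. *)
Lemma hartogs (i1 i2 : 'I_n) u (r s : R) : i1 != i2 -> 0 < r -> 0 < s ->
  (forall p, r < ⟦p⟧ -> ⟦p⟧ < r + s + s + s -> differentiable u p /\ ⟦u p⟧ <= 1) ->
  exists F, (forall p, ⟦p⟧ < r + s -> differentiable F p) /\
    forall p, r < ⟦p⟧ -> ⟦p⟧ < r + s -> F p = u p.
Proof.
move=> i12 r0 s0 hu.
have [M HM] := hartogs_approx i12 r0 s0 hu.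
pose eps j : R := 1 / 2 ^+ j.
have eps0 j : 0 < eps j by rewrite divr_gt0// exprn_gt0.
have epsle j k : (j <= k)%N -> eps k <= eps j.
  by move=> jk; rewrite ler_pM2l// lef_pV2 ?posrE ?exprn_gt0// ler_weXn2l// ler1n.
have epssmall (e : R) : 0 < e -> exists j, eps j < e by exact: exists_half_pow.
have /choice[Fs HF] : forall j, exists F, forall p, ⟦p⟧ < r + s ->
    [/\ differentiable F p, ⟦F p⟧ <= M & r < ⟦p 0 i2⟧ -> ⟦F p - u p⟧ <= eps j].
  by move=> j; exact: HM.
have line p c : ⟦p⟧ < r + s -> ⟦c⟧ < r + s -> ⟦setc p i2 c⟧ < r + s by exact: rnorm_setc.
have lineE p : setc p i2 (p 0 i2) = p by rewrite /setc subrr scale0r addr0.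
have dline f p c : differentiable f (setc p i2 c) -> differentiable (fun d => f (setc p i2 d)) c.
  move=> df; apply: (@differentiable_comp _ _ _ _ (fun d => setc p i2 d) f _ _ df).
  exact: setc_dif_r.
have cauchy p j k : ⟦p⟧ < r + s -> (j <= k)%N -> ⟦Fs j p - Fs k p⟧ <= 2 * eps j.
  move=> pr jk; rewrite -(lineE p).
  have p2 : ⟦p 0 i2⟧ < r + s by apply: le_lt_trans pr; exact: rnorm_coord.
  apply: (@disc_max R (fun c => Fs j (setc p i2 c) - Fs k (setc p i2 c)) (r + s) r (2 * eps j) _ _ _ _ _ p2).
  - by have := eps0 j; lra.
  - by lra.
  - move=> c cr; have pc := line _ _ pr cr.
    by apply: dif_sub; apply: dline; [case: (HF j _ pc)|case: (HF k _ pc)].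
  - move=> c rc cr; have pc := line _ _ pr cr.
    have rc' : r < ⟦setc p i2 c 0 i2⟧ by rewrite setcE eqxx.
    have [_ _ /(_ rc') h1] := HF j _ pc; have [_ _ /(_ rc') h2] := HF k _ pc.
    have := rdistT (Fs j (setc p i2 c)) (u (setc p i2 c)) (Fs k (setc p i2 c)).
    by rewrite [⟦u _ - _⟧]rdistC; have := epsle _ _ jk; lra.
(* The limit at [p] is a cluster point of the bounded values; off the polydisc any value serves. *)
have /choice[F FE] : forall p, exists y : C, ⟦p⟧ < r + s -> forall j, ⟦Fs j p - y⟧ <= 2 * eps j.
  move=> p; have [pr|pr] := ltP ⟦p⟧ (r + s); last by exists 0.
  have [|y [_ ycl]] := @disc_compact R 0 M ((fun j => Fs j p) @ \oo) _.
    by exists 0%N => // j _ /=; rewrite subr0; have [] := HF j _ pr.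
  exists y => _ j; apply/ler_addgt0Pr => e e0.
  have h1 : ((fun j => Fs j p) @ \oo) [set z | ⟦Fs j p - z⟧ <= 2 * eps j].
    by exists j => // k /= jk; exact: cauchy.
  have h2 : nbhs (y : C) [set z | ⟦z - y⟧ < e] := near_rnorm y e0.
  have [z [/= z1 z2]] := ycl _ _ h1 h2.
  by have := rdistT (Fs j p) z y; lra.
have dF p : ⟦p⟧ < r + s -> differentiable F p.
  move=> pr; have d0 : 0 < r + s - ⟦p⟧ by lra.
  apply: (weierstrass (M := M) d0) => e e0.
  have [j je] : exists j, eps j < e / 2 by apply: epssmall; lra.
  exists (Fs j) => x xp; have xr : ⟦x⟧ < r + s by have := rnorm_dist x p; lra.
  have [h1 h2 _] := HF j _ xr; split=> //.
  by have := FE x xr j; lra.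
have Fu p : ⟦p⟧ < r + s -> r < ⟦p 0 i2⟧ -> F p = u p.
  move=> pr rp; apply/eqP; rewrite -subr_eq0 -rnorm_eq0 eq_le rnorm_ge0 andbT.
  apply/ler_addgt0Pr => e e0; have [j je] : exists j, eps j < e / 3 by apply: epssmall; lra.
  have [_ _ /(_ rp) h] := HF j _ pr; have := FE _ pr j.
  by have := rdistT (F p) (Fs j p) (u p); rewrite [⟦F p - Fs j p⟧]rdistC; lra.
exists F; split=> // p rp pr.
have [i ri] := rnorm_row_gt (ltW r0) rp.
have [i2E|ii2] := eqVneq i i2; first by apply: Fu; rewrite // -i2E.
have p2 : ⟦p 0 i2⟧ < r + s by apply: le_lt_trans pr; exact: rnorm_coord.
apply/eqP; rewrite -subr_eq0 -rnorm_eq0 eq_le rnorm_ge0 andbT -(lineE p).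
(* A coordinate other than [i2] exceeds r, so [u] is holomorphic on the whole [i2]-disc, and F - u
   vanishes near its rim. *)
apply: (@disc_max R (fun c => F (setc p i2 c) - u (setc p i2 c)) (r + s) r 0 (lexx 0) _ _ _ _ p2).
- by lra.
- move=> c cr; have pc := line _ _ pr cr.
  apply: dif_sub; apply: dline; first exact: dF.
  have [] // := hu (setc p i2 c); last by lra.
  by apply: lt_le_trans (rnorm_coord _ i); rewrite setcE (negbTE ii2).
- move=> c rc cr; have pc := line _ _ pr cr.
  by rewrite Fu ?subrr ?rnorm0// setcE eqxx.
Qed.

End Hartogs.

(** * Euclidean geometry and automorphisms of the ball *)

Section Euclid.
Context {R : realType} {n : nat}.
Local Notation C := (Cplx R).
Local Notation V := 'rV[C]_n.
Local Notation E := (@euclid_norm R n).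
Implicit Types (v w z : V).

Lemma euclid_ge0 z : 0 <= E z. Proof. exact: sqrtr_ge0. Qed.

Lemma euclid_sqr z : E z ^+ 2 = \sum_i ⟦z 0 i⟧ ^+ 2.
Proof. by rewrite sqr_sqrtr// sumr_ge0// => i _; rewrite sqr_ge0. Qed.

Lemma euclid_lt1 z : (E z < 1) = (E z ^+ 2 < 1).
Proof. by rewrite expr_lt1// euclid_ge0. Qed.

Lemma euclid0 : E 0 = 0.
Proof.
apply/eqP; rewrite -sqrf_eq0 euclid_sqr big1// => i _.
by rewrite mxE rnorm0 expr0n.
Qed.

Lemma euclid_eq0 z : E z = 0 -> z = 0.
Proof.
move=> z0; have : \sum_i ⟦z 0 i⟧ ^+ 2 = 0 by rewrite -euclid_sqr z0 expr0n.
move=> /eqP; rewrite psumr_eq0; last by move=> i _; rewrite sqr_ge0.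
move=> /allP H; apply/matrixP => a i; rewrite ord1 mxE.
have := H i (mem_index_enum _); rewrite /= sqrf_eq0 rnorm_eq0.
by move=> /eqP.
Qed.

Lemma euclidZ (a : C) z : E (a *: z) = ⟦a⟧ * E z.
Proof.
apply/eqP; rewrite -(@eqrXn2 _ 2)// ?mulr_ge0 ?rnorm_ge0 ?euclid_ge0//.
rewrite exprMn !euclid_sqr mulr_sumr; apply/eqP/eq_bigr => i _.
by rewrite mxE rnormM exprMn.
Qed.

Lemma rnorm_le_euclid z : ⟦z⟧ <= E z.
Proof.
apply: rnorm_row_le => [|i]; first exact: euclid_ge0.
rewrite -(@ler_pXn2r _ 2) ?nnegrE ?rnorm_ge0 ?euclid_ge0// euclid_sqr.
rewrite (bigD1 i)//= lerDl sumr_ge0// => j _; exact: sqr_ge0.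
Qed.

Lemma euclid_le_rnorm z : E z <= Num.sqrt n%:R * ⟦z⟧.
Proof.
rewrite -(@ler_pXn2r _ 2) ?nnegrE ?mulr_ge0 ?rnorm_ge0 ?euclid_ge0 ?sqrtr_ge0// euclid_sqr.
rewrite exprMn sqr_sqrtr// mulr_natl.
apply: le_trans (_ : \sum_(i < n) ⟦z⟧ ^+ 2 <= _); last by rewrite sumr_const card_ord.
by apply: ler_sum => i _; rewrite ler_pXn2r ?nnegrE ?rnorm_ge0// rnorm_coord.
Qed.

Lemma sum_cauchy_schwarz (a b : 'I_n -> R) :
  (\sum_i a i * b i) ^+ 2 <= (\sum_i a i ^+ 2) * \sum_i b i ^+ 2.
Proof.
set S := \sum_i a i * b i; set A := \sum_i a i ^+ 2; set B := \sum_i b i ^+ 2.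
have B0 : 0 <= B by rewrite sumr_ge0// => i _; rewrite sqr_ge0.
have [BE|Bn] := eqVneq B 0.
  have b0 i : b i = 0.
    move/eqP: BE; rewrite psumr_eq0; last by move=> j _; rewrite sqr_ge0.
    by move=> /allP/(_ i (mem_index_enum _)); rewrite /= sqrf_eq0 => /eqP.
  by rewrite BE mulr0 /S big1 ?expr0n// => i _; rewrite b0 mulr0.
have : 0 <= \sum_i (a i * B - b i * S) ^+ 2 by rewrite sumr_ge0// => i _; rewrite sqr_ge0.
have -> : \sum_i (a i * B - b i * S) ^+ 2 = B * (A * B - S ^+ 2).
  have -> : B * (A * B - S ^+ 2) = A * B ^+ 2 + S * (- (2 * B * S)) + B * S ^+ 2 by ring.
  rewrite /A {2}/S {4}/B !mulr_suml -!big_split /=.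
  by apply: eq_bigr => i _; ring.
by rewrite pmulr_rge0 ?subr_ge0// lt_neqAle eq_sym Bn.
Qed.

Lemma sum_modulus_le v w : \sum_i ⟦v 0 i⟧ * ⟦w 0 i⟧ <= E v * E w.
Proof.
rewrite -(@ler_pXn2r _ 2) ?nnegrE ?mulr_ge0 ?euclid_ge0//; last first.
  by rewrite sumr_ge0// => i _; rewrite mulr_ge0 ?rnorm_ge0.
by rewrite exprMn !euclid_sqr; exact: sum_cauchy_schwarz.
Qed.

Lemma euclidD v w : E (v + w) <= E v + E w.
Proof.
rewrite -(@ler_pXn2r _ 2) ?nnegrE ?addr_ge0 ?euclid_ge0// euclid_sqr.
apply: le_trans (_ : \sum_i (⟦v 0 i⟧ + ⟦w 0 i⟧) ^+ 2 <= _).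
  by apply: ler_sum => i _; rewrite ler_pXn2r ?nnegrE ?addr_ge0 ?rnorm_ge0// mxE rnormD.
have -> : \sum_i (⟦v 0 i⟧ + ⟦w 0 i⟧) ^+ 2 =
    E v ^+ 2 + 2 * (\sum_i ⟦v 0 i⟧ * ⟦w 0 i⟧) + E w ^+ 2.
  by rewrite !euclid_sqr mulr_sumr -!big_split /=; apply: eq_bigr => i _; ring.
by have := sum_modulus_le v w; rewrite sqrrD; lra.
Qed.

Lemma euclid_dist v w : E v <= E w + Num.sqrt n%:R * ⟦v - w⟧.
Proof.
have := euclidD w (v - w); rewrite subrKC => h; apply: le_trans h _.
by rewrite lerD2l euclid_le_rnorm.
Qed.

Lemma euclid_continuous v (e : R) : 0 < e -> \forall w \near v, `|E w - E v| < e.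
Proof.
move=> e0; have n0 := sqrtr_ge0 (n%:R : R). have d0 : 0 < e / (Num.sqrt n%:R + 1) by rewrite divr_gt0// ltr_wpDl.
apply: filterS (near_rnorm v d0) => w; rewrite ltr_pdivlMr ?ltr_wpDl// => h.
have := euclid_dist w v; have := euclid_dist v w; rewrite [⟦v - w⟧]rdistC.
have : Num.sqrt n%:R * ⟦w - v⟧ < e.
  by have := rnorm_ge0 (w - v); move: h n0; move: ⟦_⟧ (Num.sqrt n%:R); clear; move=> a b; nra.
by move: (Num.sqrt n%:R * _); clear; move=> a h1 h2 h3; rewrite ltr_norml; apply/andP; split; lra.
Qed.

Definition hdot w z : C := \sum_i w 0 i * (z 0 i)^*.

Lemma rnorm_conj (x : C) : ⟦x^*⟧ = ⟦x⟧.
Proof.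
apply/eqP; rewrite -(@eqrXn2 _ 2)// ?rnorm_ge0// !rnorm_sqr.
by case: x => a b /=; rewrite sqrrN.
Qed.

Lemma hdot_le_sum w z : ⟦hdot w z⟧ <= \sum_i ⟦w 0 i⟧ * ⟦z 0 i⟧.
Proof.
apply: le_trans (rnorm_sum _ _ _) _; apply: ler_sum => i _.
by rewrite rnormM rnorm_conj.
Qed.

Lemma hdot_le w z : ⟦hdot w z⟧ <= E w * E z.
Proof. exact: le_trans (hdot_le_sum w z) (sum_modulus_le w z). Qed.

Lemma hdotDl v w z : hdot (v + w) z = hdot v z + hdot w z.
Proof. by rewrite /hdot -big_split; apply: eq_bigr => i _; rewrite mxE mulrDl. Qed.

Lemma hdotZl (a : C) w z : hdot (a *: w) z = a * hdot w z.
Proof. by rewrite /hdot mulr_sumr; apply: eq_bigr => i _; rewrite mxE mulrA. Qed.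

Lemma hdot0l z : hdot 0 z = 0.
Proof. by rewrite /hdot big1// => i _; rewrite mxE mul0r. Qed.

Lemma hdotvv z : hdot z z = ((E z ^+ 2)%:C)%C.
Proof.
rewrite euclid_sqr (big_morph (real_complex R) (id1 := 0) (op1 := +%R))//; last first.
  by move=> a b; rewrite rmorphD.
apply: eq_bigr => i _; case: (z 0 i) => a b; rewrite rnorm_sqr /=.
by apply/eqP; rewrite eq_complex /=; apply/andP; split; apply/eqP; ring.
Qed.

Lemma euclid_sqrB (a b : C) v w : E (a *: v - b *: w) ^+ 2 =
  ⟦a⟧ ^+ 2 * E v ^+ 2 - 2 * complex.Re (a^* * b * hdot w v) + ⟦b⟧ ^+ 2 * E w ^+ 2.
Proof.
rewrite !euclid_sqr /hdot !mulr_sumr (big_morph (@complex.Re R) (id1 := 0) (op1 := +%R))//; last first.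
  by move=> [? ?] [? ?].
rewrite mulr_sumr -sumrB -big_split /=; apply: eq_bigr => i _; rewrite !mxE.
move: (v 0 i) (w 0 i) => x y; rewrite !rnorm_sqr; case: a b x y => [a1 a2] [b1 b2] [x1 x2] [y1 y2] /=.
by ring.
Qed.

Lemma hdot_dif (W : normedModType C) (f : W -> V) z x : differentiable f x ->
  differentiable (fun y => hdot (f y) z) x.
Proof.
by move=> df; apply: dif_sum => i; apply: dif_mul; [exact: dif_coord|exact: dif_cst].
Qed.

End Euclid.

Section BallAutomorphism.
Context {R : realType} {n : nat}.
Local Notation C := (Cplx R).
Local Notation V := 'rV[C]_n.
Local Notation E := (@euclid_norm R n).
Implicit Types (v w z : V).

(** The involution (z - P w - s Q w)/(1 - <w, z>), with P the orthogonal projection to the line of z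
    and Q = 1 - P. From (1 - s)/|z|^2 = 1/(1 + s) one gets P w + s Q w = s w + <w, z> z/(1 + s), a
    form that covers z = 0. *)
Definition ball_swap z w : V := let s := ((Num.sqrt (1 - E z ^+ 2))%:C)%C in
  (1 - hdot w z)^-1 *: ((1 - hdot w z / (1 + s)) *: z - s *: w).

Variable z : V.
Hypothesis z1 : E z < 1.
Let s : R := Num.sqrt (1 - E z ^+ 2).

Let sz0 : 0 < 1 - E z ^+ 2. Proof. by rewrite subr_gt0 -euclid_lt1. Qed.
Let s0 : 0 < s. Proof. by rewrite sqrtr_gt0. Qed.
Let s2 : s ^+ 2 = 1 - E z ^+ 2. Proof. by rewrite sqr_sqrtr// ltW. Qed.

Let sC0 : (s%:C)%C != 0 :> C.
Proof. by rewrite -rnorm_gt0 rnormC normr_gt0 gt_eqF. Qed.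

Let sC1 : 1 + (s%:C)%C != 0 :> C.
Proof.
rewrite (_ : 1 + (s%:C)%C = ((1 + s)%:C)%C); last by rewrite rmorphD.
by rewrite -rnorm_gt0 rnormC normr_gt0 gt_eqF// addr_gt0.
Qed.

Let zz : hdot z z = 1 - (s%:C)%C ^+ 2.
Proof.
rewrite hdotvv (_ : E z ^+ 2 = 1 - s ^+ 2); last by rewrite s2; ring.
by rewrite rmorphB rmorphXn.
Qed.

Lemma hdot_lt1 w : E w < 1 -> ⟦hdot w z⟧ < 1.
Proof.
move=> w1; apply: le_lt_trans (hdot_le w z) _.
by rewrite (le_lt_trans _ z1)// ler_piMl ?euclid_ge0// ltW.
Qed.

Lemma hdot_neq1 w : E w < 1 -> 1 - hdot w z != 0.
Proof.
move=> /hdot_lt1; apply: contraTneq => /eqP; rewrite subr_eq0 => /eqP <-.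
by rewrite rnorm1 ltxx.
Qed.

Lemma ball_swap_center : ball_swap z z = 0.
Proof.
rewrite /ball_swap -/s zz -scalerBl.
rewrite (_ : _ - (s%:C)%C = 0) ?scale0r ?scaler0//; by field.
Qed.

Lemma ball_swap_norm w : E w < 1 ->
  E (ball_swap z w) ^+ 2 = 1 - (1 - E w ^+ 2) * (1 - E z ^+ 2) / ⟦1 - hdot w z⟧ ^+ 2.
Proof.
move=> w1; have h0 := hdot_neq1 w1.
rewrite /ball_swap -/s euclidZ exprMn euclid_sqrB rnormV exprVn -s2.
have Ez : E z ^+ 2 = 1 - s ^+ 2 by rewrite s2; ring.
rewrite Ez; set N := ⟦1 - hdot w z⟧ ^+ 2.
have N0 : N != 0 by rewrite expf_neq0// rnorm_eq0.
set X := (X in _ * X = _).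
suff -> : X = N - (1 - E w ^+ 2) * s ^+ 2 by field.
rewrite {}/X {N0}/N.
rewrite (_ : hdot w z / (1 + (s%:C)%C) = ((1 + s)^-1%:C)%C * hdot w z); last first.
  by rewrite fmorphV rmorphD mulrC.
(* The inverse of 1 + s becomes a variable [q], and the claim a polynomial identity modulo q (1 + s)
   = 1. *)
have q : (1 + s)^-1 * (1 + s) = 1 by rewrite mulVf// gt_eqF// addr_gt0.
move: ((1 + s)^-1) (E w ^+ 2) q => q e q1.
rewrite !rnorm_sqr; case: (hdot w z) => x y /=; apply/eqP; rewrite -subr_eq0.
rewrite [X in X == 0](_ : _ = (q * (1 + s) - 1) *
  (- 2 * x * (1 - s) + (x ^+ 2 + y ^+ 2) * (q * (1 - s) + 1))); last by ring.
by rewrite q1 subrr mul0r.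
Qed.

Lemma ball_swapK w : E w < 1 -> ball_swap z (ball_swap z w) = w.
Proof.
move=> w1; have h0 := hdot_neq1 w1.
set w' := ball_swap z w.
have w'z : hdot w' z = (1 - (s%:C)%C ^+ 2 - hdot w z) / (1 - hdot w z).
  rewrite /w' /ball_swap -/s hdotZl -[- (_ *: w)]scaleNr hdotDl !hdotZl zz.
  by field; rewrite h0 sC1.
rewrite {1}/ball_swap -/s w'z /w' /ball_swap -/s.
apply/matrixP => a i; rewrite !mxE; move: (hdot w z) h0 => b b0.
move: (s%:C)%C sC0 sC1 => t t0 t1.
field.
(* Here 1 - <w', z> = s^2/(1 - <w, z>), so the remaining denominator is t^2. *)
rewrite t1 b0 /= (_ : _ - _ = t ^+ 2) ?expf_neq0//; by ring.
Qed.

Lemma ball_swap_lt1 w : E w < 1 -> E (ball_swap z w) < 1.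
Proof.
move=> w1; rewrite euclid_lt1 ball_swap_norm// ltrBlDr ltrDl divr_gt0//.
  by rewrite mulr_gt0// subr_gt0 -euclid_lt1.
by rewrite exprn_gt0// rnorm_gt0 hdot_neq1.
Qed.

Lemma ball_swap_dif w : E w < 1 -> differentiable (ball_swap z) w.
Proof.
move=> w1; have dh : differentiable (fun v => hdot v z) w.
  exact: (hdot_dif z (dif_id w)).
apply: dif_row => i; under eq_fun do rewrite !mxE.
apply: dif_mul.
  apply: dif_inv; first by apply: dif_sub; [exact: dif_cst|exact: dh].
  exact: hdot_neq1.
apply: dif_sub.
  apply: dif_mul; last exact: dif_cst.
  apply: dif_sub; first exact: dif_cst.
  by apply: dif_mul; [exact: dh|exact: dif_cst].
by apply: dif_mul; [exact: dif_cst|exact: coord_differentiable].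
Qed.

Lemma ball_swap0 : ball_swap z 0 = z.
Proof. by rewrite -{1}ball_swap_center ball_swapK. Qed.

End BallAutomorphism.

(** * The complement of a polydisc in the ball *)

Section PolydiscShell.
Context {R : realType} {n : nat} (r : R).
Hypothesis r0 : 0 < r.
Local Notation C := (Cplx R).
Local Notation V := 'rV[C]_n.
Local Notation E := (@euclid_norm R n).
Implicit Types (p v w z : V).

Lemma polydiscE : polydisc (n := n) r = [set p : V | ⟦p⟧ < r].
Proof.
apply/seteqP; split=> p /= H.
  apply: le_lt_trans (_ : \big[Num.max/0]_i ⟦p 0 i⟧ < r).
    by apply: rnorm_row_le => [|i]; [exact: bigmax_ge_id|exact: le_bigmax].
  by apply/bigmax_ltP; split=> // i _; rewrite rnorm_modulus.
by move=> i; rewrite -rnorm_modulus (le_lt_trans (rnorm_coord _ _) H).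
Qed.

Lemma closure_polydisc : closure (polydisc (n := n) r) = [set p : V | ⟦p⟧ <= r].
Proof.
rewrite polydiscE; apply/seteqP; split=> p /=.
  have : closed [set p : V | ⟦p⟧ <= r] by apply: closed_rnorm_le => x; exact: cvg_id.
  move=> /closure_id cE pc; suff : [set p : V | ⟦p⟧ <= r] p by [].
  by rewrite cE; apply: closure_subset pc => q /=; exact: ltW.
have rp := r0; move=> pr A /nbhsC[d d0 dA].
have [e [e0 e1 ed]] : exists e : R, [/\ 0 < e, e < 1 & e * r < d].
  exists (d / (2 * (r + d))); split.
  - by rewrite divr_gt0// mulr_gt0//; lra.
  - by rewrite ltr_pdivrMr ?mulr_gt0//; lra.
  - by rewrite mulrAC ltr_pdivrMr ?mulr_gt0//; [nra|lra].
exists (((1 - e)%:C)%C *: p); split=> /=.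
  rewrite rnormZ rnormC ger0_norm; last by lra.
  by have := rnorm_ge0 p; move: ⟦p⟧ pr => a; nra.
apply: dA; rewrite rmorphB scalerBl scale1r addrAC subrr add0r rnormN rnormZ rnormC.
rewrite ger0_norm ?(ltW e0)//; apply: le_lt_trans ed.
by rewrite ler_pM2l.
Qed.

Lemma frontier_polydisc : frontier (polydisc (n := n) r) = [set p : V | ⟦p⟧ = r].
Proof.
have -> : frontier (polydisc (n := n) r) = [set p : V | ⟦p⟧ <= r] `\` [set p : V | ⟦p⟧ < r].
  rewrite /frontier closure_polydisc polydiscE; congr (_ `\` _).
  apply/seteqP; split=> p; first exact: interior_subset.
  move=> /= pr; apply/nbhsC; exists (r - ⟦p⟧); first by rewrite subr_gt0.
  by move=> y yp /=; have := rnorm_dist y p; lra.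
apply/seteqP; split=> p /=.
  by move=> [h /negP]; rewrite -leNgt => h'; apply/eqP; rewrite eq_le h.
by move=> ->; rewrite lexx ltxx.
Qed.

Definition shell : set V := [set p | E p < 1 /\ r < ⟦p⟧].

Lemma shellE : unit_ball `\` closure (polydisc (n := n) r) = shell.
Proof.
rewrite closure_polydisc; apply/seteqP; split=> p -[h1 h2]; split=> //.
  by rewrite ltNge; apply/negP.
by apply/negP; rewrite -ltNge.
Qed.

(** The Euclidean norm is at most sqrt n times the maximum norm. A third of the gap leaves room for
    Hartogs' three radii: extension up to r + s, nodes at r + 2s, domain up to r + 3s. *)
Lemma polydisc_margin : r < 1 / Num.sqrt n%:R ->
  exists2 s : R, 0 < s & forall p, ⟦p⟧ < r + s + s + s -> E p < 1.
Proof.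
have [->|n0] := posnP n; first by rewrite sqrtr0 invr0 mulr0 => h; have := lt_trans r0 h; rewrite ltxx.
have q0 : 0 < Num.sqrt n%:R :> R by rewrite sqrtr_gt0 ltr0n.
move=> rlt; exists ((1 / Num.sqrt n%:R - r) / 3); first by lra.
move=> p pr; apply: le_lt_trans (euclid_le_rnorm p) _.
by rewrite -(@ltr_pdivlMl _ (Num.sqrt n%:R))// mulr1; lra.
Qed.

End PolydiscShell.

(** * Schwarz's lemma on the shell *)

Section ShellSchwarz.
Context {R : realType} {n : nat} (r s : R).
Local Notation C := (Cplx R).
Local Notation V := 'rV[C]_n.
Local Notation E := (@euclid_norm R n).
Hypotheses (n2 : (1 < n)%N) (r0 : 0 < r) (s0 : 0 < s)
  (margin : forall p : V, ⟦p⟧ < r + s + s + s -> E p < 1).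
Implicit Types (p v w z : V) (u F : V -> C).

(** The Hartogs extension is glued to [u]. The bound 1 holds near the rim of each disc in the first
    coordinate, where the glued function is [u], hence inside. *)
Lemma shell_extension u :
  (forall p, E p < 1 -> r < ⟦p⟧ -> differentiable u p /\ ⟦u p⟧ <= 1) ->
  exists F, (forall p, E p < 1 -> differentiable F p /\ ⟦F p⟧ <= 1) /\
    forall p, E p < 1 -> r < ⟦p⟧ -> F p = u p.
Proof.
move=> hu; have rp := r0; have sp := s0.
pose i1 : 'I_n := Ordinal (ltnW n2); pose i2 : 'I_n := Ordinal n2.
have i12 : i1 != i2 by [].
have [|F [dF Fu]] := @hartogs R n i1 i2 u r s i12 rp sp.
  by move=> p rp1 p3; apply: hu => //; exact: margin.
pose G p := if ⟦p⟧ < r + s then F p else u p.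
have Gu p : r < ⟦p⟧ -> G p = u p.
  by move=> h; rewrite /G; case: ifP => // pr; exact: Fu.
have dG p : E p < 1 -> differentiable G p.
  move=> p1; have [pr|pr] := ltP ⟦p⟧ (r + s).
    apply: (@near_eq_dif _ _ _ F); last exact: dF.
    have : 0 < r + s - ⟦p⟧ by lra.
    move=> /near_rnorm n1; apply: filterS (n1 _ p) => y yp; rewrite /G ifT//.
    by have := rnorm_dist y p; lra.
  have rp' : r < ⟦p⟧ by lra.
  apply: (@near_eq_dif _ _ _ u); last exact: (hu p p1 rp').1.
  have : 0 < ⟦p⟧ - r by lra.
  move=> /near_rnorm n1; apply: filterS (n1 _ p) => y yp; rewrite Gu//.
  by have := rnorm_dist p y; rewrite rdistC; lra.
exists G; split; last by move=> p _; exact: Gu.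
move=> p p1; split; first exact: dG.
have [rp'|pr] := ltP r ⟦p⟧; first by rewrite Gu//; exact: (hu p p1 rp').2.
have pE : setc p i1 (p 0 i1) = p by rewrite /setc subrr scale0r addr0.
have pr1 : ⟦p⟧ < r + s by lra.
have line c : ⟦c⟧ < r + s -> E (setc p i1 c) < 1.
  by move=> cr; apply: margin; have := rnorm_setc i1 pr1 cr; lra.
rewrite -pE; apply: (@disc_max R (fun c => G (setc p i1 c)) (r + s) r 1) => //.
- lra.
- move=> c cr; apply: (@differentiable_comp _ _ _ _ (fun c => setc p i1 c) G).
    exact: setc_dif_r.
  by apply: dG; exact: line.
- move=> c rc cr; have rc' : r < ⟦setc p i1 c⟧.
    by apply: lt_le_trans (rnorm_coord _ i1); rewrite setcE eqxx.
  by rewrite Gu//; apply: (hu _ _ rc').2; exact: line.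
- by apply: le_lt_trans pr1; exact: rnorm_coord.
Qed.

(** With x = ball_swap z w, the extension is restricted to the disc l -> ball_swap z (l x), of
    radius 1/|x|, which passes through [z] at 0 and [w] at 1. *)
Lemma shell_schwarz u z w : E z < 1 -> r < ⟦z⟧ ->
  (forall p, E p < 1 -> r < ⟦p⟧ -> differentiable u p /\ ⟦u p⟧ <= 1) -> u z = 0 ->
  E w < 1 -> r < ⟦w⟧ -> ⟦u w⟧ <= E (ball_swap z w).
Proof.
move=> z1 rz hu uz w1 rw.
have [F [hF Fu]] := shell_extension hu.
pose x := ball_swap z w; have x1 : E x < 1 by exact: ball_swap_lt1.
have wx : ball_swap z x = w by exact: ball_swapK.
rewrite -/x; have [xE0|xn] := eqVneq (E x) 0.
  by rewrite -wx (euclid_eq0 xE0) ball_swap0// uz rnorm0 euclid0.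
have x0 : 0 < E x by rewrite lt_neqAle eq_sym xn euclid_ge0.
pose g (l : C) := F (ball_swap z (l *: x)).
have g0 : g 0 = 0 by rewrite /g scale0r ball_swap0// Fu.
have g1 : g 1 = u w by rewrite /g scale1r wx Fu.
have lx (l : C) : ⟦l⟧ < (E x)^-1 -> E (l *: x) < 1.
  by move=> h; rewrite euclidZ -ltr_pdivlMr// div1r.
have dg (l : C) : ⟦l⟧ < (E x)^-1 -> differentiable g l.
  move=> /lx h; apply: (@differentiable_comp _ _ _ _ (fun l : C => ball_swap z (l *: x)) F).
    apply: (@differentiable_comp _ _ _ _ (fun l : C => l *: x) (ball_swap z)).
      by have := dif_line 0 x l; under eq_fun do rewrite add0r.
    exact: ball_swap_dif.
  by apply: (hF _ _).1; exact: ball_swap_lt1.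
have ix : 1 < (E x)^-1 by rewrite invf_gt1.
have near_in (l : C) : ⟦l⟧ < (E x)^-1 -> \forall y \near l, ⟦y⟧ < (E x)^-1.
  move=> lr; have := @near_ball R _ 0 (E x)^-1 l; rewrite subr0 => /(_ lr).
  by apply: filterS => y; rewrite subr0.
(* The quotient g l / l is at most 1/a where |l| > a, hence also at 1; [a] may be taken arbitrarily
   close to 1/|x|. *)
have main (a : R) : 0 < a -> a < (E x)^-1 -> ⟦u w⟧ <= a^-1.
  move=> a0 ax.
  have := @disc_max_marker R (fun l : C => g l / l) id (E x)^-1 a a^-1 (E x)^-1.
  rewrite -g1 => H; have := H _ ax; rewrite invr_ge0 (ltW a0) => /(_ isT).
  move=> H'; rewrite -[g 1]divr1; apply: H' => //.
  - by move=> l; exact: ltW.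
  - move=> l lr; have [->|l0] := eqVneq l 0; last first.
      left; have : 0 < ⟦l⟧ by rewrite rnorm_gt0.
      move=> /near_rnorm nl; apply: filterS2 (nl _ l) (near_in _ lr) => y yl yr.
      split; last exact: dif_id.
      apply: dif_mul; first exact: dg.
      apply: dif_inv; first exact: dif_id.
      by apply: contraTneq yl => ->; rewrite sub0r rnormN ltxx.
    right; split; last first.
      by move=> e e0; apply: filterS (near_rnorm 0 e0) => y; rewrite subr0 => /ltW.
    have [|||_ h' _] := @cauchy_estimates_dif R _ g 0 (E x)^-1 1.
    + by rewrite invr_gt0.
    + by move=> y; rewrite subr0; exact: dg.
    + by move=> y; rewrite subr0 => /lx/(ball_swap_lt1 z1)/hF[].
    exists (4 * 1 / (E x)^-1).
    have : 0 < (E x)^-1 by rewrite invr_gt0.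
    move=> /near_rnorm nl; apply: filterS (nl _ (0 : C)) => y; rewrite subr0 => yx.
    have := h' y yx; rewrite add0r g0 subr0 rnormM rnormV.
    have [->|y0] := eqVneq y 0; first by rewrite rnorm0 invr0 !mulr0 => _; rewrite invrK mulr1 mulr_ge0 ?euclid_ge0.
    by rewrite ler_pdivrMr// rnorm_gt0.
  - move=> l al lr; have l0 : 0 < ⟦l⟧ by lra.
    rewrite rnormM rnormV -[a^-1]mul1r; apply: ler_pM; rewrite ?rnorm_ge0 ?invr_ge0 ?rnorm_ge0//.
      by have /lx/(ball_swap_lt1 z1)/hF[] := lr.
    by rewrite lef_pV2 ?posrE// ltW.
  - by rewrite rnorm1.
rewrite leNgt; apply/negP => xu; have u0 : 0 < ⟦u w⟧ by lra.
pose b := (E x + ⟦u w⟧) / 2; have b0 : 0 < b by rewrite divr_gt0// addr_gt0.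
have := main b^-1; rewrite invr_gt0 b0 invrK => /(_ isT).
rewrite ltf_pV2 ?posrE// /b => h.
have := h ltac:(lra); lra.
Qed.

End ShellSchwarz.

(** * The nearest point of the polydisc and the displayed expression *)

Section Distance.
Context {R : realType} {n : nat} (r : R) (z : 'rV[Cplx R]_n).
Local Notation C := (Cplx R).
Local Notation V := 'rV[C]_n.
Local Notation E := (@euclid_norm R n).
Hypotheses (r0 : 0 < r) (margin : forall p : V, ⟦p⟧ <= r -> E p < 1)
  (z1 : E z < 1) (rz : r < ⟦z⟧).
Implicit Types (p v w : V).

Lemma ball_swap_continuous w (A : set V) : E w < 1 -> nbhs (ball_swap z w) A ->
  \forall y \near w, A (ball_swap z y).
Proof. by move=> w1; apply: (differentiable_continuous (ball_swap_dif z1 w1)). Qed.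

Lemma euclid_swap_near w (e : R) : E w < 1 -> 0 < e ->
  \forall y \near w, `|E (ball_swap z y) - E (ball_swap z w)| < e.
Proof.
move=> w1 e0; have h := euclid_continuous (ball_swap z w) e0.
exact: (ball_swap_continuous w1 h).
Qed.

(** A minimum inside the open polydisc is impossible: moving its image under the involution slightly
    towards 0 stays in the image of the polydisc and decreases the norm. *)
Lemma closest_point : exists2 w, ⟦w⟧ = r &
  forall v, ⟦v⟧ <= r -> E (ball_swap z w) <= E (ball_swap z v).
Proof.
have rp := r0; pose K := [set p : V | ⟦p⟧ <= r].
have cK : compact K.
  have := @cball_compact R n 0 r; suff -> : [set v : V | ⟦v - 0⟧ <= r] = K by [].
  by apply/seteqP; split=> p; rewrite /K /= subr0.
have [||w /= wr wmin] := @EVT_compact_min R V (fun p => E (ball_swap z p)) K _ cK.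
- by exists 0; rewrite /K /= rnorm0 ltW.
- move=> p /= pr; apply/(@cvgrPdist_lt R R^o V (nbhs p) _) => e e0.
  have h : \forall y \near p, `|E (ball_swap z p) - E (ball_swap z y)| < e.
    have h' := euclid_swap_near (margin pr) e0.
    by apply: filterS h' => y h'; rewrite distrC; exact: h'.
  exact: h.
exists w => //; apply/eqP; rewrite eq_le wr leNgt; apply/negP => wr'.
have w1 := margin wr; pose x := ball_swap z w.
have x1 : E x < 1 by exact: ball_swap_lt1.
have wx : ball_swap z x = w by exact: ball_swapK.
have xn0 : E x != 0.
  apply/eqP => /euclid_eq0 x0; move: wx; rewrite x0 ball_swap0// => zw.
  by move: rz; rewrite zw ltNge => /negP; apply.
have x0 : 0 < E x by rewrite lt_neqAle eq_sym xn0 euclid_ge0.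
have : \forall y \near x, ⟦ball_swap z y⟧ < r.
  apply: (@ball_swap_continuous x [set y | ⟦y⟧ < r] x1); rewrite wx.
  have : 0 < r - ⟦w⟧ by lra.
  move=> /near_rnorm n1; apply: filterS (n1 _ w) => y yw /=.
  by have := rnorm_dist y w; lra.
move=> /nbhsC[d d0 hd].
pose t : R := Num.min (d / 2) (1 / 2).
have [t0 t1 td] : [/\ 0 < t, t <= 1 / 2 & t <= d / 2].
  by rewrite /t lt_min !ge_min !lexx orbT; split=> //; apply/andP; split; lra.
clearbody t; have t2 : t <= 1 by apply: le_trans t1 _; lra.
pose y := (((1 - t)%:C)%C : C) *: x.
have yx : ⟦y - x⟧ < d.
  rewrite /y rmorphB scalerBl scale1r addrAC subrr add0r rnormN rnormZ rnormC.
  rewrite ger0_norm ?(ltW t0)//; have := rnorm_le_euclid x; have := rnorm_ge0 x.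
  by move: x1 t0 td d0; move: ⟦x⟧ (E x); move=> a b *; nra.
have yE : E y = (1 - t) * E x by rewrite euclidZ rnormC ger0_norm// subr_ge0.
have y1 : E y < 1 by apply: le_lt_trans x1; rewrite yE ler_piMl ?euclid_ge0// gerBl ltW.
have := wmin _ (ltW (hd _ yx)); rewrite ball_swapK// yE -/x.
by rewrite -[leLHS]mul1r ler_pM2r// lerBrDr gerDl leNgt t0.
Qed.

Definition distance_bound w := Num.sqrt (1 - (1 - E w ^+ 2) * (1 - E z ^+ 2) /
  (1 - \sum_(i < n) modulus (z 0 i * w 0 i)) ^+ 2).

Lemma aligned_point w : exists w', [/\ ⟦w'⟧ = ⟦w⟧, E w' = E w &
  hdot w' z = ((\sum_(i < n) ⟦z 0 i * w 0 i⟧)%:C)%C].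
Proof.
(* Each coordinate of [w] receives the argument of that of [z]; where z_i = 0 it is kept, as the
   product is 0 in any case. *)
pose w' : V := \row_i if z 0 i == 0 then w 0 i else
  (⟦w 0 i⟧%:C)%C * (z 0 i / (⟦z 0 i⟧%:C)%C).
have wi i : ⟦w' 0 i⟧ = ⟦w 0 i⟧.
  rewrite mxE; case: ifPn => // zi.
  rewrite !rnormM rnormV !rnormC !ger0_norm ?rnorm_ge0// divff ?mulr1//.
  by rewrite rnorm_eq0.
exists w'; split.
- apply/eqP; rewrite eq_le; apply/andP; split.
    by apply: rnorm_row_le; rewrite ?rnorm_ge0// => i; rewrite wi rnorm_coord.
  by apply: rnorm_row_le; rewrite ?rnorm_ge0// => i; rewrite -wi rnorm_coord.
- apply/eqP; rewrite -(@eqrXn2 _ 2) ?euclid_ge0// !euclid_sqr; apply/eqP.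
  by apply: eq_bigr => i _; rewrite wi.
- rewrite (big_morph (real_complex R) (id1 := 0) (op1 := +%R))//; last first.
    by move=> a b; rewrite rmorphD.
  apply: eq_bigr => i _; rewrite mxE; case: eqP => [->|/eqP zi].
    by rewrite conjC0 mulr0 mul0r rnorm0.
  have nz : (⟦z 0 i⟧%:C)%C != 0 :> C by rewrite -rnorm_gt0 rnormC normr_gt0 rnorm_eq0.
  have zz : z 0 i * (z 0 i)^* = (⟦z 0 i⟧%:C)%C ^+ 2 :> C by rewrite -normCK -rnormE.
  rewrite rnormM rmorphM -!mulrA [_^-1 * _]mulrC !mulrA -[_ * z 0 i * _]mulrA zz.
  by field.
Qed.

(** By [ball_swap_norm] the norm depends on <w, z> only through |1 - <w, z>|, which is at least 1 -
    sum |z_i w_i|, with equality at the aligned point. *)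
Lemma distance_boundE w : ⟦w⟧ <= r -> exists w', [/\ ⟦w'⟧ = ⟦w⟧,
  distance_bound w = E (ball_swap z w') & distance_bound w <= E (ball_swap z w)].
Proof.
move=> wr; have w1 := margin wr; have [w' [h1 h2 h3]] := aligned_point w.
exists w'; pose S := \sum_(i < n) ⟦z 0 i * w 0 i⟧.
have S1 : S < 1.
  have := hdot_lt1 z1 (w := w'); rewrite h2 h3 rnormC => /(_ w1).
  by apply: le_lt_trans; exact: ler_norm.
have SE : distance_bound w = Num.sqrt (1 - (1 - E w ^+ 2) * (1 - E z ^+ 2) / (1 - S) ^+ 2) by [].
have E1 : distance_bound w = E (ball_swap z w').
  rewrite SE -[RHS]ger0_norm ?euclid_ge0// -sqrtr_sqr ball_swap_norm ?h2// h3.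
  congr Num.sqrt; congr (1 - _ / _).
  rewrite (_ : 1 - ((\sum_(i < n) ⟦z 0 i * w 0 i⟧)%:C)%C = ((1 - S)%:C)%C); last by rewrite rmorphB.
  by rewrite rnormC ger0_norm// ltW// subr_gt0.
split=> //.
rewrite SE -[leRHS]ger0_norm ?euclid_ge0// -sqrtr_sqr ball_swap_norm//.
apply: ler_wsqrtr; rewrite lerD2l lerN2; apply: ler_wpM2l.
  by rewrite mulr_ge0// subr_ge0 ltW// -euclid_lt1.
have hS : 1 - S <= ⟦1 - hdot w z⟧.
  have := rnorm_dist (1 : C) (hdot w z); rewrite rnorm1.
  have : ⟦hdot w z⟧ <= S.
    apply: le_trans (hdot_le_sum w z) _; apply: ler_sum => i _.
    by rewrite rnormM mulrC.
  lra.
rewrite lef_pV2 ?posrE ?exprn_gt0//; [|lra..].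
by rewrite ler_pXn2r ?nnegrE//; lra.
Qed.

Lemma distance_bound_min w : ⟦w⟧ = r ->
  (forall v, ⟦v⟧ <= r -> E (ball_swap z w) <= E (ball_swap z v)) ->
  is_min [set distance_bound v | v in [set p : V | ⟦p⟧ = r]] (E (ball_swap z w)).
Proof.
move=> wr wmin; split.
  have wr' : ⟦w⟧ <= r by rewrite wr.
  have [w' [w'r h1 h2]] := distance_boundE wr'.
  exists w; first exact: wr.
  apply: le_anti; apply/andP; split; first exact: h2.
  by rewrite h1; apply: wmin; rewrite w'r.
move=> _ [v /= vr <-]; have vr' : ⟦v⟧ <= r by rewrite vr.
have [v' [v'r h1 _]] := distance_boundE vr'.
by rewrite h1; apply: wmin; rewrite v'r.
Qed.

End Distance.

(** * The squeezing function *)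

Lemma sup_max {R : realType} (A : set R) (m : R) : A m -> ubound A m -> sup A = m.
Proof.
move=> Am ubm; apply/eqP; rewrite eq_le; apply/andP; split.
  by apply: ge_sup => //; exists m.
by apply: ub_le_sup => //; exists m.
Qed.

Section Squeezing.
Context {R : realType} {n : nat} (r s : R) (z w : 'rV[Cplx R]_n).
Local Notation C := (Cplx R).
Local Notation V := 'rV[C]_n.
Local Notation E := (@euclid_norm R n).
Local Notation D := (@shell R n r).
Hypotheses (n2 : (1 < n)%N) (r0 : 0 < r) (s0 : 0 < s)
  (margin : forall p : V, ⟦p⟧ < r + s + s + s -> E p < 1) (Dz : D z).
Hypotheses (wr : ⟦w⟧ = r)
  (wmin : forall v, ⟦v⟧ <= r -> E (ball_swap z w) <= E (ball_swap z v)).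
Implicit Types (p v : V).

Lemma shell_open p : D p -> exists2 d : R, 0 < d & forall y, ⟦y - p⟧ < d -> D y.
Proof.
move=> [p1 rp].
have h1 : \forall y \near p, E y < 1.
  have p0 : 0 < 1 - E p by rewrite subr_gt0.
  by apply: filterS (euclid_continuous p p0) => y; rewrite ltr_norml => /andP[_]; lra.
have h2 : \forall y \near p, r < ⟦y⟧.
  have : 0 < ⟦p⟧ - r by lra.
  move=> /near_rnorm n1; apply: filterS (n1 _ p) => y yp.
  by have := rnorm_dist p y; rewrite rdistC; lra.
have /nbhsC[d d0 hd] : \forall y \near p, E y < 1 /\ r < ⟦y⟧ by exact: filterI.
by exists d.
Qed.

Lemma closed_euclid_le (a : R) : closed [set y : V | E y <= a].
Proof.
have cE : continuous (E : V -> R).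
  move=> x; apply/(@cvgrPdist_lt R R^o V (nbhs x) _) => e e0.
  have h : \forall y \near x, `|E x - E y| < e.
    by have h' := euclid_continuous x e0; apply: filterS h' => y h'; rewrite distrC; exact: h'.
  exact: h.
rewrite (_ : [set _ | _] = E @^-1` [set x | x <= a])//.
by apply: closed_comp => [x _|]; [exact: cE|exact: closed_le].
Qed.

Lemma compact_euclid_le (a : R) : compact [set y : V | E y <= a].
Proof.
apply: (@subclosed_compact _ _ [set y : V | ⟦y - 0⟧ <= a]).
- exact: closed_euclid_le.
- exact: cball_compact.
- by move=> y /=; rewrite subr0; apply: le_trans; exact: rnorm_le_euclid.
Qed.

(** Dilate [p] outwards; the margin keeps the dilated point in the ball. *)
Lemma shell_boundary p (A : set V) : ⟦p⟧ = r -> nbhs p A -> exists2 q, D q & A q.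
Proof.
move=> pr /nbhsC[d d0 hd]; have rp := r0; have sp := s0.
pose e : R := Num.min (d / 2) s / r.
have [e0 er es] : [/\ 0 < e, e * r < d & e * r <= s].
  have h : 0 < Num.min (d / 2) s by rewrite lt_min s0 andbT; lra.
  rewrite /e divfK ?gt_eqF// divr_gt0//; split=> //; last by rewrite ge_min lexx orbT.
  by apply: le_lt_trans (_ : d / 2 < _); [rewrite ge_min lexx|lra].
clearbody e; exists (((1 + e)%:C)%C *: p).
  have qn : ⟦((1 + e)%:C)%C *: p⟧ = r + e * r by rewrite rnormZ rnormC ger0_norm ?pr; lra.
  split; last by rewrite qn ltrDl mulr_gt0.
  by apply: margin; rewrite qn; lra.
apply: hd; rewrite rmorphD scalerDl scale1r addrAC subrr add0r rnormZ rnormC.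
by rewrite ger0_norm ?(ltW e0)// pr.
Qed.

Lemma swap_gt0 : 0 < E (ball_swap z w).
Proof.
have [z1 rz] := Dz.
rewrite lt_neqAle eq_sym euclid_ge0 andbT; apply/eqP => /euclid_eq0 x0.
have w1 : E w < 1 by apply: margin; rewrite wr; have := s0; lra.
have := ball_swapK z1 w1; rewrite x0 ball_swap0// => zw.
by move: rz; rewrite zw wr ltxx.
Qed.

Lemma swap_lt1 : E (ball_swap z w) < 1.
Proof. by apply: ball_swap_lt1; [case: Dz|apply: margin; rewrite wr; have := s0; lra]. Qed.

Lemma swap_shell y : E y < E (ball_swap z w) -> D (ball_swap z y).
Proof.
have [z1 rz] := Dz; move=> yw; have y1 := lt_trans yw swap_lt1.
split; first exact: ball_swap_lt1.
rewrite ltNge; apply/negP => /wmin; rewrite ball_swapK// => h.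
by move: yw; rewrite ltNge h.
Qed.

(** Reduction to scalar functions: apply Schwarz's lemma to <f p, f q>/|f q|, whose value at [q] is
    |f q|. *)
Lemma shell_schwarz_ball (f : V -> V) q :
  (forall p, D p -> differentiable f p /\ E (f p) <= 1) -> f z = 0 -> D q ->
  E (f q) <= E (ball_swap z q).
Proof.
move=> hf fz Dq; have [z1 rz] := Dz; have [q1 rq] := Dq.
have [->|a0] := eqVneq (E (f q)) 0; first exact: euclid_ge0.
have n0 : ((E (f q))%:C)%C != 0 :> C by rewrite -rnorm_gt0 rnormC normr_gt0.
pose u p := hdot (f p) (f q) * ((E (f q))%:C)%C^-1.
have uq : u q = ((E (f q))%:C)%C by rewrite /u hdotvv rmorphXn expr2 mulfK.
have := @shell_schwarz R n r s n2 r0 s0 margin u z q z1 rz _ _ q1 rq.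
rewrite uq rnormC ger0_norm ?euclid_ge0//; apply.
  move=> p p1 rp; have [dp fp] := hf p (conj p1 rp); split.
    by apply: dif_mul; [exact: hdot_dif|exact: dif_cst].
  rewrite rnormM rnormV rnormC ger0_norm ?euclid_ge0//.
  rewrite ler_pdivrMr ?lt_neqAle 1?eq_sym ?a0 ?euclid_ge0//.
  by apply: le_trans (hdot_le _ _) _; rewrite ler_wpM2r ?euclid_ge0.
by rewrite /u fz hdot0l mul0r.
Qed.

Lemma ball_swap_holomorphic : holomorphic_maps D unit_ball (ball_swap z).
Proof.
have [z1 rz] := Dz; split=> [p [p1 _]|_ [p [p1 _] <-]].
  exact: ball_swap_dif.
exact: ball_swap_lt1.
Qed.

Lemma squeezing_shell : squeezing D z = E (ball_swap z w).
Proof.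
have [z1 rz] := Dz; apply: sup_max.
  split; first exact: swap_gt0.
  exists (ball_swap z); split.
  - exact: ball_swap_holomorphic.
  - move=> p q /set_mem[p1 _] /set_mem[q1 _] pq.
    by rewrite -(ball_swapK z1 p1) pq ball_swapK.
  - exact: ball_swap_center.
  - move=> y /= yw; exists (ball_swap z y); first exact: swap_shell.
    by rewrite ball_swapK// (lt_trans yw swap_lt1).
move=> t /= [t0 [f [[df fD] finj fz tf]]]; rewrite leNgt; apply/negP => wt.
have hf p : D p -> differentiable f p /\ E (f p) <= 1.
  move=> Dp; split; first exact: df.
  by apply: ltW; apply: fD; exists p.
pose g y := xget 0 [set x | D x /\ f x = y].
have gf p : D p -> g (f p) = p.
  move=> Dp; rewrite /g; case: xgetP => [x _ [Dx fx]|/(_ p)]; last by case.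
  by apply: finj; rewrite ?inE.
(* A radius strictly in between, so that a closed, hence compact, ball is covered. *)
have [t' [t1 t2]] : exists t' : R, E (ball_swap z w) < t' /\ t' < t.
  by exists ((E (ball_swap z w) + t) / 2); split; lra.
have onto y : E y <= t' -> exists2 x, D x & f x = y.
  by move=> yt; apply: tf; exact: le_lt_trans yt t2.
(* The preimage is compact because the inverse of an injective holomorphic map is continuous; thus
   it is closed in the whole space and not only in the shell. *)
have cl : closed (g @` [set y | E y <= t']).
  apply: compact_image_closed; first exact: compact_euclid_le.
  move=> y /onto[x Dx <-]; have [d d0 dD] := shell_open Dx.
  by apply: (inverse_continuous d0) => p /dD Dp; [exact: df|exact: gf].
have w1 : E w < 1 by apply: margin; rewrite wr; have := s0; lra.
(* Points of the shell close to [w] have |f| < t' by Schwarz's lemma, so the boundary point [w] is a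
   limit of the preimage. *)
have : closure (g @` [set y | E y <= t']) w.
  move=> A nA.
  have e0 : 0 < t' - E (ball_swap z w) by rewrite subr_gt0.
  have h1 := euclid_swap_near z1 w1 e0.
  have [q Dq [Aq hq]] := shell_boundary wr (filterI nA h1).
  exists q; split=> //; exists (f q); last exact: gf.
  apply: le_trans (shell_schwarz_ball hf fz Dq) _.
  by move: hq => /=; rewrite ltr_norml ltrD2r => /andP[_]; exact: ltW.
rewrite -(closure_id _).1// => -[y /onto[x [x1 rx] <-]].
by rewrite gf// => xw; move: rx; rewrite xw wr ltxx.
Qed.

End Squeezing.

(** * The Fridman invariant *)

Section Atanh.
Context {R : realType}.
Implicit Types x y : R.

Lemma tanh_lt x y : x < y -> tanh x < tanh y.
Proof.
move=> xy; rewrite /tanh.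
have h1 : expR x < expR y by rewrite ltr_expR.
have h2 : expR (- y) < expR (- x) by rewrite ltr_expR ltrN2.
have := expR_gt0 x; have := expR_gt0 (- y); move: h1 h2.
move: (expR x) (expR y) (expR (- x)) (expR (- y)) => a b a' b' ab ba b'0 a0.
rewrite ltr_pdivrMr; last by lra.
rewrite mulrAC ltr_pdivlMr; last by lra.
nra.
Qed.

Lemma tanh0 : tanh 0 = 0 :> R.
Proof. by rewrite /tanh oppr0 subrr mul0r. Qed.

Lemma atanh_lt x y : 0 <= x -> x < 1 -> x < tanh y -> atanh x < y.
Proof.
move=> x0 x1 xy; rewrite ltNge; apply/negP; rewrite le_eqVlt => /predU1P[yx|/tanh_lt].
  by move: xy; rewrite yx atanhK ?ltxx//; lra.
by rewrite atanhK; lra.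
Qed.

Lemma atanh_le x y : 0 <= x -> x <= y -> y < 1 -> atanh x <= atanh y.
Proof.
move=> x0; rewrite le_eqVlt => /predU1P[->//|xy] y1; apply/ltW/atanh_lt => //; first by lra.
by rewrite atanhK//; lra.
Qed.

Lemma atanh_gt0 x : 0 < x -> x < 1 -> 0 < atanh x.
Proof.
move=> x0 x1; rewrite ltNge; apply/negP; rewrite le_eqVlt => /predU1P[h|/tanh_lt].
  by have := @atanhK R x; rewrite h tanh0; lra.
by rewrite atanhK ?tanh0; lra.
Qed.

End Atanh.

Section PickVariation.
Context {R : realType} {n : nat}.
Local Notation C := (Cplx R).
Local Notation V := 'rV[C]_n.
Local Notation E := (@euclid_norm R n).

(** The Cayley transform maps the right half-plane into the unit disc. *)
Lemma cayley_le (H : C) (a : R) : 0 <= a -> 0 <= complex.Re H ->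
  ⟦H - (a%:C)%C⟧ <= ⟦H + (a%:C)%C⟧.
Proof.
move=> a0 H0; rewrite -(@ler_pXn2r _ 2) ?nnegrE ?rnorm_ge0// !rnorm_sqr.
by case: H H0 => x y /= x0; nra.
Qed.

(* With [a = G 0] and [H = 1 - <G, a>], of positive real part, [|G - a|^2 <= 2 Re H]; the
   Cayley transform of [H] shows that [|H| <= 3 H(0)] on the smaller disc. *)
Lemma pick_variation (G : C -> V) (d : R) l0 : 0 < d ->
  (forall l, ⟦l⟧ < d -> differentiable G l /\ E (G l) < 1) -> ⟦l0⟧ <= d / 8 ->
  E (G l0 - G 0) ^+ 2 <= 6 * (1 - E (G 0) ^+ 2).
Proof.
move=> d0 hG l0d; pose a := G 0.
have [_ a1] := hG 0 (eq_ind_r (fun x => x < d) d0 (rnorm0 _)).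
have A1 : E a ^+ 2 < 1 by rewrite -euclid_lt1.
pose H l : C := 1 - hdot (G l) a; pose b : R := 1 - E a ^+ 2.
have b0 : 0 < b by rewrite subr_gt0.
have H0 : H 0 = (b%:C)%C by rewrite /H hdotvv rmorphB.
have ReH l : ⟦l⟧ < d -> 0 <= complex.Re (H l).
  move=> /hG[_ g1]; have h1 : ⟦hdot (G l) a⟧ < 1.
    apply: le_lt_trans (hdot_le _ _) _; apply: le_lt_trans (_ : 1 * E a < 1).
      by rewrite ler_wpM2r ?euclid_ge0// ltW.
    by rewrite mul1r.
  have := Re_rnorm (hdot (G l) a); have := ler_norm (complex.Re (hdot (G l) a)).
  by rewrite /H; move: h1; case: (hdot _ _) => x y /=; rewrite subr_ge0; lra.
have Hb l : ⟦l⟧ < d -> H l + (b%:C)%C != 0.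
  move=> /ReH; case: (H l) => x y /= x0; rewrite eq_complex /= negb_and.
  by rewrite gt_eqF// ltr_wpDl.
pose Q l := (H l - (b%:C)%C) / (H l + (b%:C)%C).
have dH l : ⟦l⟧ < d -> differentiable H l.
  by move=> /hG[dG _]; apply: dif_sub; [exact: dif_cst|exact: hdot_dif].
have [||_ hQ _] := @cauchy_estimates_dif R _ Q 0 d 1 d0.
- move=> l; rewrite subr0 => ld; apply: dif_mul.
    by apply: dif_sub; [exact: dH|exact: dif_cst].
  by apply: dif_inv; [apply: dif_add; [exact: dH|exact: dif_cst]|exact: Hb].
- move=> l; rewrite subr0 => ld; rewrite rnormM rnormV ler_pdivrMr ?rnorm_gt0 ?Hb//.
  by rewrite mul1r; apply: cayley_le; [exact: ltW|exact: ReH].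
have ld : ⟦l0⟧ < d by lra.
have Q0 : Q 0 = 0 by rewrite /Q H0 subrr mul0r.
(* The Lipschitz constant 4/d times d/8. Then |H - b| <= |H + b|/2 yields |H| <= 3b. *)
have hQ' : ⟦Q l0⟧ <= 1 / 2.
  have := hQ l0 ld; rewrite add0r Q0 subr0 => h; apply: le_trans h _.
  by rewrite mulrAC ler_pdivrMr//; lra.
have hH : ⟦H l0⟧ <= 3 * b.
  move: hQ'; rewrite rnormM rnormV ler_pdivrMr ?rnorm_gt0 ?Hb// => h.
  have h1 := rnorm_dist (H l0) (b%:C)%C; have h2 := rnormD (H l0) (b%:C)%C.
  have hb : ⟦(b%:C)%C : C⟧ = b by rewrite rnormC ger0_norm// ltW.
  by rewrite hb in h1 h2; lra.
have := euclid_sqrB 1 1 (G l0) a; rewrite !scale1r rnorm1 expr1n !mul1r => ->.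
have -> : complex.Re ((1 : C)^* * 1 * hdot a (G l0)) = complex.Re (hdot (G l0) a).
  rewrite conjC1 !mul1r /hdot !(big_morph (@complex.Re R) (id1 := 0) (op1 := +%R))//.
  - by apply: eq_bigr => i _; case: (a 0 i) (G l0 0 i) => [x y] [x' y'] /=; ring.
  - by move=> [? ?] [? ?].
  - by move=> [? ?] [? ?].
have := Re_rnorm (H l0); have := ler_norm (complex.Re (H l0)).
have -> : complex.Re (H l0) = 1 - complex.Re (hdot (G l0) a) by rewrite /H; case: (hdot _ _).
have [_ g1] := hG _ ld; have : E (G l0) ^+ 2 <= 1 by rewrite expr_le1// ?euclid_ge0// ltW.
by move: hH; rewrite /b; lra.
Qed.

End PickVariation.

Section Fridman.
Context {R : realType} {n : nat} (r s : R) (z w : 'rV[Cplx R]_n).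
Local Notation C := (Cplx R).
Local Notation V := 'rV[C]_n.
Local Notation E := (@euclid_norm R n).
Local Notation D := (@shell R n r).
Hypotheses (n2 : (1 < n)%N) (r0 : 0 < r) (s0 : 0 < s)
  (margin : forall p : V, ⟦p⟧ < r + s + s + s -> E p < 1) (Dz : D z).
Hypotheses (wr : ⟦w⟧ = r)
  (wmin : forall v, ⟦v⟧ <= r -> E (ball_swap z w) <= E (ball_swap z v)).
Implicit Types (p v : V).

Lemma polydisc_ball p : ⟦p⟧ <= r -> E p < 1.
Proof. by move=> pr; apply: margin; have := s0; lra. Qed.

Lemma caratheodory_swap_le q : D q -> (caratheodory D z q <= (atanh (E (ball_swap z q)))%:E)%E.
Proof.
move=> Dq; have [z1 rz] := Dz; have [q1 rq] := Dq.
apply: ge_ereal_sup => _ [u [[du uD] uz] <-]; rewrite lee_fin; apply: atanh_le.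
- by rewrite -rnorm_modulus; exact: rnorm_ge0.
- rewrite -rnorm_modulus; apply: (@shell_schwarz R n r s n2 r0 s0 margin u) => // p p1 rp.
  have Dp : D p by [].
  split; first exact: du.
  by apply: ltW; rewrite rnorm_modulus; apply: uD; exists p.
- exact: ball_swap_lt1.
Qed.

(** The competitor is the component of the involution in the direction of its value at [q]. *)
Lemma caratheodory_swap_ge q : D q -> ((atanh (E (ball_swap z q)))%:E <= caratheodory D z q)%E.
Proof.
move=> Dq; have [z1 rz] := Dz; have [q1 rq] := Dq.
pose a := ball_swap z q.
have a1 : E a < 1 by exact: ball_swap_lt1.
pose u p : C := hdot (ball_swap z p) a * ((E a)%:C)%C^-1.
have uz : u z = 0 by rewrite /u ball_swap_center// hdot0l mul0r.
have uq : ⟦u q⟧ = E a.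
  rewrite /u -/a hdotvv rnormM rnormV !rnormC !ger0_norm ?sqr_ge0 ?euclid_ge0//.
  have [->|a0] := eqVneq (E a) 0; first by rewrite invr0 mulr0.
  by rewrite expr2 mulfK.
have -> : E (ball_swap z q) = modulus (u q) by rewrite -rnorm_modulus uq.
apply: ereal_sup_ubound; exists u; last by [].
split; last exact: uz.
split.
  move=> p [p1 _]; apply: dif_mul; last exact: dif_cst.
  by apply: hdot_dif; exact: ball_swap_dif.
move=> _ [p [p1 _] <-]; rewrite /unit_disk /= -rnorm_modulus.
have b1 := ball_swap_lt1 z1 p1.
rewrite /u rnormM rnormV rnormC ger0_norm ?euclid_ge0//.
have [->|a0] := eqVneq (E a) 0; first by rewrite invr0 mulr0.
have a0' : 0 < E a by rewrite lt_neqAle eq_sym a0 euclid_ge0.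
rewrite ltr_pdivrMr// mul1r; apply: le_lt_trans (hdot_le _ _) _.
by rewrite -[ltRHS]mul1r ltr_pM2r.
Qed.

(** With m the minimum, x -> ball_swap z (m x) maps the ball onto the set where the involution has
    norm below m. By minimality this set avoids the polydisc, and it contains the Caratheodory ball
    by [caratheodory_swap_ge]. *)
Lemma fridman_attained : 0 < atanh (E (ball_swap z w)) /\
  exists f : V -> V, [/\ holomorphic_maps unit_ball D f, set_inj unit_ball f &
    caratheodory_ball D z (atanh (E (ball_swap z w))) `<=` f @` unit_ball].
Proof.
have [z1 rz] := Dz; have m1 := swap_lt1 s0 margin Dz wr.
have m0 := swap_gt0 s0 margin Dz wr.
split; first exact: atanh_gt0.
pose m : C := ((E (ball_swap z w))%:C)%C.
have mn : ⟦m⟧ = E (ball_swap z w) by rewrite /m rnormC ger0_norm ?euclid_ge0.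
have mz : m != 0 by rewrite -rnorm_gt0 mn.
have inner x : E x < 1 -> E (m *: x) < E (ball_swap z w).
  by move=> x1; rewrite euclidZ mn -[ltRHS]mulr1 ltr_pM2l.
have inner1 x : E x < 1 -> E (m *: x) < 1 by move=> /inner h; exact: lt_trans h m1.
exists (fun x => ball_swap z (m *: x)); split.
- split=> [x x1|_ [x x1 <-]].
    apply: (@differentiable_comp _ _ _ _ (fun x : V => m *: x) (ball_swap z)).
      apply: dif_row => i; under eq_fun do rewrite mxE.
      by apply: dif_mul; [exact: dif_cst|exact: coord_differentiable].
    by apply: ball_swap_dif => //; exact: inner1.
  by apply: (swap_shell s0 margin Dz wr wmin); exact: inner.
- move=> x y /set_mem x1 /set_mem y1 xy.
  have h1 := ball_swapK z1 (inner1 x x1); have h2 := ball_swapK z1 (inner1 y y1).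
  have h := etrans (esym h1) (etrans (congr1 (ball_swap z) xy) h2).
  by rewrite -[x](scalerK mz) h scalerK.
- move=> q [Dq qm]; have [q1 rq] := Dq.
  have qlt : E (ball_swap z q) < E (ball_swap z w).
    rewrite ltNge; apply/negP => h; move: qm; rewrite ltNge => /negP; apply.
    apply: le_trans (caratheodory_swap_ge Dq); rewrite lee_fin.
    apply: (atanh_le (euclid_ge0 _) h); exact: ball_swap_lt1.
  exists (m^-1 *: ball_swap z q); last by rewrite scalerA divff// scale1r ball_swapK.
  suff : E (m^-1 *: ball_swap z q) < 1 by [].
  by rewrite euclidZ rnormV mn mulrC ltr_pdivrMr// mul1r.
Qed.

End Fridman.

(** * Discs along a face of the polydisc *)

Section FaceEscape.
Context {R : realType} {n : nat}.
Local Notation C := (Cplx R).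
Local Notation V := 'rV[C]_n.
Local Notation E := (@euclid_norm R n).
Implicit Types (p q : V).

Lemma rowB p q k : (p - q) 0 k = p 0 k - q 0 k.
Proof. by rewrite !mxE. Qed.

Lemma two_coord_dist p (i j : 'I_n) (c l : C) (d : R) : ⟦c - p 0 i⟧ < d -> ⟦l⟧ < d ->
  i != j -> ⟦setc (setc p i c) j (p 0 j + l) - p⟧ < d.
Proof.
move=> cd ld ij; apply: le_lt_trans (_ : Num.max ⟦c - p 0 i⟧ ⟦l⟧ < d); last by rewrite gt_max cd.
apply: rnorm_row_le => [|k]; first by rewrite le_max rnorm_ge0.
rewrite rowB !setcE le_max.
have [->|kj] := eqVneq k j; first by rewrite addrAC subrr add0r lexx orbT.
have [->|ki] := eqVneq k i; first by rewrite lexx.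
by rewrite subrr rnorm0 rnorm_ge0.
Qed.

(* Along the face the discs in the direction of the [j]-th coordinate are squeezed to
   points by the Schwarz-Pick lemma, so [g] does not depend on that coordinate on an arc
   of the boundary, hence nowhere. *)
Lemma no_face_escape (g : V -> V) (p : V) (i j : 'I_n) (r d : R) :
  0 < r -> 0 < d -> i != j -> ⟦p 0 i⟧ = r ->
  (forall q, ⟦q - p⟧ < d -> r < ⟦q 0 i⟧ -> differentiable g q /\ E (g q) < 1) ->
  (forall q q', ⟦q - p⟧ < d -> r < ⟦q 0 i⟧ -> ⟦q' - p⟧ < d -> r < ⟦q' 0 i⟧ ->
     g q = g q' -> q = q') ->
  (forall q, ⟦q - p⟧ < d -> ⟦q 0 i⟧ <= r -> forall e : R, 0 < e ->
     \forall q' \near q, r < ⟦(q' : V) 0 i⟧ -> 1 - e < E (g q')) -> False.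
Proof.
move=> r0 d0 ij pr hg ginj esc.
pose pt c l : V := setc (setc p i c) j (p 0 j + l).
have pti c l : pt c l 0 i = c by rewrite /pt !setcE eqxx (negbTE ij).
have ptj c l : pt c l 0 j = p 0 j + l by rewrite /pt setcE eqxx.
have ptd (c l : C) : ⟦c - p 0 i⟧ < d -> ⟦l⟧ < d -> ⟦pt c l - p⟧ < d.
  by move=> h1 h2; exact: two_coord_dist.
pose l0 : C := ((d / 8)%:C)%C.
have d8 : 0 < d / 8 by rewrite divr_gt0.
have l0n : ⟦l0⟧ = d / 8 by rewrite rnormC ger0_norm// ltW.
have l0d : ⟦l0⟧ < d by rewrite l0n; lra.
have z0d : ⟦0 : C⟧ < d by rewrite rnorm0.
have var c : ⟦c - p 0 i⟧ < d -> r < ⟦c⟧ ->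
    E (g (pt c l0) - g (pt c 0)) ^+ 2 <= 6 * (1 - E (g (pt c 0)) ^+ 2).
  move=> cd rc; apply: (@pick_variation R n (fun l => g (pt c l)) d l0 d0); last by rewrite l0n.
  move=> l ld; have [||h1 h2] := hg (pt c l); [exact: ptd|by rewrite pti|].
  split; last exact: h2.
  apply: (@differentiable_comp _ _ _ _ (fun l => pt c l) g _ _ h1).
  apply: (@differentiable_comp _ _ _ _ (fun l : C => p 0 j + l) (fun y => setc (setc p i c) j y)).
    by apply: dif_add; [exact: dif_cst|exact: dif_id].
  exact: setc_dif_r.
(* Extended by 0 to |c| <= r. The function tends to 0 on approaching this set, so [arc_vanish] can
   be applied on a disc straddling the circle |c| = r. *)
pose h k c : C := if r < ⟦c⟧ then g (pt c l0) 0 k - g (pt c 0) 0 k else 0.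
have hE k c : r < ⟦c⟧ -> h k c = g (pt c l0) 0 k - g (pt c 0) 0 k by rewrite /h => ->.
have h0 k c : ⟦c⟧ <= r -> h k c = 0 by rewrite /h leNgt => /negbTE ->.
have ptc l c : differentiable (fun y : C => pt y l) c.
  apply: (@differentiable_comp _ _ _ _ (fun y : C => setc p i y) (fun q => setc q j (p 0 j + l))).
    exact: setc_dif_r.
  exact: setc_dif_l.
have hdif k c : ⟦c - p 0 i⟧ < d -> r < ⟦c⟧ -> \forall y \near c, differentiable (h k) y.
  move=> cd rc; have dg y l : ⟦y - p 0 i⟧ < d -> r < ⟦y⟧ -> ⟦l⟧ < d ->
      differentiable (fun y : C => g (pt y l) 0 k) y.
    move=> yd ry ld; have [||dgy _] := hg (pt y l); [exact: ptd|by rewrite pti|].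
    apply: (@dif_coord R _ n (fun y : C => g (pt y l)) y k).
    exact: (@differentiable_comp _ _ _ _ (fun y : C => pt y l) g _ (ptc l y) dgy).
  have nd := near_ball cd.
  have : 0 < ⟦c⟧ - r by rewrite subr_gt0.
  move=> /near_rnorm n1; have nr : \forall y \near c, r < ⟦y⟧.
    by apply: filterS (n1 _ c) => y yc; have := rnorm_dist c y; rewrite rdistC; lra.
  have nn := near_join nr.
  apply: filterS2 nd nn => y yd ny; have ry := nbhs_singleton ny.
  apply: (@near_eq_dif _ _ _ (fun y : C => g (pt y l0) 0 k - g (pt y 0) 0 k)).
    by apply: filterS ny => y' ry'; rewrite hE.
  by apply: dif_sub; apply: dg.
have hsmall k c : ⟦c - p 0 i⟧ < d -> ⟦c⟧ <= r ->
    forall e : R, 0 < e -> \forall y \near c, ⟦h k y⟧ <= e.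
  move=> cd cr e e0.
  (* If |g| > 1 - t, then 6 (1 - |g|^2) <= 12 t. *)
  have [t [t0 t1 te]] : exists t : R, [/\ 0 < t, t <= 1 & 12 * t <= e ^+ 2].
    exists (Num.min 1 (e ^+ 2 / 12)); have e2 : 0 < e ^+ 2 / 12 by rewrite divr_gt0// exprn_gt0.
    split; first by rewrite lt_min ltr01.
      by rewrite ge_min lexx.
    by rewrite mulrC -ler_pdivlMr// ge_min lexx orbT.
  have H : \forall q \near pt c 0, r < ⟦(q : V) 0 i⟧ -> 1 - t < E (g q).
    by apply: esc => //; [exact: ptd|rewrite pti].
  have H' : \forall y \near c, r < ⟦y⟧ -> 1 - t < E (g (pt y 0)).
    have H2 : \forall y \near c, r < ⟦pt y 0 0 i⟧ -> 1 - t < E (g (pt y 0)).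
      exact: (differentiable_continuous (ptc 0 c) H).
    apply: filterS H2 => y hy ry.
    by apply: hy; rewrite pti.
  apply: filterS2 (near_ball cd) H' => y yd hy.
  have [ry|yr] := ltP r ⟦y⟧; last by rewrite h0// rnorm0 ltW.
  rewrite hE//; have := var y yd ry; have := hy ry.
  have [||_ a1] := hg (pt y 0); [exact: ptd|by rewrite pti|].
  move: a1; have := rnorm_coord (g (pt y l0) - g (pt y 0)) k.
  have := rnorm_le_euclid (g (pt y l0) - g (pt y 0)).
  have := euclid_ge0 (g (pt y l0) - g (pt y 0)); rewrite rowB.
  move: (E (_ - _)) (E (g (pt y 0))) ⟦_ - _⟧ ⟦_ - _⟧ => A a B b A0 BA bB a1 ta Aa.
  apply: le_trans bB _; apply: le_trans BA _.
  rewrite -(@ler_pXn2r _ 2) ?nnegrE ?(ltW e0)//; apply: le_trans Aa (le_trans _ te).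
  move: t0 t1 ta a1; clear; nra.
pose e : R := Num.min (d / (4 * r)) (1 / 2).
have [e0 e1 ed] : [/\ 0 < e, e < 1 & 3 * (e * r) < d].
  have h1 : 0 < d / (4 * r) by rewrite divr_gt0// mulr_gt0.
  split; first by rewrite lt_min h1; lra.
    by apply: le_lt_trans (_ : 1 / 2 < _); [rewrite ge_min lexx orbT|lra].
  apply: le_lt_trans (_ : 3 * (d / (4 * r) * r) < _).
    by rewrite ler_pM2l// ler_pM2r// ge_min lexx.
  rewrite (_ : d / (4 * r) * r = d / 4); first by lra.
  by field; rewrite gt_eqF.
clearbody e.
(* On the ray through p_i, [c0] lies outside the circle of radius r and [c1] inside. The disc about
   [c0] through [c1] has radius 2 e r and stays within 3 e r < d of p_i. *)
pose c0 : C := ((1 + e)%:C)%C * p 0 i; pose c1 : C := ((1 - e)%:C)%C * p 0 i.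
have c0n : ⟦c0⟧ = (1 + e) * r by rewrite rnormM pr rnormC ger0_norm//; lra.
have c1n : ⟦c1⟧ = (1 - e) * r by rewrite rnormM pr rnormC ger0_norm//; lra.
have er : 0 < e * r by rewrite mulr_gt0.
have c0p : ⟦c0 - p 0 i⟧ = e * r.
  rewrite /c0 rmorphD mulrDl mul1r addrAC subrr add0r rnormM pr rnormC ger0_norm//.
  exact: ltW.
have c0d : ⟦c0 - p 0 i⟧ < d by rewrite c0p; lra.
have rc0 : r < ⟦c0⟧ by rewrite c0n mulrDl mul1r ltrDl.
have cd x : ⟦x - c0⟧ <= 2 * (e * r) -> ⟦x - p 0 i⟧ < d.
  by have := rdistT x c0 (p 0 i); rewrite c0p; lra.
have hzero k : h k c0 = 0.
  apply: (@arc_vanish R (h k) c0 (2 * (e * r)) 2 c1).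
  - move=> x /ltW/cd xd; have [rx|xr] := ltP r ⟦x⟧; [left; exact: hdif|right; exact: hsmall].
  - move=> x /cd xd; have [rx|xr] := ltP r ⟦x⟧; last by rewrite h0// rnorm0.
    rewrite hE//; apply: le_trans (rnormB _ _) _.
    have [||_ a1] := hg (pt x l0); [exact: ptd|by rewrite pti|].
    have [||_ a2] := hg (pt x 0); [exact: ptd|by rewrite pti|].
    have b1 := le_trans (rnorm_coord (g (pt x l0)) k) (le_trans (rnorm_le_euclid _) (ltW a1)).
    have b2 := le_trans (rnorm_coord (g (pt x 0)) k) (le_trans (rnorm_le_euclid _) (ltW a2)).
    exact: lerD b1 b2.
  - rewrite (_ : c1 - c0 = ((- (2 * e))%:C)%C * p 0 i).
      by rewrite rnormM pr rnormC normrN ger0_norm; lra.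
    by rewrite /c0 /c1 -mulrBl -rmorphB; congr ((_%:C)%C * _); ring.
  - have : 0 < r - ⟦c1⟧ by rewrite c1n; lra.
    move=> /near_rnorm n1; apply: filterS (n1 _ c1) => y yc; apply: h0.
    by have := rnorm_dist y c1; lra.
have gE : g (pt c0 l0) = g (pt c0 0).
  apply/matrixP => a k; rewrite ord1; apply/eqP; rewrite -subr_eq0 -hE//.
  exact/eqP/hzero.
have : pt c0 l0 = pt c0 0 by apply: ginj gE; rewrite ?pti//; exact: ptd.
move=> /(congr1 (fun q : V => q 0 j)); rewrite !ptj => /addrI l00.
by move: l0n; rewrite l00 rnorm0; lra.
Qed.

End FaceEscape.

Section FridmanBound.
Context {R : realType} {n : nat} (r s : R) (z w : 'rV[Cplx R]_n).
Local Notation C := (Cplx R).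
Local Notation V := 'rV[C]_n.
Local Notation E := (@euclid_norm R n).
Local Notation D := (@shell R n r).
Hypotheses (n2 : (1 < n)%N) (r0 : 0 < r) (s0 : 0 < s)
  (margin : forall p : V, ⟦p⟧ < r + s + s + s -> E p < 1) (Dz : D z).
Hypotheses (wr : ⟦w⟧ = r)
  (wmin : forall v, ⟦v⟧ <= r -> E (ball_swap z w) <= E (ball_swap z v)).
Implicit Types (p q v : V).

Lemma face_coord : exists i, ⟦w 0 i⟧ = r.
Proof.
apply: contrapT => H; have : polydisc (n := n) r w.
  move=> i; rewrite -rnorm_modulus lt_neqAle -{2}wr rnorm_coord andbT.
  by apply/eqP => wi; apply: H; exists i.
by rewrite polydiscE //= wr ltxx.
Qed.

Lemma other_coord (i : 'I_n) : exists j, i != j.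
Proof.
have [->|i0] := eqVneq i (Ordinal n2); last by exists (Ordinal n2).
by exists (Ordinal (ltnW n2)).
Qed.

(** Shrinking all coordinates but the i-th moves [w] into an open face, where only the i-th
    coordinate decides membership in the polydisc. *)
Lemma face_interior (i : 'I_n) (A : set V) : ⟦w 0 i⟧ = r -> nbhs w A ->
  exists p, [/\ A p, ⟦p 0 i⟧ = r & forall l, l != i -> ⟦p 0 l⟧ < r].
Proof.
move=> wi /nbhsC[d d0 hd]; have rp := r0.
pose e : R := Num.min (d / (2 * r)) (1 / 2).
have [e0 e1 ed] : [/\ 0 < e, e <= 1 / 2 & e * r < d].
  have h1 : 0 < d / (2 * r) by rewrite divr_gt0// mulr_gt0.
  split; first by rewrite lt_min h1; lra.
    by rewrite ge_min lexx orbT.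
  apply: le_lt_trans (_ : d / (2 * r) * r < _).
    by rewrite ler_pM2r// ge_min lexx.
  rewrite (_ : d / (2 * r) * r = d / 2); first by lra.
  by field; rewrite gt_eqF.
clearbody e; have e2 : e <= 1 by lra.
pose p : V := \row_l if l == i then w 0 l else ((1 - e)%:C)%C * w 0 l.
have pE l : p 0 l = if l == i then w 0 l else ((1 - e)%:C)%C * w 0 l by rewrite mxE.
have wl l : ⟦w 0 l⟧ <= r by rewrite -wr rnorm_coord.
clearbody p; exists p; split.
- apply: hd; apply: le_lt_trans ed; apply: rnorm_row_le => [|l].
    by rewrite mulr_ge0 ?(ltW e0)// ltW.
  rewrite rowB pE; case: eqP => _; first by rewrite subrr rnorm0 mulr_ge0 ?(ltW e0)// ltW.
  rewrite rmorphB mulrBl mul1r addrAC subrr add0r rnormN rnormM rnormC ger0_norm ?(ltW e0)//.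
  by rewrite ler_pM2l.
- by rewrite pE eqxx.
- move=> l /negbTE li; rewrite pE li rnormM rnormC ger0_norm ?subr_ge0//.
  apply: le_lt_trans (_ : (1 - e) * r < r); first by rewrite ler_wpM2l ?subr_ge0.
  by rewrite mulrBl mul1r gtrBl mulr_gt0.
Qed.

(** If the bound failed, the inverse [g] of [f] would be defined on all points of the shell near
    [w], and would tend to the sphere at a piece of an open face; [no_face_escape] forbids this. *)
Lemma fridman_bound (rho : R) (f : V -> V) : holomorphic_maps unit_ball D f ->
  set_inj unit_ball f -> caratheodory_ball D z rho `<=` f @` unit_ball ->
  tanh rho <= E (ball_swap z w).
Proof.
move=> [df fD] finj hcov; rewrite leNgt; apply/negP => wt.
have rp := r0; have [z1 rz] := Dz; have ball := polydisc_ball s0 margin.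
have fD' x : E x < 1 -> D (f x) by move=> x1; apply: fD; exists x.
pose g y := xget 0 [set x | E x < 1 /\ f x = y].
have gf x : E x < 1 -> g (f x) = x.
  move=> x1; rewrite /g; case: xgetP => [x' _ [x1' fx]|/(_ x)]; last by case.
  by apply: finj; rewrite ?inE.
have cover q : D q -> E (ball_swap z q) < tanh rho -> exists2 x, E x < 1 & f x = q.
  move=> Dq qt; apply: hcov; split=> //.
  apply: le_lt_trans (caratheodory_swap_le n2 r0 s0 margin Dz Dq) _.
  rewrite lte_fin; apply: atanh_lt qt; first exact: euclid_ge0.
  by apply: ball_swap_lt1 => //; case: Dq.
have [i wi] := face_coord; have [j ij] := other_coord i.
have w1 : E w < 1 by apply: ball; rewrite wr.
have nw : \forall q \near w, E q < 1 /\ E (ball_swap z q) < tanh rho.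
  have h1 : \forall q \near w, E q < 1.
    have p0 : 0 < 1 - E w by rewrite subr_gt0.
    by have h := euclid_continuous w p0; apply: filterS h => q; rewrite ltr_norml ltrD2r => /andP[_].
  have h2 : \forall q \near w, E (ball_swap z q) < tanh rho.
    have p0 : 0 < tanh rho - E (ball_swap z w) by rewrite subr_gt0.
    have h := euclid_swap_near z1 w1 p0.
    by apply: filterS h => q; rewrite ltr_norml ltrD2r => /andP[_].
  exact: filterI.
have [p [pA pi pl]] := face_interior wi (nbhs_interior nw).
have near_small : \forall q \near p, forall l, l != i -> ⟦(q : V) 0 l⟧ < r.
  have H l : \forall q \near p, l != i -> ⟦(q : V) 0 l⟧ < r.
    have [->|li] := eqVneq l i; first by near=> q.
    have : 0 < r - ⟦p 0 l⟧ by rewrite subr_gt0 pl.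
    move=> /near_rnorm n1; apply: filterS (n1 _ p) => q qp _.
    have := rnorm_coord (q - p) l; rewrite rowB; have := rnorm_dist (q 0 l) (p 0 l).
    by move: qp; lra.
  exact: (@filter_forall V _ (fun l q => l != i -> ⟦q 0 l⟧ < r) (nbhs p) _ H).
have /nbhsC[d d0 hd] : \forall q \near p, (E q < 1 /\ E (ball_swap z q) < tanh rho) /\
    forall l, l != i -> ⟦(q : V) 0 l⟧ < r by exact: filterI.
have preim q : ⟦q - p⟧ < d -> r < ⟦q 0 i⟧ -> exists2 x, E x < 1 & f x = q.
  move=> /hd[[q1 qt] _] rq; apply: cover => //; split=> //.
  by apply: lt_le_trans rq _; exact: rnorm_coord.
apply: (@no_face_escape R n g p i j r d) => //.
- move=> q qd rq; have [x x1 <-] := preim q qd rq; rewrite gf//; split=> //.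
  have : \forall y \near x, E y < 1.
    have p0 : 0 < 1 - E x by rewrite subr_gt0.
    by have h := euclid_continuous x p0; apply: filterS h => y; rewrite ltr_norml ltrD2r => /andP[_].
  move=> /nbhsC[e e0 he].
  by apply: (inverse_differentiable e0) => y /he y1; [exact: df|exact: gf].
- move=> q q' qd rq qd' rq'; have [x x1 <-] := preim q qd rq.
  by have [x' x1' <-] := preim q' qd' rq'; rewrite !gf// => ->.
- move=> q qd qr e e0.
  (* The image of a smaller closed ball is compact and lies in the shell, hence stays away from the
     point [q] of the closed polydisc. *)
  have cl : closed (f @` [set x | E x <= 1 - e]).
    apply: compact_image_closed; first exact: compact_euclid_le.
    move=> x /= xe; apply: differentiable_continuous; apply: df.
    by rewrite /unit_ball /euclid_ball /=; apply: le_lt_trans xe _; rewrite ltrBlDr ltrDl.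
  have nq : ~ (f @` [set x | E x <= 1 - e]) q.
    move=> [x xe fx]; have [|_] := fD' x.
      by apply: le_lt_trans xe _; rewrite ltrBlDr ltrDl.
    rewrite fx ltNge => /negP; apply; apply: rnorm_row_le; first exact: ltW.
    move=> l; have [->//|li] := eqVneq l i.
    by have [_ h] := hd q qd; exact: ltW (h l li).
  have op : nbhs q (~` (f @` [set x | E x <= 1 - e])).
    by apply: open_nbhs_nbhs; split; [exact: closed_openC|exact: nq].
  apply: filterS2 (near_ball qd) op => q' qd' nq' rq'.
  have [x x1 fx] := preim q' qd' rq'; rewrite -fx gf//.
  by rewrite ltNge; apply/negP => xe; apply: nq'; exists x.
Unshelve. all: by end_near. Qed.

Lemma fridman_shell : fridman D z = E (ball_swap z w).
Proof.
have [z1 rz] := Dz.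
have m1 := swap_lt1 s0 margin Dz wr; have m0 := swap_gt0 s0 margin Dz wr.
apply: sup_max.
  have h := fridman_attained s0 margin Dz wr wmin.
  exists (atanh (E (ball_swap z w))); first exact: h.
  by rewrite atanhK// m1 andbT (lt_trans _ m0)// ltrN10.
by move=> _ [rho [_ [f [h1 h2 h3]]] <-]; exact: fridman_bound h1 h2 h3.
Qed.

End FridmanBound.

Theorem corollary3p3 (R : realType) (n : nat) (r : R) (z : 'rV[Cplx R]_n)
    (n_ge2 : (2 <= n)%N) (r_gt0 : 0 < r) (r_lt : r < 1 / Num.sqrt n%:R)
    (D := unit_ball `\` closure (polydisc (n:=n) r)) (Dz : D z) :
  squeezing D z = fridman D z /\
  is_min
    [set Num.sqrt (1 -
        (1 - euclid_norm w ^+ 2) * (1 - euclid_norm z ^+ 2) /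
        (1 - \sum_(i < n) modulus (z 0 i * w 0 i)) ^+ 2)
      | w in frontier (polydisc (n:=n) r)]
    (fridman D z).
Proof.
have [s s0 margin] := polydisc_margin r_gt0 r_lt.
have ball (p : 'rV[Cplx R]_n) : ⟦p⟧ <= r -> euclid_norm p < 1.
  exact: polydisc_ball s0 margin p.
have DE : D = shell r by exact: shellE.
rewrite DE in Dz *; have [z1 rz] := Dz.
have [w wr wmin] := closest_point r_gt0 ball z1 rz.
rewrite (squeezing_shell n_ge2 r_gt0 s0 margin Dz wr wmin).
rewrite (fridman_shell n_ge2 r_gt0 s0 margin Dz wr wmin); split=> //.
rewrite (frontier_polydisc r_gt0).
exact: (distance_bound_min ball z1 wr wmin).
Qed.
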